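(* Let $\Omega\subset\mathbb{R}^n$ be a smooth convex (possibly unbounded) domain and let $f\in C^1(\mathbb{R})$. Then there exists no non-degenerate pattern in $\Omega$; that is, every stable non-degenerate solution of $$-\Delta u=f(u)\ \text{ in }\Omega,\qquad \partial_\nu u=0\ \text{ on }\partial\Omega,\qquad u\in C^3(\overline\Omega),\ \nabla u\in L^\infty(\Omega),$$ is constant.
   Context: $\partial_\nu$ denotes the outward normal derivative on $\partial\Omega$. For a solution $u$, set $$\lambda_1:=\inf\Big\{\int_\Omega |\nabla\psi|^2-f'(u)\psi^2\ :\ \psi\in C^1_0(\overline\Omega),\ \|\psi\|_{L^2(\Omega)}=1\Big\},$$ where $C^1_0(\overline\Omega)$ is the space of continuously differentiable functions with compact support in $\overline\Omega$ (not necessarily vanishing on $\partial\Omega$). The solution $u$ is stable if $\lambda_1\ge 0$ and stable non-degenerate if $\lambda_1>0$. A pattern (resp. non-degenerate pattern) is a non-constant stable (resp. stable non-degenerate) solution. *)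

(* Defs.v *)
From HB Require Import structures.
From mathcomp Require Import all_boot all_order all_algebra.
From mathcomp Require Import all_classical all_reals all_analysis.

Set Implicit Arguments.
Unset Strict Implicit.
Unset Printing Implicit Defensive.

Import Order.TTheory GRing.Theory Num.Theory.
Import numFieldNormedType.Exports.

Local Open Scope classical_set_scope.
Local Open Scope ring_scope.

Section tuple_cons.
Context d (T : measurableType d) (n : nat).

Definition cons_pair (p : T * n.-tuple T) : n.+1.-tuple T :=
  [tuple of p.1 :: p.2].

Lemma measurable_cons_pair : measurable_fun [set: T * n.-tuple T] cons_pair.
Proof. exact: measurable_cons. Qed.

Definition uncons_tuple (t : n.+1.-tuple T) : T * n.-tuple T :=
  (thead t, [tuple of behead t]).

Lemma measurable_uncons_tuple :
  measurable_fun [set: n.+1.-tuple T] uncons_tuple.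
Proof.
apply/measurable_fun_pairP; split; first exact: measurable_tnth.
exact: measurable_behead.
Qed.

End tuple_cons.

Section measure_cons.
Context {R : realType} d (T : measurableType d) (n : nat).
Variables (m : {sigma_finite_measure set T -> \bar R})
          (mu : {sigma_finite_measure set (n.-tuple T) -> \bar R}).

Definition measure_cons : set (n.+1.-tuple T) -> \bar R :=
  pushforward (m \x mu)%E (@cons_pair d T n).

Let measure_cons0 : measure_cons set0 = 0%E.
Proof. by rewrite /measure_cons /pushforward preimage_set0 measure0. Qed.

Let measure_cons_ge0 A : (0 <= measure_cons A)%E.
Proof. exact: (measure_ge0 (m \x mu)%E). Qed.

Let measure_cons_sigma_additive : semi_sigma_additive measure_cons.
Proof.
apply: measure_semi_sigma_additive => ?; exact: measurable_cons_pair.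
Qed.

HB.instance Definition _ := isMeasure.Build _ _ _ measure_cons
  measure_cons0 measure_cons_ge0 measure_cons_sigma_additive.

Let measure_cons_sigma_finite : sigma_finite setT measure_cons.
Proof.
have /sigma_finiteP[F [TF ndF Foo]] := sigma_finiteT m.
have /sigma_finiteP[G [TG ndG Goo]] := sigma_finiteT mu.
exists (fun k => @uncons_tuple d T n @^-1` (F k `*` G k)).
  apply/esym/seteqP; split => // t _.
  have [i _ Fi] : (\bigcup_i F i) (uncons_tuple t).1 by rewrite -TF.
  have [j _ Gj] : (\bigcup_i G i) (uncons_tuple t).2 by rewrite -TG.
  exists (maxn i j) => //; split.
  - by move: Fi; exact/subsetPset/ndF/leq_maxl.
  - by move: Gj; exact/subsetPset/ndG/leq_maxr.
move=> k; have [mF Fk] := Foo k; have [mG Gk] := Goo k; split.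
  rewrite -[X in measurable X]setTI.
  by apply: measurable_uncons_tuple => //; exact: measurableX.
rewrite /measure_cons /pushforward -comp_preimage.
rewrite (_ : _ \o _ = id); last first.
  apply/funext => -[x t] /=; rewrite /uncons_tuple /cons_pair/= theadE.
  by congr (_, _); exact/val_inj.
by rewrite /= product_measure1E// lte_mul_pinfty// ge0_fin_numE.
Qed.

HB.instance Definition _ :=
  Measure_isSigmaFinite.Build _ _ _ measure_cons measure_cons_sigma_finite.

End measure_cons.

Fixpoint lebesgue_tuple (R : realType) n :
    {sigma_finite_measure set (n.-tuple (measurableTypeR R)) -> \bar R} :=
  match n with
  | 0 => \d_([tuple] : 0.-tuple (measurableTypeR R))
  | k.+1 => measure_cons lebesgue_measure (lebesgue_tuple R k)
  end.

Definition measure_row_display : measure_display.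
Proof. exact: default_measure_display. Qed.

(* The product sigma-algebra on 'rV[R]_n, generated by the coordinates; it is
   the Borel sigma-algebra of the usual topology. *)
Section measurable_row.
Context {R : realType} {n : nat}.

Let coords (i : 'I_n) (x : 'rV[R]_n) : measurableTypeR R := x ord0 i.

Let row_set0 : g_sigma_preimage coords set0.
Proof. exact: sigma_algebra0. Qed.

Let row_setC A : g_sigma_preimage coords A -> g_sigma_preimage coords (~` A).
Proof. exact: sigma_algebraC. Qed.

Let row_bigcup (F : _^nat) : (forall i, g_sigma_preimage coords (F i)) ->
  g_sigma_preimage coords (\bigcup_i (F i)).
Proof. exact: sigma_algebra_bigcup. Qed.

HB.instance Definition _ :=
  @isMeasurable.Build measure_row_display
    'rV[R]_n (g_sigma_preimage coords) row_set0 row_setC row_bigcup.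

Definition row_of_tuple (t : n.-tuple (measurableTypeR R)) : 'rV[R]_n :=
  \row_(i < n) tnth t i.

Lemma measurable_row_of_tuple :
  measurable_fun [set: n.-tuple (measurableTypeR R)] row_of_tuple.
Proof.
move=> _ A; rewrite setTI /measurable/= => mA.
have -> : g_sigma_preimage
    (fun (i : 'I_n) t => @tnth n (measurableTypeR R) t i) =
    preimage_set_system [set: n.-tuple (measurableTypeR R)] row_of_tuple
      (g_sigma_preimage coords).
  rewrite -g_sigma_preimage_comp; congr g_sigma_preimage.
  by apply/funext => i; apply/funext => t; rewrite /coords /= mxE.
by exists A => //; rewrite setTI.
Qed.

Definition lebesgue_row : set 'rV[R]_n -> \bar R :=
  pushforward (lebesgue_tuple R n) row_of_tuple.

Let lebesgue_row0 : lebesgue_row set0 = 0%E.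
Proof. by rewrite /lebesgue_row /pushforward preimage_set0 measure0. Qed.

Let lebesgue_row_ge0 A : (0 <= lebesgue_row A)%E.
Proof. exact: (measure_ge0 (lebesgue_tuple R n)). Qed.

Let lebesgue_row_sigma_additive : semi_sigma_additive lebesgue_row.
Proof.
by apply: measure_semi_sigma_additive => ?; exact: measurable_row_of_tuple.
Qed.

HB.instance Definition _ := isMeasure.Build _ _ _ lebesgue_row
  lebesgue_row0 lebesgue_row_ge0 lebesgue_row_sigma_additive.

End measurable_row.

Arguments lebesgue_row R n : clear implicits.

Section differential_calculus.
Context {R : realType} {n : nat}.
Implicit Types (u g rho : 'rV[R]_n -> R) (Omega U : set 'rV[R]_n).
Implicit Types (x v nu : 'rV[R]_n) (s : seq 'I_n) (k : nat).

(* The norm `|x| of the library on 'rV[R]_n is the sup norm. *)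
Definition enorm x : R := Num.sqrt (\sum_(i < n) x ord0 i ^+ 2).

Definition partial (i : 'I_n) u : 'rV[R]_n -> R :=
  fun x => 'D_(delta_mx ord0 i) u x.

Definition partials s u : 'rV[R]_n -> R := foldr partial u s.

Definition grad u x : 'rV[R]_n := \row_(i < n) partial i u x.

Definition laplacian u x : R := \sum_(i < n) partial i (partial i u) x.

(* The multi-index derivatives are given by sequences of coordinates.  Both
   conditions quantify over all of them, in every order. *)
Definition Ck_open k U u :=
  forall s, (size s <= k)%N ->
    (forall x, U x -> {for x, continuous (partials s u)}) /\
    ((size s < k)%N ->
      forall i x, U x -> derivable (partials s u) x (delta_mx ord0 i)).

Definition smooth_open U u := forall k, Ck_open k U u.

(* C^k(closure Omega): the partial derivatives of order at most k in Omega
   have continuous extensions to closure Omega.  The values of u outside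
   closure Omega are irrelevant. *)
Definition Ck_closure k Omega u :=
  [/\ Ck_open k Omega u,
      {within closure Omega, continuous u} &
      forall s, (size s <= k)%N -> exists g,
        {within closure Omega, continuous g} /\
        (forall x, Omega x -> g x = partials s u x)].

Definition frontier Omega : set 'rV[R]_n := closure Omega `\` Omega°.

(* The frontier of Omega is locally the regular level set [rho = 0], with Omega
   on the side [rho < 0]; hence grad rho points outward. *)
Definition local_defining Omega x U rho :=
  [/\ open U, U x, smooth_open U rho,
      (forall y, U y -> (Omega y <-> rho y < 0)) &
      (forall y, U y -> grad rho y != 0)].

Definition smooth_boundary Omega :=
  forall x, frontier Omega x -> exists U rho, local_defining Omega x U rho.

Definition outward_normal Omega x nu :=
  exists U rho, local_defining Omega x U rho /\
    nu = (enorm (grad rho x))^-1 *: grad rho x.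

(* At a frontier point the gradient of u is the limit of the gradients in
   Omega, i.e., the continuous extension provided by Ck_closure. *)
Definition normal_derivative Omega nu u x : R :=
  \sum_(i < n) nu ord0 i * lim (partial i u y @[y --> within Omega (nbhs x)]).

(* Connectedness follows from convexity. *)
Definition smooth_convex_domain Omega :=
  [/\ open Omega, Omega !=set0,
      convex_set (Omega : set (convex_lmodType 'rV[R]_n)) &
      smooth_boundary Omega].

Definition C1_real (f : R -> R) :=
  (forall t, derivable f t 1) /\ continuous (derive1 f).

(* [f \_ Omega] is the extension by 0 of f restricted to Omega, so that the
   norms below are those of L^p(Omega). *)
Definition solution Omega (f : R -> R) u :=
  [/\ Ck_closure 3 Omega u,
      ('N[lebesgue_row R n]_+oo[(fun x => (enorm (grad u x))%:E) \_ Omega] < +oo)%E,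
      (forall x, Omega x -> - laplacian u x = f (u x)) &
      (forall x nu, frontier Omega x -> outward_normal Omega x nu ->
        normal_derivative Omega nu u x = 0)].

Definition C1_compact Omega (psi : 'rV[R]_n -> R) :=
  Ck_closure 1 Omega psi /\
  compact (closure [set x | closure Omega x /\ psi x != 0]).

Definition lambda1 Omega (f : R -> R) u : \bar R :=
  ereal_inf [set (\int[lebesgue_row R n]_(x in Omega)
                    (enorm (grad psi x) ^+ 2 - derive1 f (u x) * psi x ^+ 2)%:E)%E
            | psi in [set psi | C1_compact Omega psi /\
               'N[lebesgue_row R n]_2%:E[(EFin \o psi) \_ Omega]%E = 1%E]].

Definition stable_nondegenerate Omega (f : R -> R) u :=
  (0 < lambda1 Omega f u)%E.

End differential_calculus.

(* Main.v *)
Require Import Defs.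
From mathcomp Require Import all_boot all_order all_algebra.
From mathcomp Require Import all_classical all_reals all_analysis.
From mathcomp Require Import measurable_realfun ess_sup_inf.
From mathcomp Require Import ring lra.

Set Implicit Arguments.
Unset Strict Implicit.
Unset Printing Implicit Defensive.

Import Order.TTheory GRing.Theory Num.Theory.
Import numFieldNormedType.Exports.

Local Open Scope classical_set_scope.
Local Open Scope ring_scope.

(* Test the stability inequality with chi u_i, where u_i is a first derivative
   of u and chi a cutoff at scale S around a fixed point of Omega.  Since u_i
   solves the linearized equation, summing over i gives, for F = chi^2 grad w
   and w = |grad u|^2 / 2,
     lambda int chi^2 |grad u|^2 <= int |grad chi|^2 |grad u|^2 + int div F.
   Convexity and the Neumann condition give N . grad w <= 0 on the frontier, so
   int div F <= 0 and int chi_S^2 |grad u|^2 <= (C / S^2) int chi_2S^2 |grad u|^2.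
   As grad u is bounded these integrals are O(S^n), and iterating shows that
   they vanish.

   The inequality int div F <= 0 requires neither a boundary integral nor a
   trace: multiply F by a cutoff eta of the homothetic domain
   a + (1 - e) (Omega - a), so that int div (eta F) = 0 by translation
   invariance.  As e -> 0, grad eta is of size 1 / e on a layer of volume O(e),
   and its direction is almost that of an inward normal. *)

(** * Lebesgue measure on row vectors *)

(** The shrunken domain is homothetic to Omega, not parallel to it, because scaling alone then gives
    its two features. A ball of radius r about a in Omega forces every point within r e of the
    shrunken domain to lie in Omega, and the layer left over near a has volume at most n e times
    that of Omega near a. The factors 1 / e and e cancel, so it is enough that F . (x - p) <= d |x -
    p|, p the nearest point of the shrunken domain, for each d > 0 and all small e. This is a
    compactness statement, and no boundary regularity of the shrunken domain is involved: the
    squared distance to any closed convex set is differentiable, and the cutoff is a function of it.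
    The derivatives of u reach the frontier only as continuous extensions from Omega. The sign of N
    . grad w is therefore read off a one-sided expansion between two frontier points, not from a
    curvature formula. The positivity of lambda decides the last step: once C / (lambda S^2) <=
    2^-(n+1), doubling S multiplies the integral by at least 2^(n+1), which a quantity of order S^n
    cannot sustain. *)

(** By uniqueness of Lebesgue measure: c times the pushforward has the right value on half-open
    intervals. *)
Lemma lebesgue_measure_affine (R : realType) (c b : R)
    (A : set (measurableTypeR R)) : 0 < c -> measurable A ->
  lebesgue_measure ((fun x : measurableTypeR R => c * x + b) @^-1` A) =
  ((c^-1)%:E * lebesgue_measure A)%E.
Proof.
move=> c0 mA.
have mf : measurable_fun [set: measurableTypeR R]
    (fun x => c * x + b : measurableTypeR R).
  by apply: measurable_funD => //; exact: measurable_funM.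
pose m := mscale (NngNum (ltW c0)) (pushforward lebesgue_measure
  (fun x : measurableTypeR R => c * x + b : measurableTypeR R)).
have -> : lebesgue_measure A = m mf A.
  apply: (@lebesgue_measure_unique R (m mf)) => // _ [[u v]] _ <-.
  rewrite /m /= /mscale /pushforward /=.
  have E : (fun x : measurableTypeR R => c * x + b) @^-1` `]u, v] =
     `](u - b) / c, (v - b) / c]%classic.
    apply/seteqP; split => x /=; rewrite !in_itv/=.
      by rewrite ltr_pdivrMr// ler_pdivlMr// ltrBlDr lerBrDr mulrC.
    by rewrite ltr_pdivrMr// ler_pdivlMr// ltrBlDr lerBrDr mulrC.
  pose I : set (measurableTypeR R) := `](u - b) / c, (v - b) / c]%classic.
  transitivity (c%:E * lebesgue_measure I)%E; last by rewrite /I -E.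
  rewrite /I.
  rewrite !lebesgue_measure_itv/= !lte_fin ltr_pM2r ?invr_gt0// ltrD2r.
  case: ifP => _; last by rewrite mule0.
  rewrite -!EFinD -EFinM; congr EFin; field; exact: lt0r_neq0.
rewrite /m /mscale /= muleA -EFinM mulVf ?lt0r_neq0// mul1e.
by [].
Qed.

Lemma ge0_integral_affine (R : realType) (c b : R)
    (f : measurableTypeR R -> \bar R) : 0 < c ->
  measurable_fun [set: measurableTypeR R] f -> (forall x, 0 <= f x)%E ->
  (\int[lebesgue_measure]_x f (c * x + b)%R =
  (c^-1)%:E * \int[lebesgue_measure]_x f x)%E.
Proof.
move=> c0 mf f0.
have maff : measurable_fun [set: measurableTypeR R]
    (fun x => c * x + b : measurableTypeR R).
  by apply: measurable_funD => //; exact: measurable_funM.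
have c'0 : 0 <= c^-1 by rewrite invr_ge0 ltW.
transitivity (\int[pushforward lebesgue_measure (fun x : measurableTypeR R => (c * x + b)%R : measurableTypeR R)]_x f x)%E.
  by rewrite ge0_integral_pushforward.
transitivity (\int[mscale (NngNum c'0) lebesgue_measure]_x f x)%E.
  apply: eq_measure_integral => A mA _.
  by rewrite /= /mscale /= /pushforward lebesgue_measure_affine.
by rewrite ge0_integral_mscale.
Qed.

Lemma mx_coord_le_norm (R : realType) n (x : 'rV[R]_n) i : `|x ord0 i| <= `|x|.
Proof.
rewrite [leRHS]/Num.Def.normr/= mx_normrE.
by apply/bigmax_geP; right; exists (ord0, i).
Qed.

Lemma mx_norm_le (R : realType) n (x : 'rV[R]_n) (e : R) : 0 <= e ->
  (forall i, `|x ord0 i| <= e) -> `|x| <= e.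
Proof.
move=> e0 xe; rewrite [leLHS]/Num.Def.normr/= mx_normrE.
by apply: bigmax_le => //= -[i j] _ /=; rewrite (ord1 i).
Qed.

Lemma mx_norm_lt (R : realType) n (x : 'rV[R]_n) (e : R) : 0 < e ->
  (forall i, `|x ord0 i| < e) -> `|x| < e.
Proof.
move=> e0 xe; rewrite [ltLHS]/Num.Def.normr/= mx_normrE.
by apply: bigmax_lt => //= -[i j] _ /=; rewrite (ord1 i).
Qed.

Lemma measurable_row_coord (R : realType) n (i : 'I_n) :
  measurable_fun [set: 'rV[R]_n] (fun x => x ord0 i : measurableTypeR R).
Proof.
move=> _ Y mY; rewrite setTI; apply: sub_sigma_algebra => /=.
rewrite -bigcup_seq/=; exists i => /=; first by rewrite mem_index_enum.
by exists Y => //; rewrite setTI.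
Qed.

Lemma measurable_row_ball (R : realType) n (x : 'rV[R]_n) (e : R) :
  measurable (ball x e).
Proof.
have [e0|e0] := leP e 0.
  by rewrite (_ : ball x e = set0)//; apply/seteqP; split=> // y; move/le0_ball0: e0 => ->.
rewrite (_ : ball x e = \bigcap_(i in [set: 'I_n])
    ((fun y : 'rV[R]_n => y ord0 i : measurableTypeR R) @^-1` ball (x ord0 i : R) e)).
  apply: fin_bigcap_measurable => [|i _]; first exact: finite_finset.
  rewrite -[X in measurable X]setTI; apply: measurable_row_coord => //.
  exact: measurable_ball.
apply/seteqP; split => y.
  rewrite -ball_normE/= => xy i _ /=; rewrite -ball_normE/=.
  by apply: le_lt_trans xy; have := mx_coord_le_norm (x - y) i; rewrite !mxE.
rewrite -!ball_normE/= => xy; apply: mx_norm_lt => // i.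
by have := xy i I; rewrite /= !mxE.
Qed.

(** The link between the topology and the coordinate sigma-algebra: U is the union of those balls
    with rational centre and radius 1 / (k + 1) that it contains, a countable family. *)
Lemma measurable_row_open (R : realType) n (U : set 'rV[R]_n) :
  open U -> measurable U.
Proof.
move=> oU.
pose F (p : 'rV[rat]_n * nat) : set 'rV[R]_n :=
  let B := ball (map_mx ratr p.1 : 'rV[R]_n) (p.2.+1%:R^-1) in
  if `[< B `<=` U >] then B else set0.
rewrite (_ : U = \bigcup_p F p).
  apply: countable_bigcupT_measurable => // p; rewrite /F.
  by case: ifP => // _; exact: measurable_row_ball.
apply/seteqP; split => [x Ux|x [p _]]; last first.
  by rewrite /F; case: ifP => // /asboolP; apply.
have /nbhs_ballP[e /= e0 xeU] : nbhs x U by exact: open_nbhs_nbhs.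
have [k ke] : exists k : nat, k.+1%:R^-1 < e / 2.
  have [k _ /(_ k) ke] := near_infty_natSinv_lt (PosNum (divr_gt0 e0 (@ltr0n R 2))).
  by exists k; exact: ke (leqnn k).
have [q xq] : exists q : 'rV[rat]_n, ball (map_mx ratr q : 'rV[R]_n) (k.+1%:R^-1) x.
  have H i : {q : rat | `|x ord0 i - ratr q| < k.+1%:R^-1}.
    apply/cid; have := @rat_in_itvoo R (x ord0 i - k.+1%:R^-1) (x ord0 i + k.+1%:R^-1).
    case; first by rewrite ltrD2l gt0_cp// invr_gt0.
    by move=> q; rewrite in_itv/= => qx; exists q; rewrite distrC ltr_distl.
  exists (\row_i sval (H i)); rewrite -ball_normE/=.
  apply: mx_norm_lt => [|i]; first by rewrite invr_gt0.
  by rewrite !mxE distrC; exact: (svalP (H i)).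
exists (q, k) => //; rewrite /F/=; case: ifPn => // /asboolP; apply.
apply: subset_trans xeU => y qy; rewrite (splitr e).
apply: (@ball_triangle _ _ (map_mx ratr q : 'rV[R]_n)).
  by apply/ball_sym; apply: le_ball xq; exact: ltW.
by apply: le_ball qy; exact: ltW.
Qed.

(** The translation is a sequence over [nat], so that passing to the tail of the tuple is just
    [b \o S]. *)
Definition affine_tuple (R : realType) n (c : R) (b : nat -> R)
    (t : n.-tuple (measurableTypeR R)) : n.-tuple (measurableTypeR R) :=
  mktuple (fun i : 'I_n => c * tnth t i + b i).

Lemma affine_tuple_cons (R : realType) n (c : R) b
    (p : measurableTypeR R * n.-tuple (measurableTypeR R)) :
  affine_tuple c b (cons_pair p) =
  cons_pair (c * p.1 + b 0%N, affine_tuple c (b \o S) p.2).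
Proof.
apply: eq_from_tnth => i; rewrite tnth_mktuple.
have [->|i0] := eqVneq i ord0; first by rewrite !tnth0.
have i1n : (i.-1 < n)%N by rewrite prednK ?lt0n// -ltnS.
have -> : i = lift ord0 (Ordinal i1n).
  by apply: val_inj => /=; rewrite /bump/= add1n prednK// lt0n.
by rewrite !tnthS tnth_mktuple.
Qed.

(** Induction on n through the product measure: the induction hypothesis rescales the sections, and
    the one-dimensional change of variables rescales the outer integral. *)
Lemma lebesgue_tuple_affine (R : realType) n (c : R) b
    (A : set (n.-tuple (measurableTypeR R))) : 0 < c -> measurable A ->
  lebesgue_tuple R n (affine_tuple c b @^-1` A) =
  ((c^-1 ^+ n)%:E * lebesgue_tuple R n A)%E.
Proof.
move=> c0; elim: n b A => [b A mA|n ih b A mA].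
  rewrite expr0 mul1e; congr (_ _); apply/seteqP; split => t /=;
    by rewrite [affine_tuple _ _ _]tuple0 [t]tuple0.
rewrite /= /measure_cons /pushforward /product_measure1.
pose cp := @cons_pair _ (measurableTypeR R) n.
have mA' : measurable (cp @^-1` A).
  by rewrite -[X in measurable X]setTI; apply: measurable_cons_pair.
transitivity (\int[lebesgue_measure]_x
   ((c^-1 ^+ n)%:E * (lebesgue_tuple R n \o xsection (cp @^-1` A)) (c * x + b 0%N)%R))%E.
  apply: eq_integral => x _ /=; rewrite -(ih (b \o S)); last exact: measurable_xsection.
  by congr (_ _); apply/seteqP; split => t; rewrite /xsection/= !inE/= affine_tuple_cons.
have mf : measurable_fun [set: measurableTypeR R]
  (lebesgue_tuple R n \o xsection (cp @^-1` A)).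
  exact: measurable_fun_xsection.
rewrite ge0_integralZl//; last 2 first.
  - apply: (measurableT_comp mf).
    by apply: measurable_funD => //; exact: measurable_funM.
  - by rewrite lee_fin exprn_ge0// invr_ge0 ltW.
rewrite (@ge0_integral_affine R c (b 0%N) _ c0 mf)//.
by rewrite muleA -EFinM exprSr.
Qed.

Lemma lebesgue_row_affine (R : realType) n (c : R) (b : 'rV[R]_n)
    (A : set 'rV[R]_n) : 0 < c -> measurable A ->
  lebesgue_row R n ((fun x => c *: x + b) @^-1` A) =
  ((c^-1 ^+ n)%:E * lebesgue_row R n A)%E.
Proof.
move=> c0 mA; rewrite /lebesgue_row /pushforward.
have mA' : measurable (@row_of_tuple R n @^-1` A).
  by rewrite -[X in measurable X]setTI; apply: measurable_row_of_tuple.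
pose b' k := if insub k is Some i then b ord0 i else 0.
rewrite -(lebesgue_tuple_affine b' c0 mA').
have E : (fun x => c *: x + b) \o @row_of_tuple R n =
    @row_of_tuple R n \o affine_tuple c b'.
  apply/funext => t /=; apply/rowP => i; rewrite !mxE tnth_mktuple.
  by rewrite /b' valK.
by rewrite -[X in lebesgue_tuple R n X]/(((fun x => c *: x + b) \o @row_of_tuple R n) @^-1` A) E.
Qed.

Lemma lebesgue_row_cube1 (R : realType) n :
  lebesgue_row R n [set x | forall i, -1 < x ord0 i < 1] = (2 ^+ n)%:E.
Proof.
rewrite /lebesgue_row /pushforward /=.
rewrite (_ : _ @^-1` _ = [set t : n.-tuple (measurableTypeR R) | forall i, -1 < tnth t i < 1]); last first.
  by apply/seteqP; split => t /= H i; have := H i; rewrite mxE.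
elim: n => [|n ih].
  rewrite /= diracE mem_set//=; by case.
rewrite /= /measure_cons /pushforward.
rewrite (_ : _ @^-1` _ = (`]-1, 1[%classic : set (measurableTypeR R)) `*`
   [set t : n.-tuple (measurableTypeR R) | forall i, -1 < tnth t i < 1]); last first.
  apply/seteqP; split => [[x t]|[x t]] /=.
    move=> H; split; first by rewrite in_itv/=; exact: H ord0.
    by move=> i; have := H (lift ord0 i); rewrite tnthS.
  move=> [x1 t1] i; have [->|i0] := eqVneq i ord0; first by move: x1; rewrite in_itv/= tnth0.
  have i1n : (i.-1 < n)%N by rewrite prednK ?lt0n// -ltnS.
  have -> : i = lift ord0 (Ordinal i1n).
    by apply: val_inj => /=; rewrite /bump/= add1n prednK// lt0n.
  by rewrite tnthS.
rewrite product_measure1E//=; last first.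
  rewrite (_ : [set _ | _] = \bigcap_(i in [set: 'I_n])
    ((fun t : n.-tuple (measurableTypeR R) => tnth t i) @^-1` `]-1, 1[%classic)).
    apply: fin_bigcap_measurable => [|i _]; first exact: finite_finset.
    by rewrite -[X in measurable X]setTI; apply: measurable_tnth.
  apply/seteqP; split => t /= H i; first by move=> _ /=; rewrite in_itv/=; exact: H.
  by have := H i I; rewrite /= in_itv.
rewrite ih lebesgue_measure_itv/= lte_fin ifT; last by lra.
by rewrite -EFinD -EFinM exprS; congr (_ * _)%:E; lra.
Qed.

(** Balls of the sup norm are cubes of side 2 e; one affine map reduces to the unit cube. *)
Lemma lebesgue_row_ball (R : realType) n (x : 'rV[R]_n) (e : R) : 0 < e ->
  lebesgue_row R n (ball x e) = ((2 * e) ^+ n)%:E.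
Proof.
move=> e0.
have e0' : 0 < e^-1 by rewrite invr_gt0.
rewrite (_ : ball x e = (fun y => e^-1 *: y + (- e^-1 *: x)) @^-1` ball 0 1).
  rewrite lebesgue_row_affine//; last exact: measurable_row_ball.
  rewrite invrK exprMn mulrC EFinM; congr (_ * _)%E.
  rewrite -lebesgue_row_cube1; congr (lebesgue_row R n _).
  apply/seteqP; split => y; rewrite -ball_normE/= sub0r normrN.
    by move=> y1 i; rewrite -ltr_norml; apply: le_lt_trans y1; exact: mx_coord_le_norm.
  by move=> y1; apply: mx_norm_lt => // i; rewrite ltr_norml.
apply/seteqP; split => y; rewrite -!ball_normE/= sub0r normrN scaleNr -scalerBr normrZ gtr0_norm// distrC ltr_pdivrMl// mulr1//.
Qed.

Lemma measurable_fun_row_open (R : realType) n (D : set 'rV[R]_n)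
    (f : 'rV[R]_n -> R) : open D -> (forall x, D x -> {for x, continuous f}) ->
  measurable_fun D f.
Proof.
move=> oD cf mD; apply: (measurability _ (RGenOInfty.measurableE R)) => //.
move=> /= _ [_ [a ->] <-]; apply: measurable_row_open.
rewrite openE => x [Dx /=]; rewrite in_itv/= andbT => ax.
apply: filterI; first exact: open_nbhs_nbhs.
near do rewrite /= in_itv/= andbT.
exact: (cvgr_gt (f x) (cf x Dx)).
Unshelve. all: by end_near. Qed.

(** * Differential calculus *)

Section neighbourhoods.
Context {R : realType} {V : normedModType R}.

Lemma near_normP (x : V) (P : V -> Prop) : (\forall y \near x, P y) <->
  exists2 r : R, 0 < r & forall y, `|y - x| < r -> P y.
Proof.
split=> [/nbhs_ballP[r /= r0 H]|[r r0 H]]; last first.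
  by apply/nbhs_ballP; exists r => //= y; rewrite -ball_normE/= distrC; exact: H.
by exists r => // y yr; apply: H; rewrite -ball_normE/= distrC.
Qed.

Lemma continuous_normP (f : V -> R) (x : V) : {for x, continuous f} <->
  (forall e : R, 0 < e ->
     exists2 r : R, 0 < r & forall y, `|y - x| < r -> `|f y - f x| <= e).
Proof.
split=> [/cvgrPdist_le H e /H/near_normP[r r0 K]|H].
  by exists r => // y /K; rewrite distrC.
apply/cvgrPdist_le => e /H[r r0 K]; apply/near_normP; exists r => // y yr.
by rewrite distrC; apply: K; exact: yr.
Qed.

End neighbourhoods.

Section continuity.
Context {R : realType} {T : topologicalType}.
Implicit Types (f g : T -> R) (t : T).

Lemma continuous_at_cst t (c : R) : continuous_at t (fun _ : T => c).
Proof. exact: cvg_cst. Qed.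

Lemma continuous_atD f g t : continuous_at t f -> continuous_at t g ->
  continuous_at t (fun s : T => f s + g s).
Proof. by move=> cf cg; apply: cvgD. Qed.

Lemma continuous_atN f t : continuous_at t f ->
  continuous_at t (fun s : T => - f s).
Proof. by move=> cf; apply: cvgN. Qed.

Lemma continuous_atB f g t : continuous_at t f -> continuous_at t g ->
  continuous_at t (fun s : T => f s - g s).
Proof. by move=> cf cg; apply: cvgB. Qed.

Lemma continuous_atM f g t : continuous_at t f -> continuous_at t g ->
  continuous_at t (fun s : T => f s * g s).
Proof. by move=> cf cg; apply: cvgM. Qed.

Lemma continuous_atX2 f t : continuous_at t f ->
  continuous_at t (fun s : T => f s ^+ 2).
Proof. by move=> cf; apply: cvgM. Qed.

Lemma continuous_at_max f g t : continuous_at t f -> continuous_at t g ->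
  continuous_at t (fun s : T => Num.max (f s) (g s)).
Proof. by move=> cf cg; exact: continuous_max. Qed.

Lemma continuous_at_sum m (F : 'I_m -> T -> R) t :
  (forall i, continuous_at t (F i)) ->
  continuous_at t (fun s : T => \sum_i F i s).
Proof.
move=> cF; elim: m F cF => [F _|m ih F cF].
  by under eq_fun do rewrite big_ord0; exact: cvg_cst.
under eq_fun do rewrite big_ord_recr/=.
by apply: continuous_atD => //; exact: ih.
Qed.

Lemma continuous_at_comp (h : R -> R) f t : continuous_at t f ->
  {for f t, continuous h} -> continuous_at t (fun s : T => h (f s)).
Proof. by move=> cf ch; apply: (continuous_comp cf ch). Qed.

End continuity.

Section directional.
Context {R : realType} {V : normedModType R}.
Implicit Types (f : V -> R) (x v : V).

(** Restricting to a line turns directional derivatives into derivatives of one real variable, so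
    that the chain rule, the mean value theorem and the intermediate value theorem become
    available. *)
Lemma is_derive_line f x v (t d : R) :
  is_derive (t *: v + x) v f d <-> is_derive t 1 (fun h : R => f (h *: v + x)) d.
Proof.
have E : (fun h : R => h^-1 *: ((f \o shift (t *: v + x)) (h *: v) - f (t *: v + x))) =
    (fun h : R => h^-1 *: (((fun h : R => f (h *: v + x)) \o shift t) (h *: (1 : R)) -
       f (t *: v + x))).
  by apply/funext => h /=; rewrite [h *: (1 : R)]mulr1 scalerDl addrA.
by split=> -[dv ev]; split; move: dv ev; rewrite /derivable /derive E.
Qed.

Lemma is_derive_estimate f x v (d : R) :
  (forall e : R, 0 < e -> exists2 r : R, 0 < r & forall h : R, `|h| < r ->
    `|f (h *: v + x) - f x - h * d| <= e * `|h|) -> is_derive x v f d.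
Proof.
move=> H.
have C : (fun h : R => h^-1 *: ((f \o shift x) (h *: v) - f x)) h @[h --> 0^'] --> d.
  apply/cvgrPdist_le => e e0; have [r r0 Hr] := H e e0.
  near=> h.
  have h0 : h != 0 by near: h; exact: nbhs_dnbhs_neq.
  have hr : `|h| < r by near: h; apply: dnbhs0_lt.
  rewrite distrC /= -(ler_pM2r (_ : 0 < `|h|)) ?normr_gt0// -normrM.
  apply: le_trans (Hr h hr); rewrite le_eqVlt; apply/orP; left; apply/eqP; congr (`|_|).
  by rewrite mulrBl [_ *: _]mulrC divfK// [d * h]mulrC.
by split; [apply/cvg_ex; exists d|apply/cvg_lim].
Unshelve. all: by end_near. Qed.

Lemma is_derive_comp1 (g : R -> R) f x v (dg df : R) :
  is_derive (f x) 1 g dg -> is_derive x v f df ->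
  is_derive x v (g \o f) (dg * df).
Proof.
move=> Hg Hf.
have Hf0 : is_derive (0 *: v + x) v f df by rewrite scale0r add0r.
suff : is_derive (0 *: v + x) v (g \o f) (dg * df) by rewrite scale0r add0r.
apply/is_derive_line; move/is_derive_line : Hf0 => Hf0.
apply: (@is_derive1_comp _ g (fun h : R => f (h *: v + x))) => //.
by rewrite scale0r add0r.
Qed.

Lemma is_derive_scale_direction f x v (c d : R) :
  is_derive x v f d -> is_derive x (c *: v) f (c * d).
Proof.
move=> H.
have H0 : is_derive (0 *: v + x) v f d by rewrite scale0r add0r.
suff : is_derive (0 *: (c *: v) + x) (c *: v) f (c * d) by rewrite scale0r add0r.
apply/is_derive_line; move/is_derive_line : H0 => H0.
have -> : (fun h : R => f (h *: (c *: v) + x)) =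
    (fun h : R => f (h *: v + x)) \o (fun h : R => c * h).
  by apply/funext => h /=; rewrite scalerA mulrC.
rewrite mulrC; apply: is_derive1_comp; first by rewrite mulr0.
by rewrite -[X in is_derive _ _ _ X]mulr1; exact: is_deriveZ.
Qed.

Lemma is_derive_shift f x v a (d : R) :
  is_derive (x + a) v f d -> is_derive x v (fun y => f (y + a)) d.
Proof.
have E : (fun h : R => h^-1 *: ((f \o shift (x + a)) (h *: v) - f (x + a))) =
   (fun h : R => h^-1 *: (((fun y => f (y + a)) \o shift x) (h *: v) - f (x + a))).
  by apply/funext => h /=; rewrite addrA.
by move=> -[dv ev]; split; move: dv ev; rewrite /derivable /derive E.
Qed.

Lemma MVT_direction f x v (df : R -> R) :
  (forall t : R, 0 <= t <= 1 -> is_derive (t *: v + x) v f (df t)) ->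
  exists2 t : R, 0 < t < 1 & f (v + x) - f x = df t.
Proof.
move=> H.
have H1 (t : R) : 0 <= t <= 1 -> is_derive t 1 (fun h : R => f (h *: v + x)) (df t).
  by move=> t01; apply/is_derive_line; exact: H.
have [| |c c01 E] := @MVT R (fun h : R => f (h *: v + x)) df 0 1 ltr01.
- by move=> t; rewrite in_itv/= => /andP[t0 t1]; apply: H1; rewrite !ltW.
- apply: derivable_within_continuous => t; rewrite in_itv/= => t01.
  by have [] := H1 t t01.
exists c; first by move: c01; rewrite in_itv.
by move: E; rewrite subr0 mulr1 scale1r scale0r add0r.
Qed.

End directional.

Section partials.
Context {R : realType} {n : nat}.
Implicit Types (f : 'rV[R]_n -> R) (x v w : 'rV[R]_n) (i j : 'I_n).

Local Notation e_ i := (delta_mx ord0 i : 'rV[R]_n).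

Lemma norm_delta_mx_row i : `|e_ i| <= 1.
Proof.
by apply: mx_norm_le => // j; rewrite mxE eqxx/=; case: (_ == _); rewrite ?normr1 ?normr0.
Qed.

Lemma partial_is_derive f x i : derivable f x (e_ i) ->
  is_derive x (e_ i) f (partial i f x).
Proof. by move=> /derivableP. Qed.

Lemma is_derive_partial f x i (d : R) : is_derive x (e_ i) f d ->
  partial i f x = d.
Proof. by move=> [_ <-]. Qed.

Local Opaque partial.

Lemma increment_partials f x (r e : R) w : 0 < e ->
  (forall y : 'rV[R]_n, `|y - x| < r -> forall i, derivable f y (e_ i) /\
     `|partial i f y - partial i f x| <= e) ->
  `|w| < r ->
  `|f (w + x) - f x - \sum_i w ord0 i * partial i f x| <= e * \sum_i `|w ord0 i|.
Proof.
move=> e0 H wr.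
pose p (k : nat) : 'rV[R]_n := \row_i (if (i < k)%N then w ord0 i else 0).
have p0 : p 0%N = 0 by apply/rowP => i; rewrite !mxE.
have pn : p n = w by apply/rowP => i; rewrite !mxE ltn_ord.
have pS i : p i.+1 = w ord0 i *: e_ i + p i.
  apply/rowP => j; rewrite !mxE eqxx/= ltnS leq_eqVlt.
  rewrite -(inj_eq val_inj) /=.
  have [ji|ji] := eqVneq (j : nat) i; last by rewrite mulr0 add0r.
  by rewrite ji ltnn mulr1 addr0 (val_inj ji).
have -> : f (w + x) - f x = \sum_(i < n) (f (p i.+1 + x) - f (p i + x)).
  rewrite -(big_mkord xpredT (fun k => f (p k.+1 + x) - f (p k + x))).
  by rewrite (telescope_sumr (fun k => f (p k + x)))// pn p0 add0r.
rewrite -sumrB; apply: le_trans (ler_norm_sum _ _ _) _.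
rewrite mulr_sumr; apply: ler_sum => i _.
have pr (t : R) : 0 <= t <= 1 -> `|t *: (w ord0 i *: e_ i) + (p i + x) - x| < r.
  move=> /andP[t0 t1]; rewrite addrA addrK; apply: le_lt_trans wr.
  apply: mx_norm_le => // j; rewrite !mxE eqxx/=.
  have [->|ji] := eqVneq j i.
    rewrite ltnn mulr1 addr0 normrM ger0_norm//.
    by apply: le_trans (mx_coord_le_norm _ i); rewrite ler_piMl.
  rewrite !mulr0 add0r; case: ifP => _; first exact: mx_coord_le_norm.
  by rewrite normr0.
have D (t : R) : 0 <= t <= 1 -> is_derive (t *: (w ord0 i *: e_ i) + (p i + x))
    (w ord0 i *: e_ i) f (w ord0 i * partial i f (t *: (w ord0 i *: e_ i) + (p i + x))).
  move=> t01; have [/derivableP + _] := H _ (pr t t01) i.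
  exact: is_derive_scale_direction.
have [t /andP[t0 t1]] := MVT_direction D.
rewrite addrA -pS => ->; rewrite -mulrBr normrM mulrC ler_wpM2r//.
by have [] := H _ (pr t _) i; rewrite ?(ltW t0) ?(ltW t1).
Qed.

Lemma C1_is_derive f x v :
  (forall i, \forall y \near x, derivable f y (e_ i)) ->
  (forall i, {for x, continuous (partial i f)}) ->
  is_derive x v f (\sum_i v ord0 i * partial i f x).
Proof.
move=> df cf; apply: is_derive_estimate => e e0.
pose e' := e / (1 + \sum_i `|v ord0 i|).
have s0 : 0 < 1 + \sum_i `|v ord0 i| by rewrite ltr_pwDl// sumr_ge0.
have e'0 : 0 < e' by rewrite divr_gt0.
have : \forall y \near x, forall i, derivable f y (e_ i) /\ `|partial i f y - partial i f x| <= e'.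
  have := @filter_forall _ _ (fun i y => derivable f y (e_ i) /\ `|partial i f y - partial i f x| <= e') (nbhs x) _.
  apply => i; apply: filterI; first exact: df.
  have := cf i => /cvgrPdist_le /(_ _ e'0); apply: filterS => y; by rewrite distrC.
move=> /nbhs_ballP[r /= r0 H].
exists (r / (1 + `|v|)) => [|h hr]; first by rewrite divr_gt0// ltr_pwDl.
have hvr : `|h *: v| < r.
  rewrite normrZ; move: hr; rewrite ltr_pdivlMr ?ltr_pwDl//; apply: le_lt_trans.
  by rewrite ler_wpM2l// lerDr.
have := @increment_partials f x r e' (h *: v) e'0 _ hvr.
move=> /(_ _)/wrap[y yr|]; first by apply: H; rewrite -ball_normE/= distrC.
have -> : \sum_i (h *: v) ord0 i * partial i f x = h * \sum_i v ord0 i * partial i f x.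
  by rewrite mulr_sumr; apply: eq_bigr => i _; rewrite mxE mulrA.
move=> /le_trans; apply.
have -> : \sum_i `|(h *: v) ord0 i| = `|h| * \sum_i `|v ord0 i|.
  by rewrite mulr_sumr; apply: eq_bigr => i _; rewrite mxE normrM.
rewrite mulrCA [leRHS]mulrC ler_wpM2l// /e' -mulrA ler_piMr ?(ltW e0)//.
by rewrite mulrC ler_pdivrMr// mul1r lerDr.
Qed.

(** The mean value theorem twice: along e_i for the increment of f in the direction e_j, then along
    e_j for [partial i f]. *)
Lemma second_difference f x i j (t : R) : 0 < t ->
  (forall y : 'rV[R]_n, `|y - x| <= 2 * t -> derivable f y (e_ i) /\ derivable (partial i f) y (e_ j)) ->
  exists2 y : 'rV[R]_n, `|y - x| <= 2 * t &
    f (t *: e_ i + x + t *: e_ j) - f (t *: e_ i + x) - (f (x + t *: e_ j) - f x)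
    = t ^+ 2 * partial j (partial i f) y.
Proof.
move=> t0 H.
have B (a b : R) : 0 <= a <= 1 -> 0 <= b <= 1 ->
    `|b *: (t *: e_ j) + (a *: (t *: e_ i) + x) - x| <= 2 * t.
  move=> /andP[a0 a1] /andP[b0 b1]; rewrite addrA addrK mulr_natl mulr2n.
  rewrite (le_trans (ler_normD _ _))// lerD// !normrZ !ger0_norm ?(ltW t0)//.
    rewrite mulrA -[leRHS]mulr1 ler_pM ?norm_delta_mx_row// ?mulr_ge0 ?(ltW t0)//.
    by rewrite ler_piMl// ltW.
  rewrite mulrA -[leRHS]mulr1 ler_pM ?norm_delta_mx_row// ?mulr_ge0 ?(ltW t0)//.
  by rewrite ler_piMl// ltW.
pose F (y : 'rV[R]_n) := f (y + t *: e_ j) - f y.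
pose y0 (a : R) : 'rV[R]_n := a *: (t *: e_ i) + x.
have D1 (a : R) : 0 <= a <= 1 -> is_derive (y0 a) (t *: e_ i) F
    (t * (partial i f (y0 a + t *: e_ j) - partial i f (y0 a))).
  move=> a01; apply: is_derive_scale_direction; apply: is_deriveB.
    apply: is_derive_shift; apply: partial_is_derive.
    have -> : y0 a + t *: e_ j = 1 *: (t *: e_ j) + (a *: (t *: e_ i) + x).
      by rewrite scale1r addrC.
    by have [] := H _ (B a 1 a01 _); rewrite ?ler01 ?lexx.
  apply: partial_is_derive.
  by have := B a 0 a01; rewrite scale0r add0r lexx ler01 => /(_ isT)/H[].
have [a /andP[a0 a1]] := MVT_direction D1.
have a01 : 0 <= a <= 1 by rewrite !ltW.
rewrite /F => ->.
have Ba b := B a b a01; move: Ba; rewrite -/(y0 a).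
move: (y0 a) => z {D1 B y0 F} B.
have D2 (b : R) : 0 <= b <= 1 -> is_derive (b *: (t *: e_ j) + z) (t *: e_ j)
   (partial i f) (t * partial j (partial i f) (b *: (t *: e_ j) + z)).
  move=> /B/H[_ Dj]; apply: is_derive_scale_direction.
  exact: partial_is_derive.
have [b /andP[b0 b1]] := MVT_direction D2.
rewrite [t *: e_ j + z]addrC => ->; exists (b *: (t *: e_ j) + z); last by rewrite expr2 mulrA.
by apply: B => //; rewrite !ltW.
Qed.

(** The second difference is symmetric in i and j. By [second_difference] it equals t^2 times either
    mixed derivative at some point within 2 t of x, and continuity at x concludes. *)
Lemma schwarz f x i j :
  (\forall y \near x, [/\ derivable f y (e_ i), derivable f y (e_ j),
     derivable (partial i f) y (e_ j) & derivable (partial j f) y (e_ i)]) ->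
  {for x, continuous (partial j (partial i f))} ->
  {for x, continuous (partial i (partial j f))} ->
  partial j (partial i f) x = partial i (partial j f) x.
Proof.
move=> df cji cij; apply/eqP; rewrite -subr_eq0 -normr_le0.
apply/ler_addgt0Pr => e e0; rewrite add0r.
have e20 : 0 < e / 2 by rewrite divr_gt0.
have [r1 r10 H1] := (near_normP _ _).1 df.
have [r2 r20 H2] := (continuous_normP _ _).1 cji _ e20.
have [r3 r30 H3] := (continuous_normP _ _).1 cij _ e20.
pose r := Num.min r1 (Num.min r2 r3).
have r0 : 0 < r by rewrite !lt_min r10 r20.
have Hr y : `|y - x| < r -> [/\
   [/\ derivable f y (e_ i), derivable f y (e_ j),
     derivable (partial i f) y (e_ j) & derivable (partial j f) y (e_ i)],
    `|partial j (partial i f) y - partial j (partial i f) x| <= e / 2 &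
    `|partial i (partial j f) y - partial i (partial j f) x| <= e / 2].
  by rewrite !lt_min => /and3P[/H1 ? /H2 ? /H3 ?]; split.
pose t := r / 4.
have t0 : 0 < t by rewrite divr_gt0.
have tr y : `|y - x| <= 2 * t -> `|y - x| < r.
  by move=> yt; apply: le_lt_trans yt _; rewrite /t; lra.
have [y1 y1t E1] : exists2 y : 'rV[R]_n, `|y - x| <= 2 * t &
    f (t *: e_ i + x + t *: e_ j) - f (t *: e_ i + x) - (f (x + t *: e_ j) - f x)
    = t ^+ 2 * partial j (partial i f) y.
  by apply: (second_difference t0) => y yt; have [[]] := Hr y (tr y yt).
have [y2 y2t E2] : exists2 y : 'rV[R]_n, `|y - x| <= 2 * t &
    f (t *: e_ j + x + t *: e_ i) - f (t *: e_ j + x) - (f (x + t *: e_ i) - f x)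
    = t ^+ 2 * partial i (partial j f) y.
  by apply: (second_difference t0) => y yt; have [[]] := Hr y (tr y yt).
have [_ y1e _] := Hr y1 (tr y1 y1t).
have [_ _ y2e] := Hr y2 (tr y2 y2t).
have E : partial j (partial i f) y1 = partial i (partial j f) y2.
  apply: (@mulfI _ (t ^+ 2)); first by rewrite expf_neq0// lt0r_neq0.
  have K (v w : 'rV[R]_n) : f (v + x + w) - f (v + x) - (f (x + w) - f x) =
      f (w + x + v) - f (w + x) - (f (x + v) - f x).
    by rewrite (addrC v x) (addrC w x) (addrAC x v w); ring.
  exact: etrans (esym E1) (etrans (K _ _) E2).
rewrite E distrC in y1e.
apply: le_trans (ler_distD (partial i (partial j f) y2) _ _) _.
by apply: le_trans (lerD y1e y2e) _; rewrite -splitr.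
Qed.

End partials.

(** * Projections and cutoffs *)

Section dot.
Context {R : realType} {n : nat}.
Implicit Types (x y z v w : 'rV[R]_n).

(** The norm of the library on rows is the sup norm. Projections and normals need the Euclidean
    structure, which is carried by [dot] and compared with the norm by [dot_le_norm] and
    [norm_le_dot]. *)
Definition dot x y : R := \sum_i x ord0 i * y ord0 i.

Lemma dotC x y : dot x y = dot y x.
Proof. by apply: eq_bigr => i _; rewrite mulrC. Qed.

Lemma dotDl x y z : dot (x + y) z = dot x z + dot y z.
Proof. by rewrite -big_split; apply: eq_bigr => i _; rewrite mxE mulrDl. Qed.

Lemma dotZl (a : R) x z : dot (a *: x) z = a * dot x z.
Proof. by rewrite mulr_sumr; apply: eq_bigr => i _; rewrite mxE mulrA. Qed.

Lemma dotNl x z : dot (- x) z = - dot x z.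
Proof. by rewrite -scaleN1r dotZl mulN1r. Qed.

Lemma dotBl x y z : dot (x - y) z = dot x z - dot y z.
Proof. by rewrite dotDl dotNl. Qed.

Lemma dotDr x y z : dot z (x + y) = dot z x + dot z y.
Proof. by rewrite !(dotC z) dotDl. Qed.

Lemma dotZr (a : R) x z : dot z (a *: x) = a * dot z x.
Proof. by rewrite !(dotC z) dotZl. Qed.

Lemma dotNr x z : dot z (- x) = - dot z x.
Proof. by rewrite !(dotC z) dotNl. Qed.

Lemma dotBr x y z : dot z (x - y) = dot z x - dot z y.
Proof. by rewrite !(dotC z) dotBl. Qed.

Lemma sqdist_expand x y : dot (x - y) (x - y) = dot x x - 2 * dot x y + dot y y.
Proof. by rewrite !(dotBl, dotBr) (dotC y x); ring. Qed.

Lemma dot0l x : dot 0 x = 0.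
Proof. by rewrite -(scale0r x) dotZl mul0r. Qed.

Lemma dot_ge0 x : 0 <= dot x x.
Proof. by apply: sumr_ge0 => i _; rewrite -expr2 sqr_ge0. Qed.

Lemma sqr_coord_le_dot x i : x ord0 i ^+ 2 <= dot x x.
Proof.
by rewrite /dot (bigD1 i)//= expr2 lerDl sumr_ge0// => j _; rewrite -expr2 sqr_ge0.
Qed.

Lemma dot_eq0 x : dot x x = 0 -> x = 0.
Proof.
move=> x0; apply/rowP => i; rewrite mxE; apply/eqP; rewrite -sqrf_eq0.
by rewrite eq_le sqr_ge0 andbT -x0 sqr_coord_le_dot.
Qed.

Lemma dot_le_norm x : dot x x <= n%:R * `|x| ^+ 2.
Proof.
rewrite mulr_natl -[X in _ *+ X]card_ord -sumr_const ler_sum// => i _.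
by rewrite -expr2 -real_normK ?num_real// lerXn2r ?nnegrE// mx_coord_le_norm.
Qed.

Lemma norm_le_dot x (r : R) : 0 <= r -> dot x x <= r ^+ 2 -> `|x| <= r.
Proof.
move=> r0 xr; apply: mx_norm_le => // i.
rewrite -(@ler_pXn2r _ 2)// ?nnegrE// real_normK ?num_real//.
exact: le_trans (sqr_coord_le_dot x i) xr.
Qed.

Lemma enorm_sqr x : enorm x ^+ 2 = dot x x.
Proof.
rewrite /enorm sqr_sqrtr; last by apply: sumr_ge0 => i _; exact: sqr_ge0.
by apply: eq_bigr => i _; rewrite expr2.
Qed.

Lemma continuous_coord i x : continuous_at x (fun y : 'rV[R]_n => y ord0 i).
Proof. exact: coord_continuous. Qed.

Lemma continuous_dot (T : topologicalType) (F G : T -> 'rV[R]_n) (t : T) :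
  (forall i, continuous_at t (fun s : T => F s ord0 i)) ->
  (forall i, continuous_at t (fun s : T => G s ord0 i)) ->
  continuous_at t (fun s : T => dot (F s) (G s)).
Proof.
by move=> cF cG; apply: continuous_at_sum => i; exact: continuous_atM.
Qed.

End dot.

Section projection.
Context {R : realType} {n : nat}.
Implicit Types (x y z v w : 'rV[R]_n) (K : set 'rV[R]_n).

Definition segment_convex K := forall x y (t : R), K x -> K y -> 0 <= t <= 1 ->
  K (t *: x + (1 - t) *: y).

Definition sqdist x y : R := dot (x - y) (x - y).

(** The default value x is returned only if no minimizer exists; [nearestP] excludes this for K
    closed and nonempty. *)
Definition nearest K x : 'rV[R]_n :=
  xget x [set z | K z /\ forall y, K y -> sqdist x z <= sqdist x y].

Definition dist2 K x : R := sqdist x (nearest K x).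

Lemma continuous_sqdist x y : continuous_at y (sqdist x).
Proof.
apply: (@continuous_dot _ _ _ (fun z => x - z) (fun z => x - z) y) => i;
  under eq_fun do rewrite mxE [X in _ + X]mxE;
  by apply: continuous_atB; [exact: continuous_at_cst|exact: continuous_coord].
Qed.

Section proj_theory.
Variable K : set 'rV[R]_n.
Hypotheses (K0 : K !=set0) (clK : closed K) (cvxK : segment_convex K).

(** The points of K no farther from x than a given z0 in K form a compact set; a minimizer there is
    a minimizer on K. *)
Lemma nearestP x : K (nearest K x) /\ forall y, K y -> sqdist x (nearest K x) <= sqdist x y.
Proof.
rewrite /nearest; case: xgetP => [z _ //|H]; exfalso.
have [z0 Kz0] := K0.
pose C := K `&` [set y | sqdist x y <= sqdist x z0].
have cC : compact C.
  apply: bounded_closed_compact.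
    (* The inequality q <= (1 + q)^2 for q >= 0 spares a square root. *)
    exists (`|x| + (1 + sqdist x z0)); split; first exact: num_real.
    move=> M HM y [_ /= yz0].
    rewrite (le_trans _ (ltW HM))// -[y](subrKC x) (le_trans (ler_normD _ _))// lerD2l.
    rewrite distrC; apply: norm_le_dot; first by rewrite addr_ge0// dot_ge0.
    apply: le_trans yz0 _; have := dot_ge0 (x - z0); rewrite -/(sqdist x z0); nra.
  apply: closedI => //.
  exact: (closed_comp (fun y _ => @continuous_sqdist x y) (@closed_le _ _)).
have [c /[!inE] -[Kc cz0] cmin] := @EVT_min_rV R n (sqdist x) C
  (ex_intro _ z0 (conj Kz0 (lexx _))) cC (continuous_subspaceT (@continuous_sqdist x)).
apply: (H c); split => // y Ky.
have [yz0|yz0] := leP (sqdist x y) (sqdist x z0); first by apply: cmin; rewrite inE.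
exact: le_trans cz0 (ltW yz0).
Qed.

Lemma nearest_in x : K (nearest K x).
Proof. by have [] := nearestP x. Qed.

Lemma dist2_le x y : K y -> dist2 K x <= sqdist x y.
Proof. by have [_] := nearestP x; apply. Qed.

Lemma dist2_ge0 x : 0 <= dist2 K x.
Proof. exact: dot_ge0. Qed.

Lemma nearest_id x : K x -> nearest K x = x.
Proof.
move=> Kx; have := dist2_le x Kx; rewrite /sqdist subrr dot0l => H.
have : dist2 K x = 0 by apply/eqP; rewrite eq_le H dist2_ge0.
by move/dot_eq0/eqP; rewrite subr_eq0 eq_sym => /eqP.
Qed.

Lemma dist2_in x : K x -> dist2 K x = 0.
Proof. by move=> Kx; rewrite /dist2 nearest_id// /sqdist subrr dot0l. Qed.

(** Compare the nearest point p with the points t y + (1 - t) p of K: this gives 2 t d <= t^2 s. If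
    d > 0, the choice t = d / (d + s) yields 2 (d + s) <= s, which is absurd. *)
Lemma nearest_normal x y : K y -> dot (x - nearest K x) (y - nearest K x) <= 0.
Proof.
move=> Ky; set p := nearest K x; set d := dot _ _.
rewrite leNgt; apply/negP => d0.
pose s := dot (y - p) (y - p); have s0 : 0 <= s by exact: dot_ge0.
have H t : 0 <= t <= 1 -> 2 * t * d <= t ^+ 2 * s.
  move=> t01; have := dist2_le x (cvxK Ky (nearest_in x) t01).
  rewrite -/p /dist2 /sqdist -/p.
  have -> : x - (t *: y + (1 - t) *: p) = (x - p) - t *: (y - p).
    by apply/rowP => i; rewrite !mxE; ring.
  rewrite (sqdist_expand (x - p)) !(dotZl, dotZr) -/d -/s; lra.
have ds : 0 < d + s by rewrite ltr_pwDl.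
have := H (d / (d + s)); have r0 : 0 < d / (d + s) by rewrite divr_gt0.
have r1 : d / (d + s) <= 1 by rewrite ler_pdivrMr// mul1r lerDl.
rewrite (ltW r0) r1 => /(_ isT).
rewrite -mulrA [2 * _]mulrC -mulrA expr2 -mulrA ler_pM2l//.
rewrite mulrAC ler_pdivlMr//; nra.
Qed.

(** With p and q the nearest points, the two inequalities [nearest_normal] add up to |p - q|^2 <= (x
    - y) . (p - q); then expand |(x - y) - (p - q)|^2 >= 0. *)
Lemma nearest_nonexpansive x y : sqdist (nearest K x) (nearest K y) <= sqdist x y.
Proof.
have H1 := nearest_normal x (nearest_in y); have H2 := nearest_normal y (nearest_in x).
have H3 := dot_ge0 ((x - y) - (nearest K x - nearest K y)).
move: H1 H2 H3; rewrite /sqdist; move: (nearest K x) (nearest K y) => p q.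
rewrite !(dotBl, dotBr).
rewrite (dotC y x) (dotC p x) (dotC p y) (dotC q x) (dotC q y) (dotC q p); lra.
Qed.

Lemma continuous_nearest i x : continuous_at x (fun y => nearest K y ord0 i).
Proof.
apply/continuous_normP => e e0.
have n0 : 0 < n%:R + 1 :> R by rewrite ltr_wpDl.
exists (e / (n%:R + 1)) => [|y yr]; first by rewrite divr_gt0.
have -> : nearest K y ord0 i - nearest K x ord0 i = (nearest K y - nearest K x) ord0 i.
  by rewrite !mxE.
apply: le_trans (mx_coord_le_norm _ _) _.
apply: norm_le_dot; first exact: ltW.
apply: le_trans (nearest_nonexpansive _ _) _.
apply: le_trans (dot_le_norm _) _.
move: yr; rewrite ltr_pdivlMr// => yr.
have := normr_ge0 (y - x); move: yr; set a := `|_| => yr a0.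
have nn : 0 <= n%:R :> R by [].
have : (a * (n%:R + 1)) ^+ 2 <= e ^+ 2.
  by rewrite lerXn2r ?nnegrE ?mulr_ge0 ?addr_ge0//= ltW.
apply: le_trans; rewrite exprMn mulrC ler_wpM2l ?sqr_ge0//; nra.
Qed.

Lemma continuous_sub_nearest i x :
  continuous_at x (fun y => (y - nearest K y) ord0 i).
Proof.
under eq_fun do rewrite mxE [X in _ + X]mxE.
by apply: continuous_atB; [exact: continuous_coord|exact: continuous_nearest].
Qed.

Lemma continuous_dist2 x : continuous_at x (dist2 K).
Proof.
by apply: (@continuous_dot _ _ _ (fun y => y - nearest K y)
  (fun y => y - nearest K y) x) => i; exact: continuous_sub_nearest.
Qed.

(** The nearest point of x is a competitor for h + x, which gives the upper bound. The nearest point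
    of h + x is a competitor for x, which gives the lower bound once nonexpansiveness controls the
    difference of the two points. *)
Lemma dist2_quadratic x h :
  `|dist2 K (h + x) - dist2 K x - 2 * dot (x - nearest K x) h| <= dot h h.
Proof.
have H1 := dist2_le (h + x) (nearest_in x).
have H2 := dist2_le x (nearest_in (h + x)).
have H3 := nearest_nonexpansive x (h + x).
move: H1 H2 H3; rewrite /dist2 /sqdist; move: (nearest K x) (nearest K (h + x)) => p q.
have H4 := dot_ge0 ((p - q) + h).
move: H4; rewrite !(dotBl, dotBr, dotDl, dotDr).
rewrite (dotC x h) (dotC p x) (dotC p h) (dotC q x) (dotC q h) (dotC q p).
rewrite ler_norml; lra.
Qed.

Lemma is_derive_dist2 x v : is_derive x v (dist2 K) (2 * dot (x - nearest K x) v).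
Proof.
apply: is_derive_estimate => e e0.
have v0 : 0 < 1 + dot v v by rewrite ltr_pwDl// dot_ge0.
exists (e / (1 + dot v v)) => [|h hr]; first by rewrite divr_gt0.
have := dist2_quadratic x (h *: v).
rewrite !dotZr dotZl mulrCA => /le_trans; apply.
rewrite mulrA -expr2 -real_normK ?num_real// expr2 mulrAC ler_wpM2r//.
move: hr; rewrite ltr_pdivlMr// => /ltW; apply: le_trans.
by rewrite ler_wpM2l// lerDr.
Qed.

End proj_theory.
End projection.

(** * Cutoffs built from the squared distance to a convex set *)

Section cutoff.
Context {R : realType} {n : nat}.
Implicit Types (x y z v w : 'rV[R]_n) (K : set 'rV[R]_n).

(** The square makes the positive part continuously differentiable, as the test functions must
    be. *)
Definition possqr (s : R) : R := Num.max 0 s ^+ 2.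

Lemma is_derive_possqr (s : R) : is_derive s 1 possqr (2 * Num.max 0 s).
Proof.
apply: is_derive_estimate => e e0; exists e => // h he.
have -> : h *: (1 : R) + s = h + s by rewrite [_ *: _]mulr1.
apply: (@le_trans _ _ (`|h| ^+ 2)); last by rewrite expr2 ler_wpM2r// ltW.
rewrite real_normK ?num_real// ler_norml /possqr.
have [s0|s0] := leP 0 s; have [hs0|hs0] := leP 0 (h + s); apply/andP; split; nra.
Qed.

(** Used for two sets K: the shrunken domain, where it is the layer cutoff eta, and a single point,
    where it is the cutoff chi at scale s. It equals 1 on K and 0 at distance s or more. *)
Definition cutoff K (s : R) x : R := possqr (1 - dist2 K x / s ^+ 2).

(** The scalar factor of the gradient of [cutoff], which is [cut_slope K s x] times x -
    [nearest K x]. It is never positive: the gradient points towards K. *)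
Definition cut_slope K (s : R) x : R :=
  - (4 * Num.max 0 (1 - dist2 K x / s ^+ 2) / s ^+ 2).

Section cut_theory.
Variables (K : set 'rV[R]_n) (s : R).
Hypotheses (K0 : K !=set0) (clK : closed K) (cvxK : segment_convex K).
Hypothesis s0 : 0 < s.

Lemma is_derive_cut x v :
  is_derive x v (cutoff K s) (cut_slope K s x * dot (x - nearest K x) v).
Proof.
have s20 : s ^+ 2 != 0 by rewrite expf_neq0// lt0r_neq0.
have D : is_derive x v (fun y => 1 - dist2 K y / s ^+ 2)
    (0 - (s ^+ 2)^-1 * (2 * dot (x - nearest K x) v)).
  have -> : (fun y => 1 - dist2 K y / s ^+ 2) =
      cst 1 - ((s ^+ 2)^-1 \*: dist2 K).
    by apply/funext => y; rewrite /= !fctE/= [X in _ = _ - X]mulrC.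
  apply: is_deriveB; apply: is_deriveZ; exact: is_derive_dist2.
have := @is_derive_comp1 _ _ possqr (fun y => 1 - dist2 K y / s ^+ 2) x v _ _ (is_derive_possqr _) D.
suff -> : cut_slope K s x * dot (x - nearest K x) v =
  2 * Num.max 0 (1 - dist2 K x / s ^+ 2) * (0 - s ^- 2 * (2 * dot (x - nearest K x) v)) by [].
by rewrite /cut_slope; move: (s ^+ 2)^-1 => c; ring.
Qed.

Lemma cutoff_ge0 x : 0 <= cutoff K s x.
Proof. exact: sqr_ge0. Qed.

Lemma max_cut_le1 x : Num.max 0 (1 - dist2 K x / s ^+ 2) <= 1.
Proof.
by rewrite ge_max ler01 lerBlDr lerDl divr_ge0 ?dist2_ge0// exprn_ge0// ltW.
Qed.

Lemma cutoff_le1 x : cutoff K s x <= 1.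
Proof. by rewrite exprn_ile1// ?max_cut_le1// le_max lexx. Qed.

Lemma cutoff_in x : K x -> cutoff K s x = 1.
Proof.
by move=> Kx; rewrite /cutoff /possqr dist2_in// mul0r subr0 max_r// expr1n.
Qed.

Lemma cut_far x : s ^+ 2 <= dist2 K x ->
  Num.max 0 (1 - dist2 K x / s ^+ 2) = 0.
Proof.
by move=> sx; rewrite max_l// subr_le0 ler_pdivlMr ?mul1r// exprn_gt0.
Qed.

Lemma cut_far0 x : s ^+ 2 <= dist2 K x -> cutoff K s x = 0.
Proof. by move=> sx; rewrite /cutoff /possqr cut_far// expr0n. Qed.

Lemma cut_slope_far0 x : s ^+ 2 <= dist2 K x -> cut_slope K s x = 0.
Proof. by move=> sx; rewrite /cut_slope cut_far// mulr0 mul0r oppr0. Qed.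

Lemma continuous_max_cut x :
  continuous_at x (fun y => Num.max 0 (1 - dist2 K y / s ^+ 2)).
Proof.
apply: continuous_at_max; first exact: continuous_at_cst.
apply: continuous_atB; first exact: continuous_at_cst.
by apply: continuous_atM; [exact: continuous_dist2|exact: continuous_at_cst].
Qed.

Lemma continuous_cut x : continuous_at x (cutoff K s).
Proof. by apply: continuous_atX2; exact: continuous_max_cut. Qed.

Lemma continuous_cut_slope x : continuous_at x (cut_slope K s).
Proof.
apply: continuous_atN; apply: continuous_atM; last exact: continuous_at_cst.
by apply: continuous_atM; [exact: continuous_at_cst|exact: continuous_max_cut].
Qed.

(** The left-hand side is the Euclidean length of the gradient of the cutoff. It vanishes at
    distance s or more, and below that distance the square root is at most s. *)
Lemma cut_slope_bound x : `|cut_slope K s x| * Num.sqrt (dist2 K x) <= 4 / s.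
Proof.
have [h|h] := leP (s ^+ 2) (dist2 K x).
  by rewrite cut_slope_far0// normr0 mul0r divr_ge0// ltW.
have q : Num.sqrt (dist2 K x) <= s.
  by rewrite -[leRHS]gtr0_norm// -sqrtr_sqr ler_sqrt ?ltW// exprn_gt0.
pose m := Num.max 0 (1 - dist2 K x / s ^+ 2).
have m0 : 0 <= m by rewrite le_max lexx.
have m1 : m <= 1 by exact: max_cut_le1.
have i0 : 0 <= (s ^+ 2)^-1 by rewrite invr_ge0 sqr_ge0.
rewrite /cut_slope -/m normrN ger0_norm; last first.
  by apply: mulr_ge0 => //; apply: mulr_ge0.
apply: (@le_trans _ _ (4 / s ^+ 2 * s)); last first.
  have s1 : s != 0 by exact: lt0r_neq0.
  by rewrite le_eqVlt; apply/orP; left; apply/eqP; field.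
apply: ler_pM => //; first by apply: mulr_ge0 => //; apply: mulr_ge0.
by rewrite ler_wpM2r// ler_piMr.
Qed.

End cut_theory.
End cutoff.

(** * Homothetic shrinking of convex domains *)

Section convex_domain.
Context {R : realType} {n : nat}.
Implicit Types (x y z v w a : 'rV[R]_n) (Omega K : set 'rV[R]_n).

Lemma convex_set_segment Omega :
  convex_set (Omega : set (convex_lmodType 'rV[R]_n)) -> segment_convex Omega.
Proof.
move=> cO x y t Ox Oy /andP[t0 t1].
have t01 : Itv.spec (@Itv.num_sem R) (Itv.Real `[0%Z, 1%Z]) t.
  by apply/and3P; split; rewrite ?num_real//= in_itv/= ?t0 ?t1.
have := cO x y (Itv.mk t01).
by rewrite !inE => /(_ Ox Oy).
Qed.

Lemma closure_normP Omega x : closure Omega x <->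
  forall e : R, 0 < e -> exists2 y, Omega y & `|y - x| < e.
Proof.
split=> [cx e e0|H B /near_normP[r r0 rB]]; last first.
  by have [y Oy yr] := H r r0; exists y; split => //; exact: rB.
have [|y [Oy By]] := cx (fun y => `|y - x| < e).
  by apply: (near_normP x _).2; exists e.
by exists y.
Qed.

Lemma open_normP Omega x : open Omega -> Omega x ->
  exists2 r : R, 0 < r & forall y, `|y - x| < r -> Omega y.
Proof.
by move=> oO Ox; apply/near_normP; exact: (open_nbhs_nbhs (conj oO Ox)).
Qed.

Lemma closure_segment_convex Omega :
  segment_convex Omega -> segment_convex (closure Omega).
Proof.
move=> cO x y t /closure_normP cx /closure_normP cy t01.
apply/closure_normP => e e0.
have [x' Ox' xx'] := cx e e0; have [y' Oy' yy'] := cy e e0.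
exists (t *: x' + (1 - t) *: y'); first exact: cO.
have -> : t *: x' + (1 - t) *: y' - (t *: x + (1 - t) *: y) =
    t *: (x' - x) + (1 - t) *: (y' - y).
  by apply/rowP => i; rewrite !mxE; ring.
case/andP: t01 => t0 t1.
rewrite (le_lt_trans (ler_normD _ _))// !normrZ !ger0_norm ?subr_ge0//.
set A := `|_| in xx' *; set B := `|_| in yy' *.
apply: (@le_lt_trans _ _ (Num.max A B)); last by rewrite gt_max xx'.
have : A <= Num.max A B by rewrite le_max lexx.
have : B <= Num.max A B by rewrite le_max lexx orbT.
nra.
Qed.

(** Replace x by a close x' in Omega and compensate by moving y to y', which stays in a ball of
    Omega about y because t < 1. *)
Lemma open_closure_segment Omega x y (t : R) : open Omega ->
  segment_convex Omega -> closure Omega x -> Omega y -> 0 <= t < 1 ->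
  Omega (t *: x + (1 - t) *: y).
Proof.
move=> oO cO /closure_normP cx Oy /andP[t0 t1].
have [r r0 Hr] := open_normP oO Oy.
have t1' : 0 < 1 - t by rewrite subr_gt0.
have [x' Ox' xx'] := cx ((1 - t) * r) (mulr_gt0 t1' r0).
pose y' := y + (t / (1 - t)) *: (x - x').
have -> : t *: x + (1 - t) *: y = t *: x' + (1 - t) *: y'.
  by apply/rowP => i; rewrite !mxE; field; exact: lt0r_neq0.
apply: cO => //; last by rewrite t0 ltW.
apply: Hr; rewrite /y' addrC addKr normrZ ger0_norm ?divr_ge0 ?(ltW t1')// distrC.
rewrite mulrAC ltr_pdivrMr// mulrC [r * _]mulrC; apply: le_lt_trans xx'.
by rewrite ler_piMr// ltW.
Qed.

(* The image of closure Omega under the homothety of centre a and ratio 1 - e. *)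
Definition shrink Omega a (e : R) : set 'rV[R]_n :=
  [set z | closure Omega (a + (1 - e)^-1 *: (z - a))].

Section shrink_theory.
Variables (Omega : set 'rV[R]_n) (a : 'rV[R]_n) (e r : R).
Hypotheses (oO : open Omega) (cO : segment_convex Omega).
Hypotheses (r0 : 0 < r) (ar : forall y, `|y - a| < r -> Omega y).
Hypotheses (e0 : 0 < e) (e1 : e < 1).

Lemma domain_center : Omega a.
Proof. by apply: ar; rewrite subrr normr0. Qed.

Lemma shrink_center : shrink Omega a e a.
Proof.
by rewrite /shrink/= subrr scaler0 addr0; exact/subset_closure/domain_center.
Qed.

Lemma shrink_closed : closed (shrink Omega a e).
Proof.
have e1' : 0 < 1 - e by rewrite subr_gt0.
move=> z /closure_normP cz; apply/closure_normP => d d0.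
have d20 : 0 < d / 2 by rewrite divr_gt0.
have [z' Kz' zz'] := cz ((1 - e) * (d / 2)) (mulr_gt0 e1' d20).
have [y Oy yz'] := (closure_normP _ _).1 Kz' _ d20.
exists y => //; rewrite (splitr d).
apply: le_lt_trans (ler_distD (a + (1 - e)^-1 *: (z' - a)) _ _) _.
rewrite ltrD//.
have -> : a + (1 - e)^-1 *: (z' - a) - (a + (1 - e)^-1 *: (z - a)) =
    (1 - e)^-1 *: (z' - z).
  by apply/rowP => i; rewrite !mxE; move: ((1 - e)^-1) => c; ring.
by rewrite normrZ gtr0_norm ?invr_gt0// ltr_pdivrMl.
Qed.

Lemma shrink_convex : segment_convex (shrink Omega a e).
Proof.
move=> x y t Kx Ky t01; rewrite /shrink/=.
have -> : a + (1 - e)^-1 *: (t *: x + (1 - t) *: y - a) =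
   t *: (a + (1 - e)^-1 *: (x - a)) + (1 - t) *: (a + (1 - e)^-1 *: (y - a)).
  by apply/rowP => i; rewrite !mxE; move: ((1 - e)^-1) => c; ring.
by apply: closure_segment_convex.
Qed.

(** The point w is the combination, with weights 1 - e and e, of a point of the closure and of y = a
    + (w - z) / e, which lies in the ball of radius r about a. *)
Lemma shrink_thick z w : shrink Omega a e z -> `|w - z| < r * e -> Omega w.
Proof.
move=> Kz zw; have e1' : 0 < 1 - e by rewrite subr_gt0.
pose y := a + e^-1 *: (w - z).
have Oy : Omega y.
  apply: ar; rewrite /y addrC addKr normrZ gtr0_norm ?invr_gt0//.
  by rewrite ltr_pdivrMl// mulrC.
have -> : w = (1 - e) *: (a + (1 - e)^-1 *: (z - a)) + (1 - (1 - e)) *: y.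
  by apply/rowP => i; rewrite !mxE; field; rewrite !lt0r_neq0.
by apply: open_closure_segment => //; rewrite ltW//= ltrBlDr ltrDl.
Qed.

Lemma shrink_homothety x : Omega x -> shrink Omega a e ((1 - e) *: x + e *: a).
Proof.
move=> Ox; apply: subset_closure.
suff -> : a + (1 - e)^-1 *: ((1 - e) *: x + e *: a - a) = x by [].
by apply/rowP => i; rewrite !mxE; field; rewrite subr_eq0 gt_eqF.
Qed.

End shrink_theory.
End convex_domain.

(** * Integration over row vectors and integrals of partial derivatives *)

Section row_integral.
Context {R : realType} {n : nat}.
Local Notation mu := (lebesgue_row R n).
Implicit Types (f : 'rV[R]_n -> R) (D : set 'rV[R]_n).

Lemma measurable_fun_row d (T : measurableType d) (f : T -> 'rV[R]_n) :
  (forall i, measurable_fun [set: T] (fun t => f t ord0 i : measurableTypeR R)) ->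
  measurable_fun [set: T] f.
Proof.
move=> mf _ A mA; rewrite setTI.
have : preimage_set_system [set: T] f (@measurable _ 'rV[R]_n) `<=` measurable.
  rewrite (_ : @measurable _ 'rV[R]_n = g_sigma_preimage
    (fun i (x : 'rV[R]_n) => x ord0 i : measurableTypeR R))//.
  rewrite -g_sigma_preimage_comp.
  apply: smallest_sub; first exact: sigma_algebra_measurable.
  move=> B; rewrite -bigcup_seq/= => -[i _ [C mC <-]].
  exact: mf.
by apply; exists A => //; rewrite setTI.
Qed.

Lemma measurable_row_affine (c : R) (b : 'rV[R]_n) :
  measurable_fun [set: 'rV[R]_n] (fun x : 'rV[R]_n => c *: x + b).
Proof.
apply: measurable_fun_row => i; under eq_fun do rewrite !mxE.
by apply: measurable_funD => //; apply: measurable_funM => //; exact: measurable_row_coord.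
Qed.

Lemma integrable_bounded_support D f (L M : R) : measurable D ->
  measurable_fun D f -> (forall x, D x -> `|f x| <= L) ->
  (forall x, D x -> M <= `|x| -> f x = 0) -> mu.-integrable D (EFin \o f).
Proof.
move=> mD mf fL fM; apply/integrableP; split; first exact/measurable_EFinP.
pose M' := Num.max M 1; have M'0 : 0 < M' by rewrite lt_max ltr01 orbT.
pose B := ball (0 : 'rV[R]_n) M'.
have mB : measurable B by exact: measurable_row_ball.
apply: (@le_lt_trans _ _ (\int[mu]_(x in D) ((cst (`|L|%:E : \bar R)) \_ B) x)%E).
  apply: ge0_le_integral => //.
  - by apply: measurableT_comp => //; exact/measurable_EFinP.
  - apply/(measurable_restrict _ mB mD) => //.
  - move=> x Dx /=; rewrite patchE; case: ifPn => [_|].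
      by rewrite lee_fin (le_trans (fL _ Dx))// ler_norm.
    rewrite notin_setE /B -ball_normE/= sub0r normrN => /negP; rewrite -leNgt => xM.
    by rewrite fM ?normr0//; apply: le_trans xM; rewrite le_max lexx.
rewrite -integral_mkcondr integral_cst//; last exact: measurableI.
rewrite lte_mul_pinfty//; apply: le_lt_trans (_ : mu B < +oo)%E.
  have mDB := measurableI _ _ mD mB.
  by apply: le_measure; rewrite ?inE//; exact: subIsetr.
by rewrite lebesgue_row_ball// ltry.
Qed.

Lemma integrable_EFinD D f g : measurable D -> mu.-integrable D (EFin \o f) ->
  mu.-integrable D (EFin \o g) ->
  mu.-integrable D (EFin \o (fun x => f x + g x)).
Proof.
move=> mD intf intg.
have -> : EFin \o (fun x => f x + g x) = ((EFin \o f) \+ (EFin \o g))%E by [].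
exact: integrableD.
Qed.

Lemma integrable_EFinB D f g : measurable D -> mu.-integrable D (EFin \o f) ->
  mu.-integrable D (EFin \o g) ->
  mu.-integrable D (EFin \o (fun x => f x - g x)).
Proof.
move=> mD intf intg.
have -> : EFin \o (fun x => f x - g x) = ((EFin \o f) \- (EFin \o g))%E by [].
exact: integrableB.
Qed.

Lemma integrable_EFin_sum D m (F : 'I_m -> 'rV[R]_n -> R) : measurable D ->
  (forall i, mu.-integrable D (EFin \o F i)) ->
  mu.-integrable D (EFin \o (fun x => \sum_i F i x)) /\
  \int[mu]_(x in D) (\sum_i F i x) = \sum_i \int[mu]_(x in D) F i x.
Proof.
move=> mD; elim: m F => [F _|m ih F iF].
  have -> : (fun x => \sum_i F i x) = cst 0 by apply/funext => x; rewrite big_ord0.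
  split; first exact: integrable0.
  by rewrite big_ord0 Rintegral_cst// mul0r.
have [i1 i2] := ih (fun i => F (widen_ord (leqnSn m) i)) (fun i => iF _).
under [X in EFin \o X]eq_fun do rewrite big_ord_recr/=.
under eq_Rintegral do rewrite big_ord_recr/=.
split; first exact: integrable_EFinD.
by rewrite RintegralD// i2 big_ord_recr.
Qed.

Lemma Rintegral_patch_cst D S (c : R) : measurable D -> measurable S ->
  (mu S < +oo)%E ->
  mu.-integrable D (EFin \o ((fun=> c) \_ S)) /\
  \int[mu]_(x in D) ((fun=> c) \_ S) x = c * fine (mu (D `&` S)).
Proof.
move=> mD mS Soo; split; last first.
  by rewrite -Rintegral_mkcondr Rintegral_cst//; exact: measurableI.
apply: (integrableS measurableT mD (@subsetT _ _)).
rewrite -restrict_EFin; apply: (integrable_mkcond _ mS).1.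
by apply: measurable_bounded_integrable => //; exact: bounded_cst.
Qed.

Lemma Rintegral_translate f (v : 'rV[R]_n) : measurable_fun [set: 'rV[R]_n] f ->
  mu.-integrable setT (EFin \o (fun x => f (x + v))) ->
  \int[mu]_x f (x + v) = \int[mu]_x f x.
Proof.
move=> mf intf; congr fine.
have mphi : measurable_fun [set: 'rV[R]_n] (fun x : 'rV[R]_n => x + v).
  by have := measurable_row_affine 1 v; under eq_fun do rewrite scale1r.
transitivity (\int[pushforward mu (fun x : 'rV[R]_n => x + v)%R]_x (f x)%:E)%E.
  rewrite (@integral_pushforward _ _ _ _ R _ mphi mu setT (EFin \o f))//.
  exact/measurable_EFinP.
apply: eq_measure_integral => A mA _.
have := lebesgue_row_affine v ltr01 mA.
rewrite invr1 expr1n mul1e => H; apply: etrans H.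
by congr (lebesgue_row R n _); apply/seteqP; split => x /=; rewrite scale1r.
Qed.

(** The difference quotients [D k] with step 1 / (k + 1) have integral 0 by translation invariance.
    The mean value theorem bounds them by L, so dominated convergence passes this to the
    derivative. *)
Lemma Rintegral_partial f i (L M : R) :
  (forall x, derivable f x (delta_mx ord0 i)) ->
  (forall x, continuous_at x f) ->
  (forall x, `|f x| <= L) -> (forall x, `|partial i f x| <= L) ->
  (forall x, M <= `|x| -> f x = 0) ->
  \int[mu]_x partial i f x = 0.
Proof.
move=> df cf fbd fL fM.
pose e : 'rV[R]_n := delta_mx ord0 i.
pose t (k : nat) : R := k.+1%:R^-1.
have t0 k : 0 < t k by rewrite invr_gt0.
have t1 k : t k <= 1 by rewrite invf_le1// ler1n.
pose D k (x : 'rV[R]_n) : R := (t k)^-1 * (f (x + t k *: e) - f x).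
have mf : measurable_fun [set: 'rV[R]_n] f.
  by apply: measurable_fun_row_open => [|x _]; [exact: openT|exact: cf].
have mft k : measurable_fun [set: 'rV[R]_n] (fun x => f (x + t k *: e)).
  apply: measurableT_comp => //.
  by have := measurable_row_affine 1 (t k *: e); under eq_fun do rewrite scale1r.
have mD k : measurable_fun [set: 'rV[R]_n] (D k).
  by apply: measurable_funM => //; exact: measurable_funB.
have DL k x : `|D k x| <= L.
  have H (s : R) : 0 <= s <= 1 -> is_derive (s *: (t k *: e) + x) (t k *: e) f
      (t k * partial i f (s *: (t k *: e) + x)).
    move=> _; apply: is_derive_scale_direction; exact: partial_is_derive.
  have [s _ E] := MVT_direction H.
  by rewrite /D [x + _]addrC E mulKf ?lt0r_neq0.
have Dc x : D ^~ x @ \oo --> partial i f x.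
  apply/cvgrPdist_le => d d0.
  have /cvgrPdist_le/(_ _ d0) := df x.
  rewrite -[lim _]/(partial i f x) => /near_normP[s s0 Hs].
  have [k _ Hk] := near_infty_natSinv_lt (PosNum s0).
  exists k => // l /Hk /= ts.
  have := Hs (t l); rewrite subr0 (gtr0_norm (t0 l)) => /(_ ts).
  by rewrite gt_eqF// => /(_ isT); rewrite /D /= [x + _]addrC.
have shiftM k x : M + 1 <= `|x| -> M <= `|x + t k *: e|.
  move=> xM; have te : `|t k *: e| <= 1.
    by rewrite normrZ gtr0_norm// mulr_ile1// ?(ltW (t0 k))// norm_delta_mx_row.
  rewrite -(lerD2r 1); apply: (le_trans xM); rewrite -[x in `|x|](addrK (t k *: e)).
  by apply: le_trans (ler_normB _ _) _; rewrite lerD2l.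
(* The steps have length at most 1, so all the quotients vanish outside this one ball. *)
pose B := ball (0 : 'rV[R]_n) (M + 1).
have DB k x : ~ B x -> D k x = 0.
  rewrite /B -ball_normE/= sub0r normrN => /negP; rewrite -leNgt => xM.
  rewrite /D !fM ?subrr ?mulr0//; last exact: shiftM.
  by apply: le_trans xM; rewrite lerDl.
have iD k : mu.-integrable setT (EFin \o D k).
  apply: (@integrable_bounded_support setT (D k) L (M + 1)) => // x _ Mx.
  by apply: DB; rewrite /B -ball_normE/= sub0r normrN => /lt_geF; rewrite Mx.
have mB : measurable B by exact: measurable_row_ball.
have I0 k : (\int[mu]_x (D k x)%:E = 0)%E.
  rewrite -(fineK (integrable_fin_num measurableT (iD k))) -[fine _]/(\int[mu]_x D k x); congr EFin.
  have iff : mu.-integrable setT (EFin \o f).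
    by apply: (@integrable_bounded_support setT f L M) => // x _; exact: fM.
  have ift : mu.-integrable setT (EFin \o (fun x => f (x + t k *: e))).
    apply: (@integrable_bounded_support setT _ L (M + 1)) => // x _ Mx.
    by apply: fM; apply: shiftM.
  rewrite RintegralZl//; last first.
    exact: integrable_EFinB.
  by rewrite RintegralB// Rintegral_translate// subrr mulr0.
have L0 : 0 <= L by apply: le_trans (fbd 0).
have [] := @dominated_convergence _ _ _ mu setT measurableT (fun k x => (D k x)%:E)
  (fun x => (partial i f x)%:E) (fun x => (L * \1_B x)%:E).
- by move=> k; exact/measurable_EFinP.
- apply/measurable_EFinP; apply: (measurable_fun_cvg mD) => x _; exact: Dc.
- by apply: aeW => x _; apply/fine_cvgP; split; [exact: nearW|exact: Dc].
- apply: (@integrable_bounded_support setT (fun x => L * \1_B x) L (M + 1)) => //.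
  + by apply: measurable_funM => //; exact: measurable_indic.
  + by move=> x _; rewrite indicE; case: (_ \in _); rewrite ?mulr1 ?mulr0 ?normr0// ger0_norm.
  + move=> x _ Mx; rewrite indicE memNset ?mulr0//.
    by rewrite /B -ball_normE/= sub0r normrN => /lt_geF; rewrite Mx.
- apply: aeW => x k _; rewrite indicE lee_fin; have [xB|xB] := pselect (B x).
    by rewrite mem_set// mulr1.
  by rewrite memNset// DB// normr0 mulr0.
move=> _ _.
under eq_fun do rewrite I0.
move=> /cvg_lim; rewrite lim_cst// => /(_ _)/esym H.
by rewrite /Rintegral H.
Qed.

End row_integral.

(** * Volume of the layer between a convex domain and its shrunken copy *)

Section strip.
Context {R : realType} {n : nat}.
Local Notation mu := (lebesgue_row R n).
Variables (Omega : set 'rV[R]_n) (a : 'rV[R]_n) (r : R).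
Hypotheses (oO : open Omega) (cO : segment_convex Omega).
Hypotheses (r0 : 0 < r) (ar : forall y, `|y - a| < r -> Omega y).

Lemma bernoulli_onem (e : R) m : 0 <= e <= 1 -> 1 - m%:R * e <= (1 - e) ^+ m.
Proof.
move=> /andP[e0 e1]; elim: m => [|m ih]; first by rewrite mul0r subr0 expr0.
rewrite exprS -natr1.
have m0 : 0 <= m%:R :> R by [].
have : (1 - e) * (1 - m%:R * e) <= (1 - e) * (1 - e) ^+ m.
  by rewrite ler_wpM2l// subr_ge0.
apply: le_trans; nra.
Qed.

Lemma bounded_set_fin_measure (A : set 'rV[R]_n) (M : R) : measurable A ->
  (forall x, A x -> `|x - a| < M) -> (mu A < +oo)%E.
Proof.
move=> mA AM; have [M0|M0] := leP M 0.
  rewrite (_ : A = set0) ?measure0//; apply/seteqP; split => // x /AM.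
  by rewrite ltNge (le_trans M0).
apply: le_lt_trans (_ : mu (ball a M) < +oo)%E; last first.
  by rewrite lebesgue_row_ball// ltry.
apply: le_measure; rewrite ?inE//; first exact: measurable_row_ball.
by move=> x /AM; rewrite -ball_normE/= distrC.
Qed.

(* The homothety maps the region into its shrunken part and scales volumes by
   (1 - e)^n >= 1 - n e. *)
Lemma shrink_strip_measure (e M : R) : 0 < e < 1 ->
  let S := (Omega `&` [set x | `|x - a| < M]) `\` shrink Omega a e in
  measurable S /\
  fine (mu S) <= n%:R * e * fine (mu (Omega `&` [set x | `|x - a| < M])).
Proof.
move=> /andP[e0 e1] /=; set A := Omega `&` _; set K := shrink _ _ _.
have e1' : 0 < 1 - e by rewrite subr_gt0.
have mA : measurable A.
  apply: measurable_row_open; apply: openI => //.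
  have -> : [set x | `|x - a| < M] = ball a M.
    by apply/seteqP; split => x; rewrite -ball_normE/= distrC.
  exact: ball_open.
have mK : measurable K.
  rewrite -[K]setCK; apply: measurableC; apply: measurable_row_open.
  by apply: closed_openC; exact: shrink_closed.
have mS : measurable (A `\` K) by exact: measurableD.
split => //.
have Aoo : (mu A < +oo)%E by apply: (@bounded_set_fin_measure A M) => // x [].
(* The image of [A] under the homothety, written as a preimage under the inverse map so that
   [lebesgue_row_affine] applies. *)
pose H := (fun x => (1 - e)^-1 *: x + (- (e / (1 - e)) *: a)) @^-1` A.
have mH : measurable H.
  by rewrite -[X in measurable X]setTI; apply: measurable_row_affine.
have HP x : H x -> exists2 y, A y & x = (1 - e) *: y + e *: a.
  move=> Hx; exists ((1 - e)^-1 *: x + (- (e / (1 - e)) *: a)) => //.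
  by apply/rowP => i; rewrite !mxE; field; exact: lt0r_neq0.
have HA : H `<=` A.
  move=> x /HP[y [Oy yM] ->]; split.
    have := cO Oy (ar (_ : `|a - a| < r)); rewrite subrr normr0 => /(_ (1 - e) r0).
    by rewrite subKr; apply; rewrite ltW//= lerBlDr lerDl ltW.
  rewrite /= (_ : _ - a = (1 - e) *: (y - a)); last first.
    by apply/rowP => i; rewrite !mxE; ring.
  rewrite normrZ gtr0_norm//; apply: le_lt_trans yM.
  by rewrite ler_piMl// lerBlDr lerDl ltW.
have HK : H `<=` K.
  by move=> x /HP[y [Oy _] ->]; exact: shrink_homothety.
have muH : mu H = (((1 - e) ^+ n)%:E * mu A)%E.
  by rewrite /H lebesgue_row_affine ?invr_gt0// invrK.
have Afin : mu A \is a fin_num by rewrite ge0_fin_numE.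
have SH : (mu (A `\` K) <= mu (A `\` H))%E.
  apply: le_measure; rewrite ?inE//; first exact: measurableD.
  by move=> x [Ax Kx]; split => // /HK.
have AHE : mu (A `\` H) = ((1 - (1 - e) ^+ n) * fine (mu A))%:E.
  rewrite measureD//= (_ : A `&` H = H); last by apply/setIidPr.
  by rewrite muH -(fineK Afin) -EFinM -EFinB mulrBl mul1r.
have Sfin : mu (A `\` K) \is a fin_num.
  by rewrite ge0_fin_numE//; apply: le_lt_trans SH _; rewrite AHE ltry.
rewrite -lee_fin fineK//; apply: le_trans SH _; rewrite AHE lee_fin.
rewrite ler_wpM2r// ?fine_ge0// lerBlDr addrC -lerBlDr.
by apply: bernoulli_onem; rewrite !ltW.
Qed.

End strip.

(** * One-sided divergence inequality *)

Section divergence.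
Context {R : realType} {n : nat}.
Local Notation mu := (lebesgue_row R n).
Local Notation e_ i := (delta_mx ord0 i : 'rV[R]_n).
Local Opaque partial.
Implicit Types (x y z : 'rV[R]_n).
Variables (Omega : set 'rV[R]_n) (a : 'rV[R]_n) (r : R).
Hypotheses (oO : open Omega) (cO : segment_convex Omega).
Hypotheses (r0 : 0 < r) (ar : forall y, `|y - a| < r -> Omega y).
Variables (F : 'rV[R]_n -> 'rV[R]_n) (C M : R).
Local Notation F_ i := (fun x => F x ord0 i).
Hypotheses (dF : forall i x, Omega x -> derivable (F_ i) x (e_ i)).
Hypotheses (cF : forall i x, Omega x -> continuous_at x (F_ i)).
Hypotheses (cdF : forall i x, Omega x -> continuous_at x (partial i (F_ i))).
Hypotheses (bF : forall i x, Omega x -> `|F x ord0 i| <= C).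
Hypotheses (bdF : forall i x, Omega x -> `|partial i (F_ i) x| <= C).
Hypotheses (sF : forall x, Omega x -> M <= `|x - a| -> F x = 0).
Hypotheses (sdF : forall i x, Omega x -> M <= `|x - a| -> partial i (F_ i) x = 0).

Lemma norm_lt_dot (x : 'rV[R]_n) (s : R) : 0 < s -> dot x x < s ^+ 2 -> `|x| < s.
Proof.
move=> s0 xs; apply: mx_norm_lt => // i.
rewrite -(@ltr_pXn2r _ 2)// ?nnegrE// ?ltW// real_normK ?num_real//.
exact: le_lt_trans (sqr_coord_le_dot x i) xs.
Qed.

Lemma integrable_Omega (g : 'rV[R]_n -> R) (L : R) : (forall x, Omega x -> continuous_at x g) ->
  (forall x, Omega x -> `|g x| <= L) -> (forall x, Omega x -> M <= `|x - a| -> g x = 0) ->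
  mu.-integrable Omega (EFin \o g).
Proof.
move=> cg gL gM.
apply: (@integrable_bounded_support _ _ Omega g L (M + `|a|)) => //.
- exact: measurable_row_open.
- exact: measurable_fun_row_open.
- move=> x Ox xM; apply: gM => //.
  rewrite -(lerD2r `|a|); apply: le_trans xM _.
  by rewrite -[in leLHS](subrK a x) ler_normD.
Qed.

Lemma integrable_partial i : mu.-integrable Omega (EFin \o partial i (F_ i)).
Proof.
apply: (@integrable_Omega _ C).
- by move=> x Ox; exact: cdF.
- by move=> x Ox; exact: bdF.
- by move=> x Ox; exact: sdF.
Qed.

Section fixed_shrink.
Variable e : R.
Hypotheses (e0 : 0 < e) (e1 : e < 1).

Let K := shrink Omega a e.
(** Half of the thickness r e given by [shrink_thick]: the cutoff then vanishes in a neighbourhood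
    of each point outside Omega, not merely at the point. *)
Let s := r * e / 2.
Let K0 : K !=set0.
Proof. by exists a; rewrite /K; apply: shrink_center r0 ar. Qed.
Let clK : closed K. Proof. exact: shrink_closed. Qed.
Let cvxK : segment_convex K. Proof. exact: shrink_convex. Qed.
Let s0 : 0 < s. Proof. by rewrite /s divr_gt0// mulr_gt0. Qed.

Lemma dist2_outside x : ~ Omega x -> (r * e) ^+ 2 <= dist2 K x.
Proof.
move=> nOx; rewrite leNgt; apply/negP => d; apply: nOx.
apply: (@shrink_thick _ _ Omega a e r oO cO ar e0 e1 (nearest K x)).
  exact: nearest_in.
by apply: norm_lt_dot => //; rewrite mulr_gt0.
Qed.

Lemma cut_near_outside x : ~ Omega x -> \forall y \near x, cutoff K s y = 0.
Proof.
move=> nOx; have H := dist2_outside nOx.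
have d0 : 0 < (r * e) ^+ 2 - s ^+ 2.
  have : 0 < r * e by rewrite mulr_gt0.
  by rewrite /s; nra.
have [t t0 Ht] := (continuous_normP _ _).1 (continuous_dist2 K0 clK cvxK (x := x)) _ d0.
apply/near_normP; exists t => // y /Ht yx.
apply: cut_far0 => //; move: yx; rewrite ler_norml => /andP[yx _].
by rewrite -subr_ge0; lra.
Qed.

(** The i-th component of eta F, extended by 0. As eta vanishes near the complement of Omega, the
    extension is continuous and differentiable on the whole space, although F is controlled on Omega
    only. *)
Let G i : 'rV[R]_n -> R := (fun x => cutoff K s x * F x ord0 i) \_ Omega.

Let GE i x : Omega x -> G i x = cutoff K s x * F x ord0 i.
Proof. by move=> Ox; rewrite /G patchE mem_set. Qed.

Let GnE i x : ~ Omega x -> G i x = 0.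
Proof. by move=> Ox; rewrite /G patchE memNset. Qed.

Let G_near_in i x : Omega x -> \forall y \near x, cutoff K s y * F y ord0 i = G i y.
Proof.
move=> Ox; have : \forall y \near x, Omega y by exact: open_nbhs_nbhs.
by apply: filterS => y Oy; rewrite GE.
Qed.

Let G_near_out i x : ~ Omega x -> \forall y \near x, 0 = G i y.
Proof.
move=> Ox; have := cut_near_outside Ox; apply: filterS => y y0.
have [Oy|Oy] := pselect (Omega y); last by rewrite GnE.
by rewrite GE// y0 mul0r.
Qed.

Let dG i (x : 'rV[R]_n) : R := if `[< Omega x >] then
  cutoff K s x * partial i (F_ i) x + cut_slope K s x * F x ord0 i * (x - nearest K x) ord0 i else 0.

Lemma dot_delta (x : 'rV[R]_n) i : dot x (e_ i) = x ord0 i.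
Proof.
rewrite /dot (bigD1 i)//= big1 => [|j ji]; first by rewrite mxE !eqxx mulr1 addr0.
by rewrite mxE (negbTE ji) andbF mulr0.
Qed.

Let is_derive_G i x : is_derive x (e_ i) (G i) (dG i x).
Proof.
rewrite /dG; case: asboolP => Ox; last first.
  apply: (near_eq_is_derive (G_near_out i Ox)); exact: is_derive_cst.
apply: (near_eq_is_derive (G_near_in i Ox)).
have := @is_deriveM _ _ (cutoff K s) (F_ i) x (e_ i) _ _
  (is_derive_cut K0 clK cvxK s0 x (e_ i)) (partial_is_derive (@dF i x Ox)).
rewrite dot_delta.
suff -> : cutoff K s x *: partial i (F_ i) x +
    F x ord0 i *: (cut_slope K s x * (x - nearest K x) ord0 i) =
    cutoff K s x * partial i (F_ i) x + cut_slope K s x * F x ord0 i * (x - nearest K x) ord0 i by [].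
by rewrite [_ *: _ in X in _ + X]mulrC mulrAC.
Qed.

Let continuous_G i x : continuous_at x (G i).
Proof.
have [Ox|Ox] := pselect (Omega x).
  apply: (cvg_trans (near_eq_cvg (G_near_in i Ox))).
  rewrite GE//; apply: continuous_atM; first exact: continuous_cut.
  exact: cF.
apply: (cvg_trans (near_eq_cvg (G_near_out i Ox))).
rewrite GnE//; exact: cvg_cst.
Qed.

Lemma coord_le_sqrt_dot (x : 'rV[R]_n) i : `|x ord0 i| <= Num.sqrt (dot x x).
Proof. by rewrite -sqrtr_sqr ler_sqrt ?dot_ge0// sqr_coord_le_dot. Qed.

Let C0 (i : 'I_n) : 0 <= C.
Proof. by apply: le_trans (bF i (domain_center r0 ar)). Qed.

Let bound_dG i x : `|dG i x| <= C + 4 / s * C.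
Proof.
have C1 := C0 i.
rewrite /dG; case: asboolP => Ox; last first.
  by rewrite normr0 addr_ge0// mulr_ge0// divr_ge0// ltW.
apply: le_trans (ler_normD _ _) _; rewrite lerD//.
  rewrite normrM ger0_norm ?cutoff_ge0//; apply: le_trans (bdF i Ox).
  by rewrite ler_piMl// cutoff_le1.
rewrite mulrAC normrM ler_pM// ?bF// normrM.
apply: le_trans (cut_slope_bound K s0 x); rewrite ler_wpM2l//.
exact: coord_le_sqrt_dot.
Qed.

Lemma integral_cut_divergence :
  let A := fun x => \sum_i (cutoff K s x * partial i (F_ i) x +
     cut_slope K s x * F x ord0 i * (x - nearest K x) ord0 i) in
  mu.-integrable Omega (EFin \o A) /\ \int[mu]_(x in Omega) A x = 0.
Proof.
move=> A.
have mO : measurable Omega by exact: measurable_row_open.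
pose A_ i x := cutoff K s x * partial i (F_ i) x +
     cut_slope K s x * F x ord0 i * (x - nearest K x) ord0 i.
have iA i : mu.-integrable Omega (EFin \o A_ i).
  apply: (@integrable_Omega _ (C + 4 / s * C)).
  - move=> x Ox; apply: continuous_atD; first by apply: continuous_atM; [exact: continuous_cut|exact: cdF].
    apply: continuous_atM; last exact: continuous_sub_nearest.
    by apply: continuous_atM; [exact: continuous_cut_slope|exact: cF].
  - by move=> x Ox; have := bound_dG i x; rewrite /dG; case: asboolP.
  - by move=> x Ox xM; rewrite /A_ sdF// sF// mxE !(mulr0, mul0r) addr0.
have [i1 i2] := integrable_EFin_sum mO iA.
split; first exact: i1.
rewrite [LHS]i2 big1// => i _.
have Cs : 0 <= 4 / s * C.
  by apply: mulr_ge0; [apply: divr_ge0 => //; exact: ltW|exact: C0 i].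
have <- : \int[mu]_x partial i (G i) x = 0.
  apply: (@Rintegral_partial _ _ (G i) i (C + 4 / s * C) (M + `|a|)).
  - by move=> x; have [] := is_derive_G i x.
  - by move=> x; exact: continuous_G.
  - move=> x; have [Ox|Ox] := pselect (Omega x); last first.
      by rewrite GnE// normr0 addr_ge0// (C0 i).
    rewrite GE// normrM ger0_norm ?cutoff_ge0//.
    apply: (@le_trans _ _ C); last by rewrite lerDl.
    by apply: le_trans (bF i Ox); rewrite ler_piMl// cutoff_le1.
  - by move=> x; rewrite (is_derive_partial (is_derive_G i x)).
  - move=> x xM; have [Ox|Ox] := pselect (Omega x); last by rewrite GnE.
    rewrite GE// sF// ?mxE ?mulr0//.
    rewrite -(lerD2r `|a|); apply: le_trans xM _.
    by rewrite -[in leLHS](subrK a x) ler_normD.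
rewrite Rintegral_mkcond; congr (Rintegral _ _ _); apply/funext => x.
rewrite (is_derive_partial (is_derive_G i x)) /dG patchE.
by case: asboolP => Ox; [rewrite mem_set|rewrite memNset].
Qed.

End fixed_shrink.

(** Subtracting int div (eta F) = 0 leaves the integrals of (1 - eta) div F and of - grad eta . F,
    both carried by the layer. The first is at most N times its volume, hence O(e). In the second,
    grad eta is a nonpositive multiple of x - [nearest], so the hypothesis bounds the integrand by d
    (4 / s), with s = r e / 2; multiplied by the volume n e V this is O(d). *)
Lemma integral_divergence_le0 :
  (forall d : R, 0 < d -> exists2 e1 : R, 0 < e1 & forall e x, 0 < e < e1 -> e < 1 -> Omega x ->
     `|x - a| < M -> dot (F x) (x - nearest (shrink Omega a e) x) <=
       d * Num.sqrt (dist2 (shrink Omega a e) x)) ->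
  \int[mu]_(x in Omega) \sum_i partial i (F_ i) x <= 0.
Proof.
move=> HN.
pose B := [set x | `|x - a| < M].
pose V := fine (mu (Omega `&` B)).
have V0 : 0 <= V by rewrite fine_ge0.
have mO : measurable Omega by exact: measurable_row_open.
pose divF x := \sum_i partial i (F_ i) x.
have idivF : mu.-integrable Omega (EFin \o divF).
  by have [] := @integrable_EFin_sum _ _ Omega n (fun i => partial i (F_ i)) mO integrable_partial.
pose N := n%:R * C.
have N0 : 0 <= N.
  rewrite /N; case: (posnP n) => [->|n1]; first by rewrite mul0r.
  apply: mulr_ge0 => //; apply: le_trans (bF (Ordinal n1) (domain_center r0 ar)).
  exact: normr_ge0.
have n0 : 0 <= n%:R :> R by [].
have Nn : 0 <= N * n%:R * V by apply: mulr_ge0 => //; exact: mulr_ge0.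
have key (d e : R) : 0 < d -> 0 < e < 1 ->
   (forall x, Omega x -> `|x - a| < M -> dot (F x) (x - nearest (shrink Omega a e) x) <=
       d * Num.sqrt (dist2 (shrink Omega a e) x)) ->
  \int[mu]_(x in Omega) divF x <= (N + d * (4 / (r * e / 2))) * (n%:R * e * V).
  move=> d0 /andP[e0 e1] H.
  set K := shrink Omega a e in H *; set s := r * e / 2.
  have K0 : K !=set0 by exists a; rewrite /K; apply: shrink_center r0 ar.
  have clK : closed K by exact: shrink_closed.
  have cvxK : segment_convex K by exact: shrink_convex.
  have s0 : 0 < s by rewrite /s divr_gt0// mulr_gt0.
  have [iA IA] := integral_cut_divergence e0 e1.
  have e01 : 0 < e < 1 by rewrite e0.
  have [mS muS] := @shrink_strip_measure _ _ Omega a r oO cO r0 ar e M e01.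
  set S := (_ `\` _) in mS muS.
  have Soo : (mu S < +oo)%E by apply: (@bounded_set_fin_measure _ _ a S M) => // x [[]].
  pose c := N + d * (4 / s).
  have [iS IS] := Rintegral_patch_cst c mO mS Soo.
  have c0 : 0 <= c.
    apply: addr_ge0 => //; apply: mulr_ge0; first exact: ltW.
    by apply: divr_ge0 => //; exact: ltW.
  have SO : Omega `&` S = S by apply/setIidPr => x [[]].
  apply: (@le_trans _ _ (c * fine (mu S))); last by rewrite ler_wpM2l.
  (* Adding the vanishing integral on the right allows a pointwise comparison, which is an equality
     on [K] and at the points with |x - a| >= M. *)
  rewrite -SO -IS -[leRHS]add0r -IA -RintegralD//.
  apply: le_Rintegral => //; first exact: integrable_EFinD.
  move=> x Ox.
  have -> : \sum_i (cutoff K s x * partial i (F_ i) x + cut_slope K s x * F x ord0 i *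
      (x - nearest K x) ord0 i) = cutoff K s x * divF x + cut_slope K s x * dot (F x) (x - nearest K x).
    rewrite big_split/= -mulr_sumr; congr (_ + _).
    by rewrite mulr_sumr; apply: eq_bigr => i _; rewrite mulrA.
  have [Kx|Kx] := pselect (K x).
    rewrite patchE memNset; last by move=> [_]; apply.
    rewrite cutoff_in// mul1r nearest_id// subrr dotC dot0l mulr0 !addr0//.
  have [xM|xM] := ltP `|x - a| M; last first.
    have -> : divF x = 0 by apply: big1 => i _; exact: sdF.
    rewrite sF// dot0l !mulr0 add0r patchE memNset; first by rewrite add0r.
    by move=> -[[_]] /=; rewrite ltNge xM.
  rewrite patchE mem_set//.
  have E0 := cutoff_ge0 K s x; have E1 := cutoff_le1 K s0 x.
  have D1 : divF x <= N.
    apply: le_trans (ler_norm _) _; apply: le_trans (ler_norm_sum _ _ _) _.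
    rewrite /N mulr_natl -[X in _ *+ X]card_ord -sumr_const.
    by apply: ler_sum => i _; exact: bdF.
  have D2 : (1 - cutoff K s x) * divF x <= N.
    apply: (@le_trans _ _ ((1 - cutoff K s x) * N)).
      by rewrite ler_wpM2l// subr_ge0.
    by rewrite ler_piMl// lerBlDr lerDl.
  have D3 : - cut_slope K s x * dot (F x) (x - nearest K x) <= d * (4 / s).
    have sl : 0 <= - cut_slope K s x.
      rewrite opprK; apply: mulr_ge0; last by rewrite invr_ge0 sqr_ge0.
      by apply: mulr_ge0 => //; rewrite le_max lexx.
    apply: le_trans (ler_wpM2l sl (H x Ox xM)) _.
    rewrite mulrCA ler_wpM2l ?(ltW d0)//.
    by have := cut_slope_bound K s0 x; rewrite -/K -/s -normrN ger0_norm.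
  rewrite /c; move: D2 D3; clear.
  move: (divF x) (cutoff K s x) (cut_slope K s x) (dot (F x) (x - nearest K x)).
  by move: (d * (4 / s)) => z p q w t; lra.
(* With s = r e / 2 the bound of [key] reads e (N n V) + d (8 n V / r), at most d Q as soon as e <=
   d. The choice d = I / (2 (Q + 1)) makes this smaller than I. *)
pose Q := N * n%:R * V + 8 / r * n%:R * V.
have Q0 : 0 <= Q.
  by apply: addr_ge0 => //; rewrite !mulr_ge0// invr_ge0 ltW.
rewrite leNgt; apply/negP => I0; set I := Rintegral _ _ _ in I0.
pose d := I / (2 * (Q + 1)).
have Q1 : 0 < Q + 1 by rewrite ltr_wpDl.
have d0 : 0 < d by rewrite divr_gt0// mulr_gt0.
have [e1 e10 He] := HN d d0.
pose e := Num.min (e1 / 2) (Num.min (1 / 2) d).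
have e0 : 0 < e by rewrite !lt_min d0 !divr_gt0.
have ee1 : e < e1.
  by rewrite /e gt_min; apply/orP; left; rewrite ltr_pdivrMr//; lra.
have e1' : e < 1.
  by rewrite /e !gt_min; apply/orP; right; apply/orP; left; lra.
have ed : e <= d by rewrite /e !ge_min lexx !orbT.
have := key d e d0; rewrite e0 e1' => /(_ isT).
move=> /(_ (fun x Ox xM => He e x _ e1' Ox xM)); rewrite e0 ee1 => /(_ isT).
rewrite -/I.
have -> : (N + d * (4 / (r * e / 2))) * (n%:R * e * V) =
    e * (N * n%:R * V) + d * (8 / r * n%:R * V).
  by field; rewrite !lt0r_neq0.
move=> IQ; have : I <= d * Q.
  apply: le_trans IQ _; rewrite /Q mulrDr lerD2r ler_wpM2r//.
apply/negP; rewrite -ltNge /d mulrAC ltr_pdivrMr ?mulr_gt0// ltr_pM2l//; lra.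
Qed.

End divergence.

(** * Outward normals *)

Section within_closure.
Context {R : realType} {n : nat}.
Implicit Types (x y z v w : 'rV[R]_n) (A Omega : set 'rV[R]_n) (g : 'rV[R]_n -> R).

Lemma near_within_normP A x (P : 'rV[R]_n -> Prop) :
  (\forall y \near within A (nbhs x), P y) <->
  exists2 r : R, 0 < r & forall y, A y -> `|y - x| < r -> P y.
Proof.
split=> [/(near_normP x (fun y => A y -> P y)).1 [r r0 H]|[r r0 H]].
  by exists r => // y Ay yr; exact: H.
by apply: (near_normP x (fun y => A y -> P y)).2; exists r => // y yr Ay; exact: H.
Qed.

Lemma within_continuous_normP A g : {within A, continuous g} <->
  (forall x, A x -> forall e : R, 0 < e -> exists2 r : R, 0 < r &
     forall y, A y -> `|y - x| < r -> `|g y - g x| <= e).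
Proof.
split=> [/subspace_continuousP cg x Ax e e0|H].
  have /cvgrPdist_le/(_ _ e0)/near_within_normP[r r0 Hr] := cg x Ax.
  by exists r => // y Ay yr; rewrite distrC; exact: Hr.
apply/subspace_continuousP => x Ax; apply/cvgrPdist_le => e e0.
have [r r0 Hr] := H x Ax e e0.
by apply/near_within_normP; exists r => // y Ay yr; rewrite distrC; exact: Hr.
Qed.

(** Evaluates the limits in [normal_derivative] by the continuous extensions. The uniqueness of such
    limits also carries the constancy of u from Omega to its closure. *)
Lemma within_closure_lim Omega g (f : 'rV[R]_n -> R) x :
  {within closure Omega, continuous g} -> (forall y, Omega y -> g y = f y) ->
  closure Omega x -> lim (f y @[y --> within Omega (nbhs x)]) = g x.
Proof.
move=> /within_continuous_normP cg gf cx.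
have PF : ProperFilter (within Omega (nbhs x)).
  apply: Build_ProperFilter_ex => B /near_within_normP[r r0 Hr].
  have [y Oy yr] := (closure_normP _ _).1 cx r r0.
  by exists y; exact: Hr.
apply: cvg_lim => //; apply/cvgrPdist_le => e e0.
have [r r0 Hr] := cg x cx e e0.
apply/near_within_normP; exists r => // y Oy yr.
by rewrite distrC -gf//; apply: Hr => //; exact: subset_closure.
Qed.

Lemma dot_bound v w : `|dot v w| <= n%:R * `|v| * `|w|.
Proof.
apply: le_trans (ler_norm_sum _ _ _) _.
rewrite -mulrA mulr_natl -[X in _ *+ X]card_ord -sumr_const ler_sum// => i _.
by rewrite normrM ler_pM// mx_coord_le_norm.
Qed.

Lemma sum_norm_bound v : \sum_i `|v ord0 i| <= n%:R * `|v|.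
Proof.
rewrite mulr_natl -[X in _ *+ X]card_ord -sumr_const ler_sum// => i _.
exact: mx_coord_le_norm.
Qed.

(** A cluster point of the pair in a product of compact balls: both sequences are close to their
    limits at the same index, which replaces the extraction of a common subsequence. *)
Lemma bounded_pair_cluster (X W : nat -> 'rV[R]_n) (M : R) :
  (forall k, `|X k| <= M) -> (forall k, `|W k| <= M) ->
  exists x w, forall (e : R) N, 0 < e ->
    exists2 k, (N <= k)%N & `|X k - x| < e /\ `|W k - w| < e.
Proof.
move=> XM WM.
pose B := [set x : 'rV[R]_n | `|x| <= M].
have cB : compact B.
  apply: bounded_closed_compact.
    exists M; split; first exact: num_real.
    by move=> m Mm y /= yM; apply: le_trans yM (ltW Mm).
  apply: (@closed_comp _ _ (fun y : 'rV[R]_n => `|y|) [set t : R | t <= M]).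
    by move=> y _; exact: norm_continuous.
  exact: closed_le.
have := compact_setX cB cB.
move=> /(_ ((fun k => (X k, W k)) @ \oo) _)[|[x w] [_ cl]].
  by exists 0%N => // k _; split; [exact: XM|exact: WM].
exists x, w => e N e0.
have [||p [[k Nk <-] [/= xk wk]]] := cl ((fun k => (X k, W k)) @` [set k | (N <= k)%N])
  (ball x e `*` ball w e).
- by exists N => // k Nk; exists k.
- by exists (ball x e, ball w e) => //; split; exact: nbhsx_ballx.
exists k => //; split.
  by move: xk; rewrite -ball_normE/= distrC.
by move: wk; rewrite -ball_normE/= distrC.
Qed.

Lemma within_continuous_vector A (F : 'rV[R]_n -> 'rV[R]_n) x (e : R) :
  (forall i, {within A, continuous (fun y => F y ord0 i)}) -> A x -> 0 < e ->
  exists2 r : R, 0 < r & forall y, A y -> `|y - x| < r -> `|F y - F x| <= e.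
Proof.
move=> cF Ax e0.
have : \forall y \near within A (nbhs x), forall i, `|F y ord0 i - F x ord0 i| <= e.
  have := @filter_forall _ _ (fun i y => `|F y ord0 i - F x ord0 i| <= e) (within A (nbhs x)) _.
  apply => i; apply/near_within_normP.
  exact: ((within_continuous_normP _ _).1 (cF i) x Ax e e0).
move=> /near_within_normP[r r0 Hr]; exists r => // y Ay yr.
by apply: mx_norm_le => [|i]; [exact: ltW|rewrite !mxE; exact: Hr].
Qed.

Section uniform_normal.
Variables (Omega : set 'rV[R]_n) (a : 'rV[R]_n) (r : R).
Hypotheses (oO : open Omega) (cO : segment_convex Omega).
Hypotheses (r0 : 0 < r) (ar : forall y, `|y - a| < r -> Omega y).
Variables (F : 'rV[R]_n -> 'rV[R]_n) (M : R).
Hypothesis cF : forall i, {within closure Omega, continuous (fun x => F x ord0 i)}.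
Hypothesis NF : forall x v, closure Omega x -> ~ Omega x ->
  (forall z, Omega z -> dot v (z - x) <= 0) -> dot (F x) v <= 0.

(* Otherwise, as e -> 0, the normalized vectors x - nearest x would cluster at
   an outward normal v of a frontier point x where dot (F x) v > 0. *)
Lemma uniform_normal_bound (d : R) : 0 < d -> exists2 e1 : R, 0 < e1 &
  forall e x, 0 < e < e1 -> e < 1 -> Omega x -> `|x - a| < M ->
    dot (F x) (x - nearest (shrink Omega a e) x) <=
    d * Num.sqrt (dist2 (shrink Omega a e) x).
Proof.
move=> d0; apply: contrapT => /forall2NP H.
(* The bound 1 / (k + 2) also gives e <= 1 / 2, which keeps 1 - e away from 0. *)
have {}H (k : nat) : exists p : R * 'rV[R]_n, let e := p.1 in let x := p.2 in
  [/\ 0 < e < k.+2%:R^-1, Omega x, `|x - a| < M &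
    d * Num.sqrt (dist2 (shrink Omega a e) x) <
    dot (F x) (x - nearest (shrink Omega a e) x)].
  have k0 : 0 < k.+2%:R^-1 :> R by rewrite invr_gt0.
  have [/(_ k0)//|] := H k.+2%:R^-1.
  move=> /existsNP[e /existsNP[x]] /not_implyP[ek] /not_implyP[e1] /not_implyP[Ox] /not_implyP[xM] /negP.
  by rewrite -ltNge => ?; exists (e, x); split.
have [E HE] := choice H; move: HE => {H} HE.
pose e k := (E k).1; pose x k := (E k).2.
pose K k := shrink Omega a (e k).
pose w k := x k - nearest (K k) (x k).
have e0 k : 0 < e k by have [/andP[]] := HE k.
have ek k : e k < k.+2%:R^-1 by have [/andP[]] := HE k.
have e2 k : e k <= 1 / 2.
  apply: le_trans (ltW (ek k)) _; rewrite div1r lef_pV2 ?posrE//.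
  by rewrite ler_nat.
have e1 k : e k < 1 by apply: le_lt_trans (e2 k) _; lra.
have Ox k : Omega (x k) by have [] := HE k.
have xM k : `|x k - a| < M by have [] := HE k.
have Fw k : d * Num.sqrt (dot (w k) (w k)) < dot (F (x k)) (w k) by have [] := HE k.
have w0 k : 0 < Num.sqrt (dot (w k) (w k)).
  rewrite lt_neqAle sqrtr_ge0 andbT eq_sym; apply/negP => /eqP w0.
  have wk0 : w k = 0.
    apply: dot_eq0; apply/eqP; rewrite eq_le dot_ge0 andbT.
    by rewrite -sqrtr_eq0 w0.
  by have := Fw k; rewrite w0 wk0 dotC dot0l mulr0 ltxx.
have K0 k : K k !=set0 by exists a; rewrite /K; apply: shrink_center r0 ar.
have clK k : closed (K k) by exact: shrink_closed.
have cvxK k : segment_convex (K k) by exact: shrink_convex.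
pose v k := (Num.sqrt (dot (w k) (w k)))^-1 *: w k.
have vv k : dot (v k) (v k) = 1.
  rewrite /v dotZl dotZr mulrA -expr2 exprVn sqr_sqrtr ?dot_ge0// mulVf//.
  by have := w0 k; rewrite sqrtr_gt0 => /lt0r_neq0.
have v1 k : `|v k| <= 1 by apply: norm_le_dot => //; rewrite vv expr1n.
have Fv k : d < dot (F (x k)) (v k).
  by rewrite /v dotZr mulrC ltr_pdivlMr.
have eN (t : R) : 0 < t -> exists N, forall k, (N <= k)%N -> e k <= t.
  move=> t0; have [N _ HN] := near_infty_natSinv_lt (PosNum t0).
  exists N => k /HN /= kt; apply: ltW (lt_trans (ek k) (le_lt_trans _ kt)).
  by rewrite lef_pV2 ?posrE// ler_nat.
have M0 : 0 < M by apply: le_lt_trans (xM 0%N).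
(* Test [nearest_normal] at the homothetic image of z. Replacing the nearest point by [x k]
   subtracts |w|^2 and preserves the sign. The right-hand side tends to 0 with [e k]. *)
have vz k z : Omega z -> dot (v k) (z - x k) <= e k * dot (v k) (z - a).
  move=> Oz.
  have Kz : K k ((1 - e k) *: z + e k *: a) by exact: shrink_homothety.
  have := nearest_normal (K0 k) (clK k) (cvxK k) (x k) Kz; rewrite -/(w k) => H1.
  have H2 : dot (w k) ((1 - e k) *: z + e k *: a - x k) <= 0.
    have -> : (1 - e k) *: z + e k *: a - x k =
        ((1 - e k) *: z + e k *: a - nearest (K k) (x k)) - w k.
      by apply/rowP => i; rewrite !mxE; ring.
    by rewrite dotBr; have := dot_ge0 (w k); lra.
  have : dot (v k) ((1 - e k) *: z + e k *: a - x k) <= 0.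
    by rewrite /v dotZl pmulr_rle0// invr_gt0.
  have -> : (1 - e k) *: z + e k *: a - x k = (z - x k) - e k *: (z - a).
    by apply/rowP => i; rewrite !mxE; ring.
  by rewrite (dotBr (z - x k)) dotZr subr_le0.
have [X [V cl]] : exists x' v', forall (d : R) N, 0 < d ->
    exists2 k, (N <= k)%N & `|x k - x'| < d /\ `|v k - v'| < d.
  apply: (@bounded_pair_cluster x v (M + `|a| + 1)) => k.
    rewrite -[x k](subrK a); apply: le_trans (ler_normD _ _) _.
    by have := xM k; lra.
  by apply: le_trans (v1 k) _; rewrite lerDr addr_ge0// ltW.
have cX : closure Omega X.
  apply/closure_normP => t t0; have [k _ [xk _]] := cl t 0%N t0.
  by exists (x k).
(* Otherwise the inverse homothety, which moves [x k] by at most 2 ([e k]) M, would leave it in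
   Omega for large k. Then [x k] would belong to [K k] and [w k] would vanish. *)
have nOX : ~ Omega X.
  move=> OX; have [t t0 Ht] := open_normP oO OX.
  have t20 : 0 < t / 2 by rewrite divr_gt0.
  have tM : 0 < t / (4 * M) by rewrite divr_gt0// mulr_gt0.
  have [N HN] := eN _ tM.
  have [k Nk [xk _]] := cl (t / 2) N t20.
  have Kx : K k (x k).
    apply: subset_closure; apply: Ht.
    have -> : a + (1 - e k)^-1 *: (x k - a) - X =
        (x k - X) + (e k / (1 - e k)) *: (x k - a).
      have G (t' : R) (p q : 'rV[R]_n) : 1 - t' != 0 ->
          a + (1 - t')^-1 *: (p - a) - q = (p - q) + (t' / (1 - t')) *: (p - a).
        by move=> t'0; apply/rowP => i; rewrite !mxE; field.
      by apply: G; rewrite subr_eq0 gt_eqF.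
    apply: le_lt_trans (ler_normD _ _) _; rewrite (splitr t) ltr_leD//.
    rewrite normrZ ger0_norm; last by rewrite divr_ge0 ?subr_ge0 ?(ltW (e0 k)) ?(ltW (e1 k)).
    have ekt : e k * (4 * M) <= t by rewrite -ler_pdivlMr ?mulr_gt0// HN.
    apply: (@le_trans _ _ (2 * e k * M)); last by lra.
    apply: ler_pM; rewrite ?divr_ge0 ?subr_ge0 ?(ltW (e0 k)) ?(ltW (e1 k))// ?(ltW (xM k))//.
    rewrite ler_pdivrMr ?subr_gt0//; have := e0 k; have := e2 k; nra.
  by have := w0 k; rewrite /w nearest_id// subrr dot0l sqrtr0 ltxx.
(* The limit of [vz]. The constant [c] collects three errors, from [e k], from [v k] - V and from
   [x k] - X, each carrying the factor n of [dot_bound]. *)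
have VN z : Omega z -> dot V (z - X) <= 0.
  move=> Oz; rewrite leNgt; apply/negP => q0.
  set q := dot V (z - X) in q0.
  pose c := n%:R * (`|z - a| + `|z - X| + 1) + 1.
  have c0 : 0 < c by rewrite ltr_wpDl// mulr_ge0// !addr_ge0.
  have t0 : 0 < q / c by rewrite divr_gt0.
  have [N HN] := eN _ t0.
  have [k Nk [xk vk]] := cl _ N t0.
  have : q <= q / c * (n%:R * (`|z - a| + `|z - X| + 1)).
    have qE : q = dot (v k) (z - x k) - dot (v k - V) (z - X) - dot (v k) (X - x k).
      by rewrite /q !(dotBl, dotBr); ring.
    have D1 : dot (v k) (z - x k) <= q / c * (n%:R * `|z - a|).
      apply: le_trans (vz k z Oz) _.
      apply: (@le_trans _ _ (e k * (n%:R * `|z - a|))).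
        rewrite ler_wpM2l ?(ltW (e0 k))//; apply: le_trans (ler_norm _) _.
        apply: le_trans (dot_bound _ _) _; rewrite ler_wpM2r//.
        by rewrite ler_piMr.
      by rewrite ler_wpM2r ?mulr_ge0// HN.
    have D2 : - dot (v k - V) (z - X) <= q / c * (n%:R * `|z - X|).
      apply: le_trans (ler_norm _) _; rewrite normrN.
      apply: le_trans (dot_bound _ _) _; rewrite mulrA ler_wpM2r// mulrC ler_wpM2r//.
      exact: ltW.
    have D3 : - dot (v k) (X - x k) <= q / c * n%:R.
      apply: le_trans (ler_norm _) _; rewrite normrN.
      apply: le_trans (dot_bound _ _) _; rewrite mulrC ler_pM// ?mulr_ge0//.
        by rewrite distrC ltW.
      by rewrite ler_piMr.
    move: qE D1 D2 D3; clear; move: (dot (v k) _) (dot (v k - V) _) (dot (v k) _) => p1 p2 p3.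
    by move: (q / c) => qc -> *; lra.
  apply/negP; rewrite -ltNge mulrAC ltr_pdivrMr// ltr_pM2l// /c ltrDl//.
have := NF cX nOX VN; apply/negP; rewrite -ltNge.
pose c := n%:R * (1 + `|F X|) + 1.
have c0 : 0 < c by rewrite ltr_wpDl// mulr_ge0// addr_ge0.
have t0 : 0 < d / c by rewrite divr_gt0.
have [s s0 Hs] := within_continuous_vector cF cX t0.
have m0 : 0 < Num.min s (d / c) by rewrite lt_min s0.
have [k _ []] := cl _ 0%N m0.
rewrite !lt_min => /andP[xs _] /andP[_ vs].
have Fs : `|F (x k) - F X| <= d / c by apply: Hs => //; exact: subset_closure.
have D1 : dot (F (x k) - F X) (v k) <= d / c * n%:R.
  apply: le_trans (ler_norm _) _; apply: le_trans (dot_bound _ _) _.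
  rewrite mulrAC mulrC ler_pM// ?mulr_ge0//.
  by rewrite ler_piMr.
have D2 : dot (F X) (v k - V) <= d / c * (n%:R * `|F X|).
  apply: le_trans (ler_norm _) _; apply: le_trans (dot_bound _ _) _.
  by rewrite mulrC ler_wpM2r ?mulr_ge0// ltW.
have := Fv k.
have -> : dot (F (x k)) (v k) = dot (F X) V + dot (F (x k) - F X) (v k) + dot (F X) (v k - V).
  by rewrite !(dotBl, dotBr); ring.
have : d / c * (n%:R * (1 + `|F X|)) < d.
  by rewrite mulrAC ltr_pdivrMr// ltr_pM2l// /c ltrDl.
lra.
Qed.

End uniform_normal.
End within_closure.

(** * Local defining functions, supporting hyperplanes and expansions at the frontier *)

Section boundary.
Context {R : realType} {n : nat}.
Implicit Types (x y z v w : 'rV[R]_n) (Omega U : set 'rV[R]_n).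
Implicit Types (f g rho u : 'rV[R]_n -> R).
Local Notation e_ i := (delta_mx ord0 i : 'rV[R]_n).
Local Opaque partial.

Lemma dot_grad f x v : dot v (grad f x) = \sum_i v ord0 i * partial i f x.
Proof. by apply: eq_bigr => i _; rewrite mxE. Qed.

Lemma Ck_open_derivable U f k s : (size s < k)%N -> Ck_open k U f ->
  forall i x, U x -> derivable (partials s f) x (e_ i).
Proof. by move=> sk /(_ s (ltnW sk))[_ /(_ sk)]. Qed.

Lemma Ck_open_continuous U f k s : (size s <= k)%N -> Ck_open k U f ->
  forall x, U x -> continuous_at x (partials s f).
Proof. by move=> sk /(_ s sk)[]. Qed.

Lemma Ck_open_is_derive U f k s x v : open U -> (size s < k)%N ->
  Ck_open k U f -> U x ->
  is_derive x v (partials s f) (dot v (grad (partials s f) x)).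
Proof.
move=> oU sk Cf Ux; rewrite dot_grad; apply: C1_is_derive => i.
  have : \forall y \near x, U y by exact: open_nbhs_nbhs.
  by apply: filterS => y Uy; apply: Ck_open_derivable Cf _ _ Uy.
exact: (@Ck_open_continuous U f k (i :: s)).
Qed.

Lemma Ck_open_schwarz U f x i j : open U -> Ck_open 2 U f -> U x ->
  partial j (partial i f) x = partial i (partial j f) x.
Proof.
move=> oU Cf Ux; apply: schwarz.
- have : \forall y \near x, U y by exact: open_nbhs_nbhs.
  apply: filterS => y Uy; split.
  + exact: (@Ck_open_derivable U f 2 [::]).
  + exact: (@Ck_open_derivable U f 2 [::]).
  + exact: (@Ck_open_derivable U f 2 [:: i]).
  + exact: (@Ck_open_derivable U f 2 [:: j]).
- exact: (@Ck_open_continuous U f 2 [:: j; i]).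
- exact: (@Ck_open_continuous U f 2 [:: i; j]).
Qed.

Lemma MVT_segment_domain Omega f x y : open Omega -> segment_convex Omega ->
  Ck_open 1 Omega f -> Omega x -> Omega y ->
  exists2 t : R, 0 < t < 1 & f y - f x = dot (y - x) (grad f (t *: y + (1 - t) *: x)).
Proof.
move=> oO cO Cf Ox Oy.
have H (t : R) : 0 <= t <= 1 -> is_derive (t *: (y - x) + x) (y - x) f
    (dot (y - x) (grad f (t *: (y - x) + x))).
  move=> t01; apply: (@Ck_open_is_derive Omega f 1 [::]) => //.
  have -> : t *: (y - x) + x = t *: y + (1 - t) *: x.
    by apply/rowP => i; rewrite !mxE; ring.
  exact: cO.
have [t t01] := MVT_direction H; rewrite subrK => E; exists t => //.
have -> : t *: y + (1 - t) *: x = t *: (y - x) + x; last exact: E.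
by apply/rowP => i; rewrite !mxE; ring.
Qed.

Lemma is_derive_expansion f x v (d e : R) : is_derive x v f d -> 0 < e ->
  exists2 r : R, 0 < r & forall h : R, `|h| < r ->
    `|f (h *: v + x) - f x - h * d| <= e * `|h|.
Proof.
move=> [df dfE] e0.
have /cvgrPdist_le/(_ _ e0) := df.
rewrite -/(derive f x v) dfE => /near_normP[r r0 H].
exists r => // h hr; have [->|h0] := eqVneq h 0.
  by rewrite scale0r add0r mul0r subr0 subrr normr0 mulr0.
have := H h; rewrite subr0 => /(_ hr h0); rewrite /= distrC => H1.
rewrite -ler_pdivrMr ?normr_gt0// -normfV -normrM mulrBl mulrAC divff// mul1r.
by rewrite mulrC.
Qed.

Lemma convex_norm_lt v w (t r : R) : 0 <= t <= 1 -> `|v| < r -> `|w| < r ->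
  `|t *: v + (1 - t) *: w| < r.
Proof.
move=> /andP[t0 t1] vr wr; apply: (@le_lt_trans _ _ (Num.max `|v| `|w|)).
  apply: le_trans (ler_normD _ _) _.
  rewrite !normrZ !ger0_norm ?subr_ge0//.
  have : `|v| <= Num.max `|v| `|w| by rewrite le_max lexx.
  have : `|w| <= Num.max `|v| `|w| by rewrite le_max lexx orbT.
  nra.
by rewrite gt_max vr.
Qed.

Section expansion.
Variables (Omega : set 'rV[R]_n) (f g : 'rV[R]_n -> R) (h : 'I_n -> 'rV[R]_n -> R).
Hypotheses (oO : open Omega) (cO : segment_convex Omega) (Cf : Ck_open 1 Omega f).
Hypotheses (cg : {within closure Omega, continuous g}).
Hypotheses (gf : forall x, Omega x -> g x = f x).
Hypotheses (ch : forall i, {within closure Omega, continuous (h i)}).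
Hypotheses (hf : forall i x, Omega x -> h i x = partial i f x).

(** The segment from x to y may run along the frontier, where f is not known to be differentiable.
    Contract it by 1 - s towards a point z of Omega close to x, apply the mean value theorem inside
    Omega, where the gradient is within e / (n + 1) of its extension at x, and let s tend to 0. *)
Lemma closure_expansion x (e : R) : closure Omega x -> 0 < e ->
  exists2 r : R, 0 < r & forall y, closure Omega y -> `|y - x| < r ->
    `|g y - g x - \sum_i (y - x) ord0 i * h i x| <= e * `|y - x|.
Proof.
move=> cx e0.
pose H y : 'rV[R]_n := \row_i h i y.
have cH i : {within closure Omega, continuous (fun y => H y ord0 i)}.
  by under eq_fun do rewrite mxE; exact: ch.
have n0 : 0 < n%:R + 1 :> R by rewrite ltr_wpDl.
have e'0 : 0 < e / (n%:R + 1) by rewrite divr_gt0.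
have [r r0 Hr] := within_continuous_vector cH cx e'0.
have [z Oz zr] : exists2 z, Omega z & `|z - x| < r by have /closure_normP := cx; apply.
exists r => // y cy yr.
have -> : \sum_i (y - x) ord0 i * h i x = dot (y - x) (H x).
  by apply: eq_bigr => i _; rewrite [H x _ _]mxE.
have in01 (s : R) : 0 < s -> s <= 1 -> 0 <= 1 - s < 1.
  by move=> s0 s1; rewrite subr_ge0 s1 ltrBlDr ltrDl.
have step (s : R) : 0 < s -> s <= 1 ->
    `|f ((1 - s) *: y + (1 - (1 - s)) *: z) - f ((1 - s) *: x + (1 - (1 - s)) *: z)
      - (1 - s) * dot (y - x) (H x)| <= e * `|y - x|.
  move=> s0 s1; have s01 := in01 s s0 s1.
  set p := (1 - s) *: y + _; set q := (1 - s) *: x + _.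
  have Op : Omega p by exact: open_closure_segment.
  have Oq : Omega q by exact: open_closure_segment.
  have [t /andP[t0 t1] ->] := MVT_segment_domain oO cO Cf Oq Op.
  have pq : p - q = (1 - s) *: (y - x) by apply/rowP => i; rewrite !mxE; ring.
  set m := t *: p + _.
  have Om : Omega m by apply: cO => //; rewrite !ltW.
  have -> : grad f m = H m by apply/rowP => i; rewrite !mxE hf.
  rewrite pq dotZl -mulrBr -dotBr normrM.
  have mr : `|m - x| < r.
    have -> : m - x = t *: ((1 - s) *: (y - x) + (1 - (1 - s)) *: (z - x)) +
       (1 - t) *: ((1 - s) *: 0 + (1 - (1 - s)) *: (z - x)).
      by apply/rowP => i; rewrite !mxE; ring.
    have s01' : 0 <= 1 - s <= 1 by case/andP: s01 => -> /ltW ->.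
    apply: convex_norm_lt; rewrite ?(ltW t0) ?(ltW t1)//; apply: convex_norm_lt => //.
    by rewrite normr0.
  case/andP: s01 => s00 s01.
  rewrite ger0_norm//; apply: (@le_trans _ _ `|dot (y - x) (H m - H x)|).
    by rewrite ler_piMl// ltW.
  apply: le_trans (dot_bound _ _) _; rewrite mulrAC ler_wpM2r//.
  apply: (@le_trans _ _ (n%:R * (e / (n%:R + 1)))).
    by rewrite ler_wpM2l// Hr//; exact: subset_closure.
  by rewrite mulrCA ler_piMr ?(ltW e0)// ler_pdivrMr// mul1r lerDl.
apply/ler_addgt0Pr => d d0.
pose D := `|dot (y - x) (H x)|.
pose d' := d / 4; have d'0 : 0 < d' by rewrite divr_gt0.
have /within_continuous_normP cg' := cg.
have [ry ry0 Hy] := cg' y cy d' d'0; have [rx rx0 Hx] := cg' x cx d' d'0.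
pose B := 1 + `|z - y| + `|z - x| + D.
have D0 : 0 <= D by exact: normr_ge0.
have B0 : 0 < B by rewrite /B -!addrA ltr_pwDl// !addr_ge0.
(* So small that [g p] and [g q] are within d / 4 of [g y] and [g x], and that s [D] <= d / 4: three
   errors, which fit in d. The final half makes the inequalities strict. *)
pose s := Num.min 1 (Num.min (rx / B) (Num.min (ry / B) (d' / B))) / 2.
have m0 : 0 < Num.min 1 (Num.min (rx / B) (Num.min (ry / B) (d' / B))).
  by rewrite !lt_min ltr01 !divr_gt0.
have s0 : 0 < s by rewrite divr_gt0.
have : s < Num.min 1 (Num.min (rx / B) (Num.min (ry / B) (d' / B))).
  by rewrite /s ltr_pdivrMr// ltr_pMr// ltr1n.
rewrite !lt_min => /and4P[s1 sx sy sd].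
have := step s s0 (ltW s1).
set p := (1 - s) *: y + _; set q := (1 - s) *: x + _.
have Op : Omega p by apply: open_closure_segment => //; exact: in01 (ltW s1).
have Oq : Omega q by apply: open_closure_segment => //; exact: in01 (ltW s1).
have py : `|g p - g y| <= d'.
  apply: Hy; first exact: subset_closure.
  have -> : p - y = s *: (z - y) by apply/rowP => i; rewrite !mxE; ring.
  rewrite normrZ gtr0_norm//; rewrite ltr_pdivlMr// in sy; apply: le_lt_trans sy.
  rewrite ler_wpM2l ?(ltW s0)// /B; have := normr_ge0 (z - x); have := normr_ge0 (dot (y - x) (H x)).
  rewrite -/D; lra.
have qx : `|g q - g x| <= d'.
  apply: Hx; first exact: subset_closure.
  have -> : q - x = s *: (z - x) by apply/rowP => i; rewrite !mxE; ring.
  rewrite normrZ gtr0_norm//; rewrite ltr_pdivlMr// in sx; apply: le_lt_trans sx.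
  rewrite ler_wpM2l ?(ltW s0)// /B; have := normr_ge0 (z - y); have := normr_ge0 (dot (y - x) (H x)).
  rewrite -/D; lra.
have sD : s * D <= d'.
  rewrite ltr_pdivlMr// in sd; apply: le_trans (ltW sd).
  rewrite ler_wpM2l ?(ltW s0)// /B; have := normr_ge0 (z - y); have := normr_ge0 (z - x); lra.
rewrite -!gf// => st.
have -> : g y - g x - dot (y - x) (H x) =
  (g p - g q - (1 - s) * dot (y - x) (H x)) - (g p - g y) + (g q - g x) - s * dot (y - x) (H x).
  by ring.
apply: le_trans (ler_normB _ _) _; rewrite normrM gtr0_norm// -/D.
apply: (@le_trans _ _ (e * `|y - x| + d' + d' + d')); last by rewrite /d'; lra.
apply: lerD => //; apply: le_trans (ler_normD _ _) _; apply: lerD => //.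
by apply: le_trans (ler_normB _ _) _; apply: lerD.
Qed.

End expansion.

Section defining.
Variables (Omega U : set 'rV[R]_n) (rho : 'rV[R]_n -> R) (x0 : 'rV[R]_n).
Hypotheses (oO : open Omega) (cO : segment_convex Omega).
Hypotheses (D : local_defining Omega x0 U rho).

Let oU : open U. Proof. by case: D. Qed.
Let OmegaE y : U y -> (Omega y <-> rho y < 0). Proof. by case: D => _ _ _ H _; exact: H. Qed.
Let gn0 y : U y -> grad rho y != 0. Proof. by case: D => _ _ _ _; exact. Qed.
Let C2 k : Ck_open k U rho. Proof. by case: D => _ _ H _ _; exact: H. Qed.

Let drho y v : U y -> is_derive y v rho (dot v (grad rho y)).
Proof. by move=> Uy; exact: (@Ck_open_is_derive U rho 1 [::]). Qed.

Let continuous_rho y : U y -> continuous_at y rho.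
Proof. exact: (@Ck_open_continuous U rho 1 [::]). Qed.

Lemma defining_decrease y v : U y -> rho y = 0 -> dot v (grad rho y) < 0 ->
  exists2 r : R, 0 < r & forall t : R, 0 < t < r -> Omega (t *: v + y).
Proof.
move=> Uy y0 vN.
have c0 : 0 < - dot v (grad rho y) / 2 by rewrite divr_gt0// oppr_gt0.
have [r r0 Hr] := is_derive_expansion (drho v Uy) c0.
have [s s0 Hs] := open_normP oU Uy.
exists (Num.min r (s / (1 + `|v|))) => [|t /andP[t0]].
  by rewrite lt_min r0 divr_gt0// ltr_pwDl.
rewrite lt_min => /andP[tr ts].
have Ut : U (t *: v + y).
  apply: Hs; rewrite addrK normrZ gtr0_norm//.
  move: ts; rewrite ltr_pdivlMr ?ltr_pwDl//; apply: le_lt_trans.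
  by rewrite ler_wpM2l ?(ltW t0)// lerDr.
apply/(OmegaE Ut); have := Hr t; rewrite gtr0_norm// y0 subr0 => /(_ tr).
by rewrite ler_norml => /andP[_]; nra.
Qed.

Lemma defining_frontier y : U y -> rho y = 0 -> closure Omega y /\ ~ Omega y.
Proof.
move=> Uy y0; split; last by move/(OmegaE Uy); rewrite y0 ltxx.
have vN : dot (- grad rho y) (grad rho y) < 0.
  rewrite dotNl oppr_lt0 lt_neqAle dot_ge0 andbT eq_sym.
  by apply/negP => /eqP/dot_eq0/eqP; apply/negP; exact: gn0.
have [r r0 Hr] := defining_decrease Uy y0 vN.
apply/closure_normP => e e0.
set v := - grad rho y in vN Hr.
pose t := Num.min (r / 2) (e / (1 + `|v|) / 2).
have v0 : 0 < 1 + `|v| by rewrite ltr_pwDl.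
have t0 : 0 < t by rewrite lt_min !divr_gt0.
have tr : t < r by rewrite /t gt_min; apply/orP; left; lra.
exists (t *: v + y); first by apply: Hr; rewrite t0.
rewrite addrK normrZ gtr0_norm//.
have te : t < e / (1 + `|v|).
  have ev0 : 0 < e / (1 + `|v|) by rewrite divr_gt0.
  by rewrite /t gt_min; apply/orP; right; lra.
move: te; rewrite ltr_pdivlMr//; apply: le_lt_trans.
by rewrite ler_wpM2l ?(ltW t0)// lerDr.
Qed.

Lemma frontier_defining y : U y -> closure Omega y -> ~ Omega y -> rho y = 0.
Proof.
move=> Uy cy nOy; apply/eqP; rewrite eq_le; apply/andP; split; last first.
  by rewrite leNgt; apply/negP => /(OmegaE Uy).
apply/ler_addgt0Pr => e e0; rewrite add0r.
have [r r0 Hr] := (continuous_normP _ _).1 (continuous_rho Uy) e e0.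
have [s s0 Hs] := open_normP oU Uy.
have m0 : 0 < Num.min r s by rewrite lt_min r0.
have [z Oz] := (closure_normP _ _).1 cy _ m0; rewrite lt_min => /andP[/Hr zr /Hs Uz].
move: zr; rewrite /= ler_norml => /andP[zr _].
by have /(OmegaE Uz) := Oz; lra.
Qed.

(** If (z - y) . grad rho(y) were positive for some z in Omega, rho would be positive just after y
    on the segment towards z, whereas [open_closure_segment] puts these points in Omega. Density
    extends this to the closure. *)
Lemma defining_supporting y z : U y -> rho y = 0 -> closure Omega z ->
  dot (z - y) (grad rho y) <= 0.
Proof.
move=> Uy y0 cz.
have [cy nOy] := defining_frontier Uy y0.
suff H z' : Omega z' -> dot (z' - y) (grad rho y) <= 0.
  set N := grad rho y in H *.
  have c0 : 0 < n%:R * `|N| + 1 by rewrite ltr_wpDl// mulr_ge0.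
  apply/ler_addgt0Pr => e e0; rewrite add0r.
  have e'0 : 0 < e / (n%:R * `|N| + 1) by rewrite divr_gt0.
  have [z' Oz' zz'] := (closure_normP _ _).1 cz _ e'0.
  have -> : z - y = (z' - y) - (z' - z) by apply/rowP => i; rewrite !mxE; ring.
  rewrite dotBl; have := H _ Oz'.
  suff : - dot (z' - z) N <= e by lra.
  apply: le_trans (ler_norm _) _; rewrite normrN.
  apply: le_trans (dot_bound _ _) _; rewrite mulrAC.
  rewrite ltr_pdivlMr// in zz'; apply: le_trans (ltW zz').
  by rewrite mulrC ler_wpM2l// lerDl.
move=> Oz; rewrite leNgt; apply/negP => d0.
set d := dot _ _ in d0.
have d20 : 0 < d / 2 by rewrite divr_gt0.
have [r r0 Hr] := is_derive_expansion (drho (z' - y) Uy) d20.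
have [s s0 Hs] := open_normP oU Uy.
pose v := z' - y; have v0 : 0 < 1 + `|v| by rewrite ltr_pwDl.
pose t := Num.min (r / 2) (Num.min 1 (s / (1 + `|v|) / 2)).
have t0 : 0 < t by rewrite !lt_min ltr01 !divr_gt0.
have t1 : t <= 1 by rewrite /t !ge_min lexx !orbT.
have tr : t < r by rewrite /t gt_min; apply/orP; left; lra.
have ts : t < s / (1 + `|v|).
  have ev0 : 0 < s / (1 + `|v|) by rewrite divr_gt0.
  by rewrite /t !gt_min; apply/orP; right; apply/orP; right; lra.
have Ut : U (t *: v + y).
  apply: Hs; rewrite addrK normrZ gtr0_norm//.
  move: ts; rewrite ltr_pdivlMr//; apply: le_lt_trans.
  by rewrite ler_wpM2l ?(ltW t0)// lerDr.
have Ot : Omega (t *: v + y).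
  have -> : t *: v + y = (1 - t) *: y + (1 - (1 - t)) *: z'.
    by apply/rowP => i; rewrite !mxE; ring.
  by apply: open_closure_segment => //; rewrite subr_ge0 t1 ltrBlDr ltrDl.
have := Hr t; rewrite gtr0_norm// y0 subr0 => /(_ tr).
rewrite ler_norml => /andP[H _]; have /(OmegaE Ut) := Ot.
by move: H; rewrite -/d -/v; nra.
Qed.

(** Each w with w . N < 0 enters Omega, hence v . w <= 0. Applied to w = m - d N, where m is the
    part of v orthogonal to N, this forces m = 0. *)
Lemma normal_cone y v : U y -> rho y = 0 ->
  (forall z, Omega z -> dot v (z - y) <= 0) ->
  exists2 c : R, 0 <= c & v = c *: grad rho y.
Proof.
move=> Uy y0 Hv; set N := grad rho y.
have N0 : 0 < dot N N.
  rewrite lt_neqAle dot_ge0 andbT eq_sym.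
  by apply/negP => /eqP/dot_eq0/eqP; apply/negP; exact: gn0.
have K w : dot w N < 0 -> dot v w <= 0.
  move=> wN; have [r r0 Hr] := defining_decrease Uy y0 wN.
  have r2 : 0 < r / 2 by rewrite divr_gt0.
  have := Hv (r / 2 *: w + y); rewrite addrK dotZr pmulr_rle0//; apply.
  by apply: Hr; rewrite r2; lra.
pose c := dot v N / dot N N; pose m := v - c *: N.
have mN : dot m N = 0 by rewrite /m dotBl dotZl divfK ?subrr// lt0r_neq0.
have c0 : 0 <= c.
  rewrite /c divr_ge0 ?(ltW N0)//.
  by have := K (- N); rewrite dotNl dotNr oppr_lt0 oppr_le0; apply.
exists c => //; apply/eqP; rewrite -subr_eq0 -/m; apply/eqP/dot_eq0.
apply/eqP; rewrite eq_le dot_ge0 andbT leNgt; apply/negP => mm.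
have vm : dot v m = dot m m.
  have -> : v = m + c *: N by rewrite /m subrK.
  by rewrite dotDl dotZl (dotC N m) mN mulr0 addr0.
have b0 : 0 < 1 + `|dot v N| by rewrite ltr_pwDl.
(* Chosen so that d (v . N) is at most half of |m|^2. *)
pose d := dot m m / (1 + `|dot v N|) / 2.
have d0 : 0 < d by rewrite !divr_gt0.
have := K (m - d *: N); rewrite dotBl dotZl mN sub0r oppr_lt0 mulr_gt0// => /(_ isT).
rewrite dotBr dotZr vm.
have : d * dot v N < dot m m.
  apply: (@le_lt_trans _ _ (d * (1 + `|dot v N|))).
    by rewrite ler_wpM2l ?(ltW d0)//; have := ler_norm (dot v N); lra.
  by rewrite /d mulrAC divfK ?lt0r_neq0//; lra.
lra.
Qed.

Lemma grad_lipschitz x : U x -> exists2 L : R, 0 <= L & exists2 r : R, 0 < r &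
  forall y, `|y - x| < r -> `|grad rho y - grad rho x| <= L * `|y - x|.
Proof.
move=> Ux.
pose c i : R := \sum_j `|partial j (partial i rho) x| + n%:R.
have c0 i : 0 <= c i by rewrite /c addr_ge0// sumr_ge0.
pose L := \sum_i c i.
have L0 : 0 <= L by apply: sumr_ge0.
have Li i : c i <= L by rewrite /L (bigD1 i)//= lerDl sumr_ge0.
exists L => //.
have : \forall y \near x, U y /\ forall i j, `|partial j (partial i rho) y - partial j (partial i rho) x| <= 1.
  apply: filterI; first exact: open_nbhs_nbhs.
  have := @filter_forall _ _ (fun i y => forall j,
    `|partial j (partial i rho) y - partial j (partial i rho) x| <= 1) (nbhs x) _.
  apply => i.
  have := @filter_forall _ _ (fun j y =>
    `|partial j (partial i rho) y - partial j (partial i rho) x| <= 1) (nbhs x) _.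
  apply => j; apply: (near_normP x _).2.
  have cij : continuous_at x (partial j (partial i rho)).
    exact: (@Ck_open_continuous U rho 2 [:: j; i]).
  exact: ((continuous_normP _ _).1 cij 1 ltr01).
move=> /near_normP[r r0 Hr]; exists r => // y yr.
apply: mx_norm_le => [|i].
  exact: mulr_ge0.
apply: (@le_trans _ _ (c i * `|y - x|)); last first.
  by rewrite ler_wpM2r.
rewrite !mxE.
have := @increment_partials _ _ (partial i rho) x r 1 (y - x) ltr01 _ yr.
rewrite subrK mul1r => /(_ _)/wrap[z zr j|H].
  have [Uz Hz] := Hr z zr; split; last exact: Hz.
  exact: (@Ck_open_derivable U rho 2 [:: i]).
rewrite -[X in `|X|](subrK (\sum_j (y - x) ord0 j * partial j (partial i rho) x)).
rewrite /c; apply: le_trans (ler_normD _ _) _; rewrite mulrDl [leRHS]addrC lerD//.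
  exact: le_trans H (sum_norm_bound _).
apply: le_trans (ler_norm_sum _ _ _) _; rewrite mulr_suml ler_sum// => j _.
by rewrite normrM mulrC ler_wpM2l// mx_coord_le_norm.
Qed.

(** Provides frontier points x + t v + o(t) in a tangent direction v. The intermediate value theorem
    in s replaces the implicit function theorem: to first order rho is s |N|^2, which changes sign
    between s = - d t and s = d t. *)
Lemma frontier_curve x v (d : R) : U x -> rho x = 0 -> dot v (grad rho x) = 0 ->
  0 < d -> exists2 t0 : R, 0 < t0 & forall t : R, 0 < t < t0 ->
  exists s : R, [/\ `|s| <= d * t, U (s *: grad rho x + (t *: v + x)) &
    rho (s *: grad rho x + (t *: v + x)) = 0].
Proof.
move=> Ux rx0 vN d0; set N := grad rho x in vN *.
have NN : 0 < dot N N.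
  rewrite lt_neqAle dot_ge0 andbT eq_sym.
  by apply/negP => /eqP/dot_eq0/eqP; apply/negP; exact: gn0.
pose W := `|v| + d * `|N| + 1.
have W0 : 0 < W by rewrite ltr_wpDl// addr_ge0// mulr_ge0// ltW.
have n0 : 0 < n%:R + 1 :> R by rewrite ltr_wpDl.
(* Keeps the expansion error n e t [W] below half of d t |N|^2, so that rho has the sign of s at
   both ends. *)
pose e := d * dot N N / (2 * (n%:R + 1) * W).
have e0 : 0 < e by rewrite divr_gt0 ?mulr_gt0.
have : \forall y \near x, U y /\ forall i, `|partial i rho y - partial i rho x| <= e.
  apply: filterI; first exact: open_nbhs_nbhs.
  have := @filter_forall _ _ (fun i y =>
    `|partial i rho y - partial i rho x| <= e) (nbhs x) _.
  apply => i; apply: (near_normP x _).2.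
  have ci : continuous_at x (partial i rho).
    exact: (@Ck_open_continuous U rho 1 [:: i]).
  exact: ((continuous_normP _ _).1 ci e e0).
move=> /near_normP[r r0 Hr]; exists (r / W) => [|t /andP[t0 tr]]; first by rewrite divr_gt0.
pose w (s : R) := s *: N + t *: v.
have wW (s : R) : `|s| <= d * t -> `|w s| <= t * W.
  move=> sd; apply: le_trans (ler_normD _ _) _; rewrite !normrZ (gtr0_norm t0) /W.
  have : `|s| * `|N| <= d * t * `|N| by rewrite ler_wpM2r.
  by move=> H; rewrite !mulrDr; lra.
have wr (s : R) : `|s| <= d * t -> `|w s| < r.
  by move=> sd; apply: le_lt_trans (wW s sd) _; rewrite -ltr_pdivlMr.
have Uw (s : R) : `|s| <= d * t -> U (s *: N + (t *: v + x)).
  move=> sd; have [|Uy _] := Hr (s *: N + (t *: v + x)) => //.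
  by rewrite addrA addrK; exact: wr.
have approx (s : R) : `|s| <= d * t ->
    `|rho (s *: N + (t *: v + x)) - s * dot N N| <= d * t * dot N N / 2.
  move=> sd.
  have := @increment_partials _ _ rho x r e (w s) e0 _ (wr s sd).
  move=> /(_ _)/wrap[y yr i|].
    have [Uy Hy] := Hr y yr; split; last exact: Hy.
    exact: (@Ck_open_derivable U rho 1 [::]).
  rewrite -dot_grad -/N dotDl !dotZl vN mulr0 addr0 rx0 subr0 addrA.
  move=> /le_trans; apply; apply: (@le_trans _ _ (e * (n%:R * (t * W)))).
    rewrite ler_wpM2l ?(ltW e0)//; apply: le_trans (sum_norm_bound _) _.
    by rewrite ler_wpM2l// wW.
  rewrite /e.
  have -> : d * dot N N / (2 * (n%:R + 1) * W) * (n%:R * (t * W)) =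
     d * t * dot N N / 2 * (n%:R / (n%:R + 1)).
    by field; rewrite !lt0r_neq0.
  rewrite ler_piMr//; first by rewrite !mulr_ge0// ltW.
  by rewrite ler_pdivrMr// mul1r lerDl.
have dt0 : 0 < d * t by rewrite mulr_gt0.
have ab : - (d * t) <= d * t by rewrite ge0_cp// ltW.
have cont : {within `[- (d * t), d * t], continuous (fun s : R => rho (s *: N + (t *: v + x)))}.
  apply: derivable_within_continuous => s; rewrite in_itv/= -ler_norml => sd.
  by have /is_derive_line[] := drho N (Uw s sd).
have [|s] := @IVT R (fun s : R => rho (s *: N + (t *: v + x))) _ _ 0 ab cont.
  have := approx (d * t); have := approx (- (d * t)).
  rewrite normrN gtr0_norm// lexx => /(_ isT) A1 /(_ isT) A2.
  have dtN : 0 < d * t * dot N N by rewrite mulr_gt0.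
  rewrite ge_min le_max; apply/andP; split; apply/orP; [left|right].
    by move: A1; rewrite ler_norml => /andP[_]; lra.
  by move: A2; rewrite ler_norml => /andP[]; lra.
by rewrite in_itv/= -ler_norml => sd r0'; exists s; split => //; exact: Uw.
Qed.

End defining.
End boundary.

(** * Boundary flux under the Neumann condition *)

Section neumann.
Context {R : realType} {n : nat}.
Implicit Types (x y z v w : 'rV[R]_n).
Local Opaque partial.
Variables (Omega U : set 'rV[R]_n) (rho u : 'rV[R]_n -> R) (x0 : 'rV[R]_n).
Variables (g : 'rV[R]_n -> 'rV[R]_n) (h : 'I_n -> 'I_n -> 'rV[R]_n -> R).
Hypotheses (oO : open Omega) (cO : segment_convex Omega).
Hypotheses (D : local_defining Omega x0 U rho).
Hypotheses (Cu : forall i, Ck_open 1 Omega (partial i u)).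
Hypotheses (cg : forall i, {within closure Omega, continuous (fun x => g x ord0 i)}).
Hypotheses (gE : forall x i, Omega x -> g x ord0 i = partial i u x).
Hypotheses (ch : forall j i, {within closure Omega, continuous (h j i)}).
Hypotheses (hE : forall j i x, Omega x -> h j i x = partial j (partial i u) x).
Hypothesis neumann : forall y, U y -> rho y = 0 -> dot (g y) (grad rho y) = 0.

(** The extended Hessian of u applied to v; thus [hessian x (g x)] is the gradient of |grad u|^2 /
    2. *)
Let hessian x v : 'rV[R]_n := \row_i \sum_j v ord0 j * h j i x.

Let hessianD x v w (s t : R) :
  hessian x (s *: v + t *: w) = s *: hessian x v + t *: hessian x w.
Proof.
apply/rowP => i; rewrite !mxE !mulr_sumr -big_split/=.
by apply: eq_bigr => j _; rewrite !mxE; ring.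
Qed.

Let gradient_expansion x (e : R) : closure Omega x -> 0 < e ->
  exists2 r : R, 0 < r & forall y, closure Omega y -> `|y - x| < r ->
    `|g y - g x - hessian x (y - x)| <= e * `|y - x|.
Proof.
move=> cx e0.
have : \forall y \near within (closure Omega) (nbhs x), forall i,
    `|g y ord0 i - g x ord0 i - \sum_j (y - x) ord0 j * h j i x| <= e * `|y - x|.
  have := @filter_forall _ _ (fun i y =>
    `|g y ord0 i - g x ord0 i - \sum_j (y - x) ord0 j * h j i x| <= e * `|y - x|)
    (within (closure Omega) (nbhs x)) _.
  apply => i; apply: (near_within_normP _ _ _).2.
  pose gi y := g y ord0 i.
  have cgi : {within closure Omega, continuous gi} by exact: cg.
  have [r r0 Hr] := @closure_expansion _ _ Omega (partial i u) gi
    (fun j => h j i) oO cO (Cu i) cgi (fun z Oz => @gE z i Oz)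
    (fun j => @ch j i) (fun j z Oz => @hE j i z Oz) x e cx e0.
  by exists r => // y; exact: Hr.
move=> /near_within_normP[r r0 Hr]; exists r => // y cy yr.
apply: mx_norm_le => [|i]; first by rewrite mulr_ge0// ltW.
by rewrite !mxE; exact: Hr.
Qed.

(* Along boundary points y = x + t g(x) + o(t), expand N(y).g(y) = 0 to first
   order: monotonicity of the normals of a convex set gives the sign. *)
Lemma boundary_flux x : U x -> rho x = 0 ->
  dot (grad rho x) (hessian x (g x)) <= 0.
Proof.
move=> Ux rx0; set N := grad rho x; set v := g x.
have vN : dot v N = 0 by exact: neumann.
have [cx _] := defining_frontier D Ux rx0.
rewrite leNgt; apply/negP; set b := dot N _ => b0.
have [L L0 [rL rL0 HL]] := grad_lipschitz D Ux.
pose W := `|v| + `|N| + 1.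
have W0 : 0 < W by rewrite ltr_wpDl// addr_ge0.
pose c := dot N (hessian x N).
(* The sum of the coefficients of e t in the errors below. The conclusion t b <= t e Q contradicts e
   Q < b. *)
pose Q := `|c| + n%:R * `|N| * W + n%:R * L * W * (`|N| + 1) + 1.
have N0 : 0 <= `|N| by [].
have A0 : 0 <= n%:R * `|N| * W by rewrite !mulr_ge0// ltW.
have B0 : 0 <= n%:R * L * W * (`|N| + 1) by rewrite !mulr_ge0 ?(ltW W0)// addr_ge0.
have Q0 : 0 < Q by rewrite ltr_wpDl// !addr_ge0.
pose e := Num.min 1 (b / Q / 2).
have e0 : 0 < e by rewrite lt_min ltr01 !divr_gt0.
have e1 : e <= 1 by rewrite ge_min lexx.
have eQ : e * Q < b.
  have : e <= b / Q / 2 by rewrite ge_min lexx orbT.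
  rewrite -(ler_pM2r Q0) => /le_lt_trans; apply.
  by rewrite mulrAC divfK ?lt0r_neq0//; lra.
have [rE rE0 HE] := gradient_expansion cx e0.
have [rC rC0 HC] := within_continuous_vector cg cx e0.
have [t0 t00 Ht] := frontier_curve D Ux rx0 vN e0.
pose r := Num.min rL (Num.min rE rC).
have r0 : 0 < r by rewrite !lt_min rL0 rE0.
have [t [tp tt0 tW]] : exists t : R, [/\ 0 < t, t < t0 & t * W < r].
  have m0 : 0 < Num.min t0 (r / W) by rewrite lt_min t00 divr_gt0.
  set m := Num.min _ _ in m0.
  have mt : m <= t0 by rewrite ge_min lexx.
  have mr : m <= r / W by rewrite ge_min lexx orbT.
  have m2 : m / 2 < m by rewrite ltr_pdivrMr// ltr_pMr// ltr1n.
  exists (m / 2); split; first by rewrite divr_gt0.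
    exact: lt_le_trans m2 mt.
  by rewrite -ltr_pdivlMr//; exact: lt_le_trans m2 mr.
have tt : 0 < t < t0 by rewrite tp.
have [s [st Uy ry0]] := Ht t tt.
move: Uy ry0; rewrite -/N; set y := _ + _ => Uy ry0.
have yx : y - x = s *: N + t *: v by rewrite /y addrA addrK.
have yW : `|y - x| <= t * W.
  rewrite yx; apply: le_trans (ler_normD _ _) _; rewrite !normrZ (gtr0_norm tp) /W.
  have : `|s| * `|N| <= t * `|N|.
    rewrite ler_wpM2r//; apply: le_trans st _.
    by rewrite ler_piMl// ltW.
  by rewrite !mulrDr; lra.
have := le_lt_trans yW tW; rewrite !lt_min => /and3P[yL yE yC].
have [cy _] := defining_frontier D Uy ry0.
set Ny := grad rho y.
have gNy : dot (g y) Ny = 0 by exact: neumann.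
have S1 : dot (x - y) Ny <= 0 by apply: (defining_supporting oO cO D Uy ry0).
have S2 : dot (y - x) N <= 0 by apply: (defining_supporting oO cO D Ux rx0).
have NyL : `|N - Ny| <= L * (t * W).
  by rewrite distrC; apply: le_trans (HL y yL) _; rewrite ler_wpM2l.
have gC : `|g y - g x| <= e by exact: HC.
have E1 : `|dot N (g y - g x - hessian x (y - x))| <= n%:R * `|N| * W * (e * t).
  apply: le_trans (dot_bound _ _) _.
  rewrite -!mulrA ler_wpM2l// ler_wpM2l//.
  apply: le_trans (HE y cy yE) _; rewrite mulrCA ler_wpM2l ?(ltW e0)//.
  by rewrite mulrC.
have P1 : dot N (g y) = dot N (g y - g x - hessian x (y - x)) + s * c + t * b.
  pose E := g y - g x - hessian x (y - x).
  have gy : g y = E + v + (s *: hessian x N + t *: hessian x v).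
    by rewrite -hessianD -yx /E addrAC subrK subrK.
  rewrite {1}gy -/E !dotDr !dotZr (dotC N v) vN /c /b; ring.
(* The Neumann condition at y allows N to be replaced by N - Ny, and t g(x) = (y - x) - s N. The
   first term has a sign by monotonicity of the normals; the other two are o(t^2), as N - Ny is O(t)
   while s is o(t) and g(y) - g(x) is o(1). *)
have P2 : t * dot N (g y) = dot (N - Ny) (y - x) - s * dot (N - Ny) N + t * dot (N - Ny) (g y - g x).
  have : dot (N - Ny) (g y) = dot N (g y) by rewrite dotBl (dotC Ny) gNy subr0.
  move=> <-; rewrite -!dotZr -dotBr -dotDr; congr (dot _ _).
  by rewrite yx -/v (addrC (s *: N)) addrK scalerBr addrC subrK.
(* The sum of the supporting inequalities at x and at y: here convexity gives the sign. *)
have P3 : dot (N - Ny) (y - x) <= 0.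
  move: S1 S2; rewrite -(opprB y x) dotNl !(dotBl N) !(dotC (y - x)); lra.
have P4 : - s * dot (N - Ny) N <= e * t * (n%:R * (L * (t * W)) * `|N|).
  apply: le_trans (ler_norm _) _; rewrite normrM normrN ler_pM//.
  apply: le_trans (dot_bound _ _) _; rewrite ler_wpM2r// ler_wpM2l//.
have P5 : dot (N - Ny) (g y - g x) <= n%:R * (L * (t * W)) * e.
  apply: le_trans (ler_norm _) _; apply: le_trans (dot_bound _ _) _.
  by rewrite ler_pM ?mulr_ge0// ler_wpM2l.
have P6 : dot N (g y) <= t * (e * (n%:R * L * W * (`|N| + 1))).
  rewrite -(ler_pM2l tp) P2.
  have : t * dot (N - Ny) (g y - g x) <= t * (n%:R * (L * (t * W)) * e).
    by rewrite ler_wpM2l ?(ltW tp).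
  move: P3 P4; rewrite mulNr.
  move: (dot (N - Ny) (y - x)) (dot (N - Ny) N) (dot (N - Ny) (g y - g x)) => p q w P3 P4 P5'.
  have -> : t * (t * (e * (n%:R * L * W * (`|N| + 1)))) =
     e * t * (n%:R * (L * (t * W)) * `|N|) + t * (n%:R * (L * (t * W)) * e) by ring.
  lra.
have P7 : - (s * c) <= e * t * `|c|.
  by apply: le_trans (ler_norm _) _; rewrite normrN normrM ler_wpM2r.
have E2 : - dot N (g y - g x - hessian x (y - x)) <= n%:R * `|N| * W * (e * t).
  by apply: le_trans (ler_norm _) _; rewrite normrN.
have : t * b <= t * (e * Q).
  move: P1 P6 P7 E2; rewrite /Q; move: (dot N (g y)) (dot N _) => p q -> P6 P7 E2.
  have -> : t * (e * (`|c| + n%:R * `|N| * W + n%:R * L * W * (`|N| + 1) + 1)) =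
    e * t * `|c| + n%:R * `|N| * W * (e * t) + t * (e * (n%:R * L * W * (`|N| + 1))) + t * e by ring.
  have te : 0 < t * e by rewrite mulr_gt0.
  lra.
by rewrite ler_pM2l// leNgt eQ.
Qed.

End neumann.

(** * Energy estimates *)

Section within_algebra.
Context {R : realType} {n : nat} (A : set 'rV[R]_n).
Implicit Types (f g : 'rV[R]_n -> R).

Lemma within_continuousT f : (forall x, continuous_at x f) ->
  {within A, continuous f}.
Proof. by move=> cf; apply: continuous_subspaceT => x; exact: cf. Qed.

Lemma within_continuousD f g : {within A, continuous f} ->
  {within A, continuous g} -> {within A, continuous (fun x => f x + g x)}.
Proof. by move=> cf cg x; apply: continuous_atD; [exact: cf|exact: cg]. Qed.

Lemma within_continuousM f g : {within A, continuous f} ->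
  {within A, continuous g} -> {within A, continuous (fun x => f x * g x)}.
Proof. by move=> cf cg x; apply: continuous_atM; [exact: cf|exact: cg]. Qed.

Lemma within_continuous_sum m (F : 'I_m -> 'rV[R]_n -> R) :
  (forall i, {within A, continuous (F i)}) ->
  {within A, continuous (fun x => \sum_i F i x)}.
Proof. by move=> cF x; apply: continuous_at_sum => i; exact: cF. Qed.

Lemma within_continuous_comp (h : R -> R) f : {within A, continuous f} ->
  continuous h -> {within A, continuous (fun x => h (f x))}.
Proof. by move=> cf ch x; apply: continuous_at_comp; [exact: cf|exact: ch]. Qed.

Lemma within_continuous_bounded f (a : 'rV[R]_n) (S : R) : closed A ->
  {within A, continuous f} ->
  exists C : R, forall x, A x -> `|x - a| <= S -> `|f x| <= C.
Proof.
move=> clA cf.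
pose B := A `&` [set x | `|x - a| <= S].
have cB : compact B.
  apply: bounded_closed_compact.
    exists (`|a| + S); split; first exact: num_real.
    move=> m Mm y [_ /= yM]; apply: le_trans (ltW Mm).
    by rewrite -[y](subrK a) addrC; apply: le_trans (ler_normD _ _) _; rewrite lerD2l.
  apply: closedI => //.
  move=> y /closure_normP cy; apply/ler_addgt0Pr => e e0.
  have [z /= zS zy] := cy e e0.
  apply: le_trans (ler_distD z _ _) _; rewrite addrC lerD// distrC; exact: ltW.
have cfB : {within B, continuous f}.
  by apply: continuous_subspaceW cf; exact: subIsetl.
have /ex_strict_bound_gt0[C _ HC] : bounded_set (f @` B).
  exact/compact_bounded/continuous_compact.
by exists C => x Ax xS; apply: ltW; apply: HC; exists x.
Qed.

End within_algebra.

(** After k doublings (2^(n+1))^k m(S) <= B (2^k S)^n, that is 2^k m(S) <= B S^n. As k is arbitrary,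
    m(S) = 0. *)
Lemma geometric_growth_eq0 (R : realType) n (m : R -> R) (B S0 : R) : 0 < S0 ->
  (forall S, 0 <= m S) -> (forall S, 0 < S -> m S <= B * S ^+ n) ->
  (forall S, S0 <= S -> 2 ^+ n.+1 * m S <= m (2 * S)) ->
  forall S, S0 <= S -> m S = 0.
Proof.
move=> S00 m0 mB mS S S0S; have Sp : 0 < S by exact: lt_le_trans S0S.
have iter k : (2 ^+ n.+1) ^+ k * m S <= m (2 ^+ k * S).
  elim: k => [|k ih]; first by rewrite !expr0 !mul1r.
  rewrite [in leLHS]exprS [in leRHS]exprS -!mulrA.
  apply: le_trans (mS _ _); last first.
    apply: le_trans S0S _; rewrite ler_peMl ?(ltW Sp)//.
    by rewrite exprn_ege1// ler1n.
  by rewrite ler_wpM2l// exprn_ge0.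
have B0 : 0 <= B * S ^+ n by apply: le_trans (mB S Sp).
have bound k : m S <= B * S ^+ n / k.+1%:R.
  have k20 : 0 < 2 ^+ k :> R by rewrite exprn_gt0.
  have H : 2 ^+ k * m S <= B * S ^+ n.
    have := le_trans (iter k) (mB _ (mulr_gt0 k20 Sp)).
    have -> : (2 ^+ n.+1) ^+ k = (2 ^+ k) ^+ n * 2 ^+ k :> R.
      by rewrite -!exprM mulSn addnC exprD (mulnC n).
    have -> : B * (2 ^+ k * S) ^+ n = (2 ^+ k) ^+ n * (B * S ^+ n).
      by rewrite exprMn; ring.
    by rewrite -mulrA ler_pM2l// exprn_gt0.
  rewrite ler_pdivlMr// mulrC; apply: le_trans H.
  by rewrite ler_wpM2r// -natrX ler_nat ltn_expl.
apply/eqP; rewrite eq_le m0 andbT; apply/ler_addgt0Pr => e e0; rewrite add0r.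
have e'0 : 0 < e / (B * S ^+ n + 1) by rewrite divr_gt0// ltr_wpDl.
have [k _ /(_ k (leqnn k)) /= ke] := near_infty_natSinv_lt (PosNum e'0).
apply: le_trans (bound k) _; move: ke; rewrite ltr_pdivlMr ?ltr_wpDl// => /ltW.
by apply: le_trans; rewrite mulrC ler_wpM2l// lerDl.
Qed.

(** * The stability inequality for a test function that is not normalized *)

Section stability.
Context {R : realType} {n : nat}.
Local Notation mu := (lebesgue_row R n).
Local Notation e_ i := (delta_mx ord0 i : 'rV[R]_n).
Local Opaque partial.
Implicit Types (x y z : 'rV[R]_n).

Lemma integrable_EFinZ (D : set 'rV[R]_n) (c : R) (f : 'rV[R]_n -> R) :
  measurable D -> mu.-integrable D (EFin \o f) ->
  mu.-integrable D (EFin \o (fun x => c * f x)).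
Proof.
move=> mD intf.
have -> : EFin \o (fun x => c * f x) = (fun x => c%:E * (EFin \o f) x)%E by [].
exact: integrableZl.
Qed.

Lemma enorm_grad_sqr (psi : 'rV[R]_n -> R) x :
  enorm (grad psi x) ^+ 2 = \sum_i partial i psi x ^+ 2.
Proof. by rewrite enorm_sqr; apply: eq_bigr => i _; rewrite mxE expr2. Qed.

Lemma Lnorm2_restrict (Omega : set 'rV[R]_n) (psi : 'rV[R]_n -> R) :
  measurable Omega -> mu.-integrable Omega (EFin \o (fun x => psi x ^+ 2)) ->
  \int[mu]_(x in Omega) (psi x ^+ 2) = 1 ->
  'N[mu]_2%:E[(EFin \o psi) \_ Omega]%E = 1%E.
Proof.
move=> mO iO I1; rewrite unlock /Lnorm.
have -> : (\int[mu]_x `|((EFin \o psi) \_ Omega) x| `^ 2 =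
    \int[mu]_(x in Omega) (psi x ^+ 2)%:E)%E.
  rewrite [RHS]integral_mkcond; apply: eq_integral => x _.
  rewrite !patchE; case: ifPn => _ /=.
    by rewrite -[2%R]/(2%:R) powR_mulrn// real_normK ?num_real.
  by rewrite normr0 powR0.
rewrite -(fineK (integrable_fin_num mO iO)) -[fine _]/(\int[mu]_(x in Omega) (psi x ^+ 2)).
by rewrite I1 poweR1r.
Qed.

(* The bound |Q| <= C psi^2 serves the case int psi^2 = 0, in which psi cannot
   be normalized. *)
Lemma stable_test (Omega : set 'rV[R]_n) (f : R -> R) (u psi P Q : 'rV[R]_n -> R) (l C : R) :
  measurable Omega -> (l%:E <= lambda1 Omega f u)%E ->
  (forall c : R, C1_compact Omega (fun x => c * psi x)) ->
  (forall x i, Omega x -> derivable psi x (e_ i)) ->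
  (forall x, Omega x -> \sum_i partial i psi x ^+ 2 = P x) ->
  (forall x, Omega x -> derive1 f (u x) * psi x ^+ 2 = Q x) ->
  mu.-integrable Omega (EFin \o (fun x => psi x ^+ 2)) ->
  mu.-integrable Omega (EFin \o P) -> mu.-integrable Omega (EFin \o Q) ->
  (forall x, Omega x -> `|Q x| <= C * psi x ^+ 2) ->
  l * \int[mu]_(x in Omega) psi x ^+ 2 <= \int[mu]_(x in Omega) (P x - Q x).
Proof.
move=> mO lle Cpsi dpsi PE QE ipsi iP iQ QC.
set I := \int[mu]_(x in Omega) psi x ^+ 2.
have I0 : 0 <= I by apply: Rintegral_ge0 => x _; exact: sqr_ge0.
have iPQ := integrable_EFinB mO iP iQ.
have [Ieq|Ineq] := eqVneq I 0.
  rewrite Ieq mulr0 RintegralB//.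
  have P0 : 0 <= \int[mu]_(x in Omega) P x.
    by apply: Rintegral_ge0 => x Ox; rewrite -PE// sumr_ge0// => i _; exact: sqr_ge0.
  have Q0 : \int[mu]_(x in Omega) Q x <= 0.
    apply: (@le_trans _ _ (\int[mu]_(x in Omega) (C * psi x ^+ 2))).
      apply: le_Rintegral => //.
        exact: integrable_EFinZ.
      by move=> x Ox; apply: le_trans (ler_norm _) (QC x Ox).
    by rewrite RintegralZl// -/I Ieq mulr0.
  by rewrite subr_ge0 (le_trans Q0).
have Ip : 0 < I by rewrite lt_neqAle eq_sym Ineq.
pose c := (Num.sqrt I)^-1.
have c2 : c ^+ 2 = I^-1 by rewrite /c exprVn sqr_sqrtr.
have : (lambda1 Omega f u <= (c ^+ 2 * \int[mu]_(x in Omega) (P x - Q x))%:E)%E.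
  apply: ereal_inf_lbound; exists (fun x => c * psi x).
    split; first exact: Cpsi.
    apply: (@Lnorm2_restrict Omega) => //.
      by under [X in EFin \o X]eq_fun do rewrite exprMn; exact: integrable_EFinZ.
    under eq_Rintegral do rewrite exprMn.
    by rewrite RintegralZl// c2 mulVf.
  have iZ := integrable_EFinZ (c ^+ 2) mO iPQ.
  transitivity (\int[mu]_(x in Omega) (c ^+ 2 * (P x - Q x))%:E)%E.
    apply: eq_integral => x /[!inE] Ox; congr EFin.
    rewrite enorm_grad_sqr -PE// -QE// exprMn mulrBr mulr_sumr mulrCA; congr (_ - _).
    apply: eq_bigr => i _; rewrite -exprMn; congr (_ ^+ 2).
    apply: is_derive_partial.
    exact: (@is_deriveZ _ _ _ psi c x (e_ i) _ (partial_is_derive (dpsi x i Ox))).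
  by rewrite -(fineK (integrable_fin_num mO iZ)) -RintegralZl.
move=> /(le_trans lle); rewrite lee_fin c2 mulrC ler_pdivlMr//.
Qed.

End stability.

Lemma closed_row1 (R : realType) n (a : 'rV[R]_n) : closed [set a].
Proof.
move=> z /closure_normP cz; apply/eqP; rewrite -subr_eq0 -normr_le0.
apply/ler_addgt0Pr => e e0; rewrite add0r.
by have [y -> /ltW] := cz e e0; rewrite distrC.
Qed.

Lemma segment_convex1 (R : realType) n (a : 'rV[R]_n) : segment_convex [set a].
Proof. by move=> x y t -> -> _ /=; rewrite -scalerDl addrC subrK scale1r. Qed.

Section energy.
Context {R : realType} {n : nat}.
Local Notation mu := (lebesgue_row R n).
Local Notation e_ i := (delta_mx ord0 i : 'rV[R]_n).
Local Opaque partial.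
Implicit Types (x y z : 'rV[R]_n) (i j : 'I_n).
Variables (Omega : set 'rV[R]_n) (a : 'rV[R]_n) (r : R).
Variables (f : R -> R) (u : 'rV[R]_n -> R) (G : seq 'I_n -> 'rV[R]_n -> R).
Hypotheses (oO : open Omega) (cO : segment_convex Omega).
Hypotheses (r0 : 0 < r) (ar : forall y, `|y - a| < r -> Omega y).
Hypotheses (Cu : Ck_open 3 Omega u) (cu : {within closure Omega, continuous u}).
Hypotheses (cG : forall s, (size s <= 3)%N -> {within closure Omega, continuous (G s)}).
Hypotheses (GE : forall s x, (size s <= 3)%N -> Omega x -> G s x = partials s u x).
Hypotheses (fC1 : C1_real f).
Hypotheses (pde : forall x, Omega x -> - laplacian u x = f (u x)).

Hypotheses (smooth_Omega : smooth_boundary Omega).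
Hypotheses (neumann : forall x nu, frontier Omega x -> outward_normal Omega x nu ->
  normal_derivative Omega nu u x = 0).

Let mO : measurable Omega. Proof. exact: measurable_row_open. Qed.

Lemma Omega_near x (P : 'rV[R]_n -> Prop) : Omega x ->
  (forall y, Omega y -> P y) -> \forall y \near x, P y.
Proof.
move=> Ox OP; have : \forall y \near x, Omega y by exact: open_nbhs_nbhs.
by apply: filterS.
Qed.

Lemma near_eq_continuous (g h : 'rV[R]_n -> R) x :
  (\forall y \near x, g y = h y) -> continuous_at x g -> continuous_at x h.
Proof.
move=> gh cg; rewrite /continuous_at -(nbhs_singleton gh).
exact: cvg_trans (near_eq_cvg gh) cg.
Qed.

Lemma within_open_continuous (g : 'rV[R]_n -> R) x : {within closure Omega, continuous g} ->
  Omega x -> continuous_at x g.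
Proof.
move=> /within_continuous_normP cg Ox; apply/continuous_normP => e e0.
have [s s0 Hs] := cg x (subset_closure Ox) e e0.
have [t t0 Ht] := open_normP oO Ox.
exists (Num.min s t) => [|y]; first by rewrite lt_min s0.
by rewrite lt_min => /andP[ys yt]; apply: Hs => //; exact/subset_closure/Ht.
Qed.

(** [G s] is a continuous extension of [partials s u] to the closure, and differentiating in Omega
    prepends an index: [G [:: j; i]] is the j-th derivative of u_i. All later integrands are built
    from these functions, so that continuity up to the frontier is immediate. *)
Lemma is_derive_G s x i : (size s < 3)%N -> Omega x ->
  is_derive x (e_ i) (G s) (G (i :: s) x).
Proof.
move=> s3 Ox; rewrite GE//=.
apply: (@near_eq_is_derive _ _ _ (partials s u)).
  by apply: Omega_near => // y Oy; rewrite GE// ltnW.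
by apply: partial_is_derive; exact: (Ck_open_derivable s3 Cu).
Qed.

Lemma G_swap x i j : Omega x -> G [:: i; j] x = G [:: j; i] x.
Proof.
move=> Ox; have C2 : Ck_open 2 Omega u.
  by move=> s s2; have [H1 H2] := Cu (leqW s2); split => // s2'; apply: H2; exact: leqW.
exact: (etrans (@GE [:: i; j] x isT Ox)
  (etrans (@Ck_open_schwarz _ _ Omega u x j i oO C2 Ox) (esym (@GE [:: j; i] x isT Ox)))).
Qed.

Lemma G_swap3 x i j : Omega x -> G [:: i; j; i] x = G [:: j; i; i] x.
Proof.
move=> Ox; have C2 : Ck_open 2 Omega (partial i u).
  move=> s s2; have := Cu (s := rcons s i).
  rewrite size_rcons ltnS => /(_ s2).
  have -> : partials (rcons s i) u = partials s (partial i u).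
    by rewrite /partials foldr_rcons.
  by [].
exact: (etrans (@GE [:: i; j; i] x isT Ox)
  (etrans (@Ck_open_schwarz _ _ Omega (partial i u) x j i oO C2 Ox)
    (esym (@GE [:: j; i; i] x isT Ox)))).
Qed.

(** The equation differentiated along e_i. The derivatives are reordered as [[:: j; i; j]], the form
    in which they occur in div F. *)
Lemma linearized_pde x i : Omega x ->
  derive1 f (u x) * G [:: i] x = - \sum_j G [:: j; i; j] x.
Proof.
move=> Ox.
have D1 : is_derive x (e_ i) (f \o u) (derive1 f (u x) * G [:: i] x).
  apply: is_derive_comp1.
    rewrite derive1E; apply: DeriveDef => //.
    exact: fC1.1.
  rewrite GE//=; apply: partial_is_derive; exact: (@Ck_open_derivable _ _ Omega u 3 [::]).
have D2 : is_derive x (e_ i) (fun y => - \sum_j G [:: j; j] y) (- \sum_j G [:: i; j; j] x).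
  apply: is_deriveN.
  have -> : (fun y => \sum_j G [:: j; j] y) = \sum_j G [:: j; j].
    by apply/funext => y; rewrite fct_sumE.
  by apply: is_derive_sum => j; exact: is_derive_G.
have D3 : is_derive x (e_ i) (f \o u) (- \sum_j G [:: i; j; j] x).
  apply: near_eq_is_derive D2; apply: Omega_near => // y Oy /=.
  by rewrite -pde//; congr (- _); apply: eq_bigr => j _; rewrite GE.
have -> : derive1 f (u x) * G [:: i] x = - \sum_j G [:: i; j; j] x.
  by rewrite -(is_derive_partial D1) (is_derive_partial D3).
by congr (- _); apply: eq_bigr => j _; rewrite G_swap3.
Qed.

Lemma neumann_grad U rho x0 y : local_defining Omega x0 U rho -> U y -> rho y = 0 ->
  dot (\row_i G [:: i] y) (grad rho y) = 0.
Proof.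
move=> D Uy ry0; have [cy nOy] := defining_frontier D Uy ry0.
have Fy : frontier Omega y by split => // /interior_subset.
have Dy : local_defining Omega y U rho by case: D => ? ? ? ? ?; split.
pose N := enorm (grad rho y).
have N0 : N != 0.
  apply/eqP => N0; have := enorm_sqr (grad rho y); rewrite -/N N0 expr0n/= => /esym/dot_eq0/eqP.
  by case: D => _ _ _ _ /(_ y Uy) /negbTE ->.
have := neumann Fy (ex_intro _ U (ex_intro _ rho (conj Dy erefl))).
rewrite /normal_derivative -/N => H.
suff : N^-1 * dot (\row_i G [:: i] y) (grad rho y) = 0.
  by move/eqP; rewrite mulf_eq0 invr_eq0 (negbTE N0)/= => /eqP.
rewrite -[RHS]H /dot mulr_sumr; apply: eq_bigr => i _.
rewrite (@within_closure_lim _ _ Omega (G [:: i]) (partial i u) y)//; last 2 first.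
- exact: cG.
- by move=> z Oz; rewrite GE.
by rewrite !mxE; ring.
Qed.

(** By [normal_cone] such a v is a nonnegative multiple of grad rho, and [boundary_flux] applies.
    This form, free of defining functions, is what [uniform_normal_bound] requires. *)
Lemma normal_hessian_le0 x v : closure Omega x -> ~ Omega x ->
  (forall z, Omega z -> dot v (z - x) <= 0) ->
  dot (\row_j \sum_i G [:: i; j] x * G [:: i] x) v <= 0.
Proof.
move=> cx nOx Hv.
have [U [rho D]] : exists U rho, local_defining Omega x U rho.
  by apply: smooth_Omega; split => // /interior_subset.
have Ux : U x by case: D.
have rx := frontier_defining D Ux cx nOx.
have [c c0 ->] := normal_cone D Ux rx Hv.
rewrite dotC dotZl mulr_ge0_le0//.
have flux := @boundary_flux _ _ Omega U rho u x (fun y => \row_i G [:: i] y)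
  (fun j i => G [:: j; i]) oO cO D.
have C1 i : Ck_open 1 Omega (partial i u).
  move=> s s1; have := Cu (s := rcons s i).
  have -> : partials (rcons s i) u = partials s (partial i u).
    by rewrite /partials foldr_rcons.
  rewrite size_rcons => /(_ (leqW s1))[H1 H2]; split => // s1'; apply: H2.
  exact: leqW.
have cg i : {within closure Omega, continuous (fun y => (\row_k G [:: k] y) ord0 i)}.
  by under eq_fun do rewrite mxE; exact: cG.
have gE y i : Omega y -> (\row_k G [:: k] y) ord0 i = partial i u y.
  by move=> Oy; rewrite mxE GE.
have hE j i y : Omega y -> G [:: j; i] y = partial j (partial i u) y.
  by move=> Oy; rewrite GE.
have := flux C1 cg gE (fun j i => @cG [:: j; i] isT) hE (fun y => neumann_grad D) x Ux rx.
suff -> : (\row_i \sum_j (\row_k G [:: k] x) ord0 j * G [:: j; i] x) =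
  \row_j \sum_i G [:: i; j] x * G [:: i] x by [].
by apply/rowP => j; rewrite !mxE; apply: eq_bigr => i _; rewrite mxE mulrC.
Qed.

Section cutoff_scale.
Variable S : R.
Hypothesis S0 : 0 < S.

(** For this set the nearest point is always a, [chi] depends only on the Euclidean distance to a,
    and [kap] is its gradient. The Euclidean norm dominates the sup norm, so both vanish where |x -
    a| >= S. *)
Let K : set 'rV[R]_n := [set a].
Let K0 : K !=set0. Proof. by exists a. Qed.
Let clK : closed K. Proof. exact: closed_row1. Qed.
Let cvxK : segment_convex K. Proof. exact: segment_convex1. Qed.

Let nearestK x : nearest K x = a. Proof. by have := nearest_in K0 clK x. Qed.

Let dist2K x : dist2 K x = dot (x - a) (x - a).
Proof. by rewrite /dist2 /sqdist nearestK. Qed.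

Let chi := cutoff K S.
Let kap x j : R := cut_slope K S x * (x - a) ord0 j.

Let is_derive_chi x j : is_derive x (e_ j) chi (kap x j).
Proof.
have := is_derive_cut K0 clK cvxK S0 x (e_ j).
by rewrite dot_delta nearestK.
Qed.

Let far_dist x : S <= `|x - a| -> S ^+ 2 <= dist2 K x.
Proof.
move=> xS; rewrite dist2K leNgt; apply/negP => /(norm_lt_dot S0).
by rewrite ltNge xS.
Qed.

Let chi_far x : S <= `|x - a| -> chi x = 0.
Proof. by move=> /far_dist; exact: cut_far0. Qed.

Let kap_far x j : S <= `|x - a| -> kap x j = 0.
Proof. by move=> /far_dist; rewrite /kap => /(cut_slope_far0 S0) ->; rewrite mul0r. Qed.

Let cchi : {within closure Omega, continuous chi}.
Proof. by apply: within_continuousT => x; exact: continuous_cut. Qed.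

Let ckap j : {within closure Omega, continuous (kap ^~ j)}.
Proof.
apply: within_continuousT => x; apply: continuous_atM.
  exact: continuous_cut_slope.
under eq_fun do rewrite mxE [X in _ + X]mxE.
by apply: continuous_atB; [exact: continuous_coord|exact: continuous_at_cst].
Qed.

Lemma integrable_compact_support (g : 'rV[R]_n -> R) : {within closure Omega, continuous g} ->
  (forall x, Omega x -> S <= `|x - a| -> g x = 0) ->
  mu.-integrable Omega (EFin \o g) /\
  exists2 C : R, 0 <= C & forall x, Omega x -> `|g x| <= C.
Proof.
move=> cg gS.
have [C HC] := within_continuous_bounded a S (@closed_closure _ Omega) cg.
have H x : Omega x -> `|g x| <= Num.max C 0.
  move=> Ox; have [xS|xS] := leP `|x - a| S.
    by rewrite le_max (HC x (subset_closure Ox) xS).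
  by rewrite gS ?(ltW xS)// normr0 le_max lexx orbT.
split; last by exists (Num.max C 0); rewrite ?le_max ?lexx ?orbT.
apply: (@integrable_Omega _ _ Omega a oO S g (Num.max C 0)) => //.
by move=> x Ox; exact: within_open_continuous.
Qed.

Let psi i x : R := chi x * G [:: i] x.
Let dpsi i j x : R := chi x * G [:: j; i] x + kap x j * G [:: i] x.

Let is_derive_psi i j x : Omega x -> is_derive x (e_ j) (psi i) (dpsi i j x).
Proof.
move=> Ox; have := @is_deriveM _ _ chi (G [:: i]) x (e_ j) _ _ (is_derive_chi x j)
  (@is_derive_G [:: i] x j isT Ox).
suff -> : chi x *: G [:: j; i] x + G [:: i] x *: kap x j = dpsi i j x by [].
by rewrite /dpsi; congr (_ + _); exact: mulrC.
Qed.

Let cdpsi i j : {within closure Omega, continuous (dpsi i j)}.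
Proof.
by apply: within_continuousD; apply: within_continuousM => //; exact: cG.
Qed.

(** The test function chi u_i, with a factor c left free for its normalization. It need not vanish
    on the frontier of Omega; compactness comes from [chi] alone. *)
Lemma C1_compact_psi i (c : R) : C1_compact Omega (fun x => c * psi i x).
Proof.
have cpsi : {within closure Omega, continuous (fun x => c * psi i x)}.
  apply: within_continuousM; first by apply: within_continuousT => x; exact: continuous_at_cst.
  by apply: within_continuousM => //; exact: cG.
have cdp j : {within closure Omega, continuous (fun x => c * dpsi i j x)}.
  apply: within_continuousM => //.
  by apply: within_continuousT => x; exact: continuous_at_cst.
have D j x : Omega x -> is_derive x (e_ j) (fun x => c * psi i x) (c * dpsi i j x).
  by move=> Ox; exact: (@is_deriveZ _ _ _ (psi i) c x (e_ j) _ (is_derive_psi i j Ox)).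
have P1 j x : Omega x -> partial j (fun x => c * psi i x) x = c * dpsi i j x.
  by move=> Ox; exact: is_derive_partial (D j x Ox).
split.
  split=> //.
  - move=> [|j [|//]] _; split => //=.
    + by move=> x Ox; exact: within_open_continuous.
    + by move=> _ j x Ox; have [] := D j x Ox.
    + move=> x Ox; apply: near_eq_continuous (within_open_continuous (cdp j) Ox).
      by apply: Omega_near => // y Oy; rewrite P1.
  - move=> [|j [|//]] _ /=; first by exists (fun x => c * psi i x).
    by exists (fun x => c * dpsi i j x); split => // x Ox; rewrite P1.
apply: bounded_closed_compact; last exact: closed_closure.
exists (`|a| + S); split; first exact: num_real.
move=> m Mm y cy; apply: le_trans (ltW Mm).
apply/ler_addgt0Pr => e e0; have [z [_ /= z0] zy] := (closure_normP _ _).1 cy e e0.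
have zS : `|z - a| < S.
  rewrite ltNge; apply/negP => zS; move: z0.
  by rewrite /psi chi_far// mul0r mulr0 eqxx.
have -> : y = a + (z - a) - (z - y) by apply/rowP => k; rewrite !mxE; ring.
apply: le_trans (ler_normB _ _) _; rewrite lerD ?(ltW zy)//.
by apply: le_trans (ler_normD _ _) _; rewrite lerD2l ltW.
Qed.

(* F = chi^2 grad (|grad u|^2 / 2). *)
Let F x : 'rV[R]_n := \row_j (chi x ^+ 2 * \sum_i G [:: i; j] x * G [:: i] x).
Let dF j x : R := 2 * chi x * kap x j * (\sum_i G [:: i; j] x * G [:: i] x) +
  chi x ^+ 2 * (\sum_i (G [:: j; i; j] x * G [:: i] x + G [:: i; j] x * G [:: j; i] x)).

Let is_derive_F j x : Omega x -> is_derive x (e_ j) (fun y => F y ord0 j) (dF j x).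
Proof.
move=> Ox.
have D1 : is_derive x (e_ j) (\sum_i (G [:: i; j] * G [:: i]))
    (\sum_i (G [:: j; i; j] x * G [:: i] x + G [:: i; j] x * G [:: j; i] x)).
  apply: is_derive_sum => i.
  have := @is_deriveM _ _ (G [:: i; j]) (G [:: i]) x (e_ j) _ _
    (@is_derive_G [:: i; j] x j isT Ox) (@is_derive_G [:: i] x j isT Ox).
  suff -> : G [:: i; j] x *: G [:: j; i] x + G [:: i] x *: G [:: j; i; j] x =
    G [:: j; i; j] x * G [:: i] x + G [:: i; j] x * G [:: j; i] x by [].
  by rewrite addrC; congr (_ + _); exact: mulrC.
have D2 := @is_deriveM _ _ chi chi x (e_ j) _ _ (is_derive_chi x j) (is_derive_chi x j).
have := @is_deriveM _ _ _ _ x (e_ j) _ _ D2 D1.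
have -> : chi * chi * \sum_i (G [:: i; j] * G [:: i]) = (fun y => F y ord0 j).
  by apply/funext => y; rewrite mxE /= !fctE fct_sumE expr2.
suff -> : (chi * chi) x *: (\sum_i (G [:: j; i; j] x * G [:: i] x + G [:: i; j] x * G [:: j; i] x)) +
  (\sum_i (G [:: i; j] * G [:: i])) x *: (chi x *: kap x j + chi x *: kap x j) = dF j x by [].
rewrite /dF fct_sumE addrC; congr (_ + _).
have sc (p q : R) : p *: q = p * q by [].
by rewrite !sc; ring.
Qed.

Let cF j : {within closure Omega, continuous (fun y => F y ord0 j)}.
Proof.
under eq_fun do rewrite mxE expr2.
apply: within_continuousM; first exact: within_continuousM.
by apply: within_continuous_sum => i; apply: within_continuousM; exact: cG.
Qed.

Let cdF j : {within closure Omega, continuous (dF j)}.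
Proof.
apply: within_continuousD; apply: within_continuousM.
- apply: within_continuousM => //; apply: within_continuousM => //.
  by apply: within_continuousT => x; exact: continuous_at_cst.
- by apply: within_continuous_sum => i; apply: within_continuousM; exact: cG.
- by under eq_fun do rewrite expr2; exact: within_continuousM.
- apply: within_continuous_sum => i; apply: within_continuousD;
    by apply: within_continuousM; exact: cG.
Qed.


Lemma integral_div_F_le0 : \int[mu]_(x in Omega) (\sum_j dF j x) <= 0.
Proof.
have PF j x : Omega x -> partial j (fun y => F y ord0 j) x = dF j x.
  by move=> Ox; exact: is_derive_partial (is_derive_F j Ox).
have F0 j x : Omega x -> S <= `|x - a| -> F x ord0 j = 0.
  by move=> _ xS; rewrite mxE chi_far// expr0n mul0r.
have dF0 j x : Omega x -> S <= `|x - a| -> dF j x = 0.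
  by move=> _ xS; rewrite /dF chi_far// expr0n/= mulr0 !mul0r addr0.
have bF j : exists C : R, forall x, Omega x -> `|F x ord0 j| <= C /\ `|dF j x| <= C.
  have [_ [C1 C10 H1]] := integrable_compact_support (@cF j) (@F0 j).
  have [_ [C2 C20 H2]] := integrable_compact_support (@cdF j) (@dF0 j).
  exists (C1 + C2) => x Ox; split.
    by apply: le_trans (H1 x Ox) _; rewrite lerDl.
  by apply: le_trans (H2 x Ox) _; rewrite lerDr.
have [C HC] := choice bF.
have HC' j x : Omega x -> `|F x ord0 j| <= \sum_k `|C k| /\ `|dF j x| <= \sum_k `|C k|.
  move=> Ox; have [H1 H2] := HC j x Ox.
  have H : C j <= \sum_k `|C k|.
    by rewrite (bigD1 j)//= (le_trans (ler_norm _))// lerDl sumr_ge0.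
  by split; [exact: le_trans H1 H|exact: le_trans H2 H].
have -> : \int[mu]_(x in Omega) (\sum_j dF j x) =
    \int[mu]_(x in Omega) (\sum_j partial j (fun y => F y ord0 j) x).
  by apply: eq_Rintegral => x /[!inE] Ox; apply: eq_bigr => j _; rewrite PF.
apply: (@integral_divergence_le0 _ _ Omega a r oO cO r0 ar F (\sum_k `|C k|) S).
- by move=> j x Ox; have [] := is_derive_F j Ox.
- by move=> j x Ox; exact: within_open_continuous (@cF j) Ox.
- move=> j x Ox; apply: near_eq_continuous (within_open_continuous (@cdF j) Ox).
  by apply: Omega_near => // y Oy; rewrite PF.
- by move=> j x Ox; exact: (HC' j x Ox).1.
- by move=> j x Ox; rewrite PF//; exact: (HC' j x Ox).2.
- by move=> x Ox xS; apply/rowP => j; rewrite F0// mxE.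
- by move=> j x Ox xS; rewrite PF// dF0.
(* F is grad w times the nonnegative factor chi^2, so the sign in the normal directions is inherited
   from [normal_hessian_le0]. *)
- apply: (@uniform_normal_bound _ _ Omega a r oO cO r0 ar F S (@cF)).
  move=> x v cx nOx Hv.
  have -> : F x = chi x ^+ 2 *: \row_j \sum_i G [:: i; j] x * G [:: i] x.
    by apply/rowP => j; rewrite !mxE.
  by rewrite dotZl mulr_ge0_le0 ?sqr_ge0// normal_hessian_le0.
Qed.

(** Here [W] is |grad u|^2, [P i] is |grad (chi u_i)|^2, and [Q i] is f'(u) (chi u_i)^2 with f'
    eliminated by the linearized equation. *)
Let W x : R := \sum_i G [:: i] x ^+ 2.
Let P i x : R := \sum_j dpsi i j x ^+ 2.
Let Q i x : R := - (chi x ^+ 2 * G [:: i] x * \sum_j G [:: j; i; j] x).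

(** In |grad (chi u_i)|^2 the terms with |grad chi|^2 give the first product. The cross terms, the
    terms chi^2 u_ij^2 and those of [Q] are exactly the product rule for div (chi^2 grad w). *)
Let energy_identity x : Omega x ->
  \sum_i (P i x - Q i x) = (\sum_j kap x j ^+ 2) * W x + \sum_j dF j x.
Proof.
move=> Ox.
have -> : \sum_i (P i x - Q i x) = \sum_i \sum_j (kap x j ^+ 2 * G [:: i] x ^+ 2 +
   (2 * chi x * kap x j * (G [:: i; j] x * G [:: i] x) +
    chi x ^+ 2 * (G [:: j; i; j] x * G [:: i] x + G [:: i; j] x * G [:: j; i] x))).
  apply: eq_bigr => i _; rewrite /P /Q opprK mulr_sumr -big_split/=.
  apply: eq_bigr => j _; rewrite /dpsi (G_swap i j Ox).
  move: (chi x) (kap x j) (G [:: j; i] x) (G [:: i] x) (G [:: j; i; j] x) => p1 p2 p3 p4 p5.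
  by ring.
rewrite exchange_big mulr_suml -big_split/=; apply: eq_bigr => j _.
by rewrite big_split/= -mulr_sumr; congr (_ + _); rewrite /dF big_split/= -!mulr_sumr.
Qed.

Let Q_E i x : Omega x -> derive1 f (u x) * psi i x ^+ 2 = Q i x.
Proof.
move=> Ox; rewrite /psi /Q.
have -> : derive1 f (u x) * (chi x * G [:: i] x) ^+ 2 =
   chi x ^+ 2 * G [:: i] x * (derive1 f (u x) * G [:: i] x) by ring.
by rewrite linearized_pde// mulrN.
Qed.

Let cW : {within closure Omega, continuous W}.
Proof.
apply: within_continuous_sum => i; under eq_fun do rewrite expr2.
by apply: within_continuousM; exact: cG.
Qed.

Let cpsi i : {within closure Omega, continuous psi i}.
Proof. by apply: within_continuousM => //; exact: cG. Qed.

Let csqr (g : 'rV[R]_n -> R) : {within closure Omega, continuous g} ->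
  {within closure Omega, continuous (fun x => g x ^+ 2)}.
Proof. by move=> cg; under eq_fun do rewrite expr2; exact: within_continuousM. Qed.

Let ipsi i : mu.-integrable Omega (EFin \o (fun x => psi i x ^+ 2)).
Proof.
have [] // := integrable_compact_support (csqr (@cpsi i)).
by move=> x _ xS; rewrite /psi chi_far// mul0r expr0n.
Qed.

Let iP i : mu.-integrable Omega (EFin \o P i).
Proof.
have [] // := @integrable_compact_support (P i).
  by apply: within_continuous_sum => j; exact: csqr.
by move=> x _ xS; rewrite /P big1// => j _; rewrite /dpsi chi_far// kap_far// !mul0r addr0 expr0n.
Qed.

Let iQ i : mu.-integrable Omega (EFin \o Q i).
Proof.
have [] // := @integrable_compact_support (fun x => (-1) * (chi x ^+ 2 * G [:: i] x * \sum_j G [:: j; i; j] x)).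
- apply: within_continuousM; first by apply: within_continuousT => x; exact: continuous_at_cst.
  apply: within_continuousM; first by apply: within_continuousM; [exact: csqr|exact: cG].
  by apply: within_continuous_sum => j; exact: cG.
- by move=> x _ xS; rewrite chi_far// expr0n/= !mul0r mulr0.
- have -> // : EFin \o Q i = EFin \o (fun x => (-1) * (chi x ^+ 2 * G [:: i] x * \sum_j G [:: j; i; j] x)).
  by apply/funext => x /=; rewrite mulN1r.
Qed.

Let ikap : mu.-integrable Omega (EFin \o (fun x => (\sum_j kap x j ^+ 2) * W x)).
Proof.
have [] // := @integrable_compact_support (fun x => (\sum_j kap x j ^+ 2) * W x).
  by apply: within_continuousM => //; apply: within_continuous_sum => j; exact: csqr.
by move=> x _ xS; rewrite big1 ?mul0r// => j _; rewrite kap_far// expr0n.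
Qed.

Let idF j : mu.-integrable Omega (EFin \o dF j).
Proof.
have [] // := @integrable_compact_support (dF j).
by move=> x _ xS; rewrite /dF chi_far// expr0n/= mulr0 !mul0r addr0.
Qed.

Let slope_energyE x : cut_slope [set a] S x ^+ 2 * dist2 [set a] x *
  \sum_i G [:: i] x ^+ 2 = (\sum_j kap x j ^+ 2) * W x.
Proof.
congr (_ * _); rewrite -/K dist2K mulr_sumr; apply: eq_bigr => j _.
by rewrite /kap exprMn; congr (_ * _); rewrite expr2.
Qed.

Lemma integrable_slope_energy : mu.-integrable Omega (EFin \o (fun x =>
  cut_slope [set a] S x ^+ 2 * dist2 [set a] x * \sum_i G [:: i] x ^+ 2)).
Proof. by under [X in EFin \o X]eq_fun do rewrite slope_energyE. Qed.

Lemma caccioppoli (l : R) : (l%:E <= lambda1 Omega f u)%E ->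
  l * \int[mu]_(x in Omega) (cutoff [set a] S x ^+ 2 * \sum_i G [:: i] x ^+ 2) <=
  \int[mu]_(x in Omega) (cut_slope [set a] S x ^+ 2 * dist2 [set a] x * \sum_i G [:: i] x ^+ 2).
Proof.
move=> lle.
have Hi i : l * \int[mu]_(x in Omega) psi i x ^+ 2 <= \int[mu]_(x in Omega) (P i x - Q i x).
  (* Omega and u may be unbounded; f'(u) is bounded on the ball that carries [chi], which suffices
     for [stable_test]. *)
  have [C HC] := within_continuous_bounded a S (@closed_closure _ Omega)
    (within_continuous_comp cu fC1.2).
  apply: (@stable_test _ _ Omega f u (psi i) (P i) (Q i) l C) => //.
  - exact: C1_compact_psi.
  - by move=> x j Ox; have [] := is_derive_psi i j Ox.
  - move=> x Ox; apply: eq_bigr => j _.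
    by rewrite (is_derive_partial (is_derive_psi i j Ox)).
  - move=> x Ox; exact: Q_E.
  - move=> x Ox; rewrite -Q_E// normrM [`|psi i x ^+ 2|]ger0_norm ?sqr_ge0//.
    have [xS|xS] := leP S `|x - a|.
      by rewrite /psi chi_far// mul0r expr0n/= !mulr0.
    by apply: ler_wpM2r; [exact: sqr_ge0|apply: HC (ltW xS); exact: subset_closure].
have [ipsiS psiS] := integrable_EFin_sum mO ipsi.
have iPQ i := integrable_EFinB mO (@iP i) (@iQ i).
have [iPQS PQS] := integrable_EFin_sum mO iPQ.
have [idFS _] := integrable_EFin_sum mO idF.
have -> : \int[mu]_(x in Omega) (cutoff [set a] S x ^+ 2 * \sum_i G [:: i] x ^+ 2) =
    \int[mu]_(x in Omega) \sum_i psi i x ^+ 2.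
  apply: eq_Rintegral => x _; rewrite mulr_sumr; apply: eq_bigr => i _.
  by rewrite -exprMn.
have -> : \int[mu]_(x in Omega) (cut_slope [set a] S x ^+ 2 * dist2 [set a] x *
     \sum_i G [:: i] x ^+ 2) = \int[mu]_(x in Omega) ((\sum_j kap x j ^+ 2) * W x).
  by apply: eq_Rintegral => x _; exact: slope_energyE.
apply: (@le_trans _ _ (\int[mu]_(x in Omega) \sum_i (P i x - Q i x))).
  by rewrite psiS PQS mulr_sumr; apply: ler_sum => i _; exact: Hi.
have -> : \int[mu]_(x in Omega) \sum_i (P i x - Q i x) =
    \int[mu]_(x in Omega) ((\sum_j kap x j ^+ 2) * W x + \sum_j dF j x).
  by apply: eq_Rintegral => x /[!inE] Ox; exact: energy_identity.
by rewrite RintegralD// gerDl integral_div_F_le0.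
Qed.


Lemma integrable_cutoff_energy : mu.-integrable Omega
  (EFin \o (fun x => cutoff [set a] S x ^+ 2 * \sum_i G [:: i] x ^+ 2)).
Proof.
have [] // := @integrable_compact_support (fun x => chi x ^+ 2 * W x).
  by apply: within_continuousM => //; exact: csqr.
by move=> x _ xS; rewrite chi_far// expr0n/= mul0r.
Qed.

Lemma cutoff_energy_support x : S <= `|x - a| -> cutoff [set a] S x = 0.
Proof. exact: chi_far. Qed.

End cutoff_scale.
End energy.

(** * From integral bounds to pointwise statements, and comparison of cutoffs *)

Section open_measure.
Context {R : realType} {n : nat}.
Local Notation mu := (lebesgue_row R n).
Variable Omega : set 'rV[R]_n.
Hypothesis oO : open Omega.

(** If a continuous h exceeded the essential bound M at one point, it would do so on a ball, which
    has positive measure. *)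
Lemma bounded_of_Lnorm_oo (h : 'rV[R]_n -> R) : (forall x, Omega x -> continuous_at x h) ->
  ('N[mu]_+oo[(fun x => (h x)%:E) \_ Omega] < +oo)%E ->
  exists M : R, forall x, Omega x -> h x <= M.
Proof.
move=> ch; rewrite unlock; case: ifPn => [_|muT] foo; last first.
  (* The branch of the norm for a space of measure 0; a ball about x refutes it. *)
  exists 0 => x Ox; have [s s0 _] := open_normP oO Ox.
  have B0 : (0 < mu (ball x s))%E by rewrite lebesgue_row_ball// lte_fin exprn_gt0// mulr_gt0.
  have : (mu (ball x s) <= mu setT)%E.
    by apply: le_measure; rewrite ?inE//; exact: measurable_row_ball.
  by move/(lt_le_trans B0) => muT'; rewrite muT' in muT.
have [M sM] : exists M : R, (ess_sup mu (abse \o ((fun x => (h x)%:E) \_ Omega)) <= M%:E)%E.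
  by move: foo; case: (ess_sup _ _) => [s _|//|_]; [exists s|exists 0; rewrite leNye].
have /ess_supP[N [mN N0 HN]] := sM.
exists M => x Ox; rewrite leNgt; apply/negP => Mh.
have [s s0 Hs] := (continuous_normP _ _).1 (ch x Ox) ((h x - M) / 2) ltac:(by rewrite divr_gt0// subr_gt0).
have [t t0 Ht] := open_normP oO Ox.
pose q := Num.min s t; have q0 : 0 < q by rewrite lt_min s0.
have qN : ball x q `<=` N.
  move=> y; rewrite -ball_normE/= distrC lt_min => /andP[ys yt]; apply: HN => /=.
  rewrite patchE mem_set/=; last exact: Ht.
  rewrite lee_fin; apply/negP; rewrite -ltNge; apply: lt_le_trans (ler_norm _).
  by have := Hs y ys; rewrite ler_norml => /andP[H _]; lra.
have : (mu (ball x q) <= mu N)%E.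
  by apply: le_measure; rewrite ?inE//; exact: measurable_row_ball.
by rewrite N0 lebesgue_row_ball// lee_fin leNgt exprn_gt0// mulr_gt0.
Qed.

Lemma integral_continuous_eq0 (g : 'rV[R]_n -> R) :
  (forall x, Omega x -> continuous_at x g) -> (forall x, Omega x -> 0 <= g x) ->
  mu.-integrable Omega (EFin \o g) -> \int[mu]_(x in Omega) g x = 0 ->
  forall x, Omega x -> g x = 0.
Proof.
move=> cg g0 ig Ig x Ox; apply/eqP; rewrite eq_le g0// andbT leNgt; apply/negP => gx.
have [s s0 Hs] := (continuous_normP _ _).1 (cg x Ox) (g x / 2) ltac:(by rewrite divr_gt0).
have [t t0 Ht] := open_normP oO Ox.
pose q := Num.min s t; have q0 : 0 < q by rewrite lt_min s0.
have mO := measurable_row_open oO.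
have mB := @measurable_row_ball R n x q.
have qO : ball x q `<=` Omega.
  by move=> y; rewrite -ball_normE/= distrC lt_min => /andP[_ yt]; exact: Ht.
have Boo : (mu (ball x q) < +oo)%E by rewrite lebesgue_row_ball// ltry.
have [iB IB] := @Rintegral_patch_cst _ _ Omega (ball x q) (g x / 2) mO mB Boo.
have : \int[mu]_(y in Omega) ((fun=> g x / 2) \_ (ball x q)) y <= \int[mu]_(y in Omega) g y.
  apply: le_Rintegral => // y Oy; rewrite patchE; case: ifPn => [|_]; last exact: g0.
  rewrite inE -ball_normE/= distrC lt_min => /andP[ys _].
  by have := Hs y ys; rewrite ler_norml => /andP[H _]; lra.
rewrite IB Ig setIidr// lebesgue_row_ball//= leNgt mulr_gt0//.
  by rewrite divr_gt0.
by rewrite exprn_gt0// mulr_gt0.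
Qed.

(** With t = d / s^2 < 1, d the squared distance, the left-hand side is 16 t (1 - t)^2 / s^2 <= 16 /
    s^2, while the cutoff at scale 2 s is (1 - t / 4)^2 >= 9 / 16, of square at least 1 / 4. Hence
    the constant 64 = 16 / (1 / 4). *)
Lemma slope_le_cutoff (K : set 'rV[R]_n) (s : R) x : 0 < s ->
  cut_slope K s x ^+ 2 * dist2 K x <= 64 / s ^+ 2 * cutoff K (2 * s) x ^+ 2.
Proof.
move=> s0; have s20 : 0 < s ^+ 2 by rewrite exprn_gt0.
have [h|h] := leP (s ^+ 2) (dist2 K x).
  by rewrite cut_slope_far0// expr0n/= mul0r mulr_ge0 ?sqr_ge0// divr_ge0// ltW.
rewrite /cut_slope /cutoff /possqr [(2 * s) ^+ 2]exprMn.
have := @dist2_ge0 R n K x; move: (dist2 K x) (s ^+ 2) s20 h => d c c0 dc d0.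
pose t := d / c; have t0 : 0 <= t by rewrite divr_ge0// ltW.
have t1 : t < 1 by rewrite ltr_pdivrMr// mul1r.
have -> : d = t * c by rewrite /t divfK// gt_eqF.
have -> : t * c / c = t by rewrite mulfK// gt_eqF.
have -> : t * c / (2 ^+ 2 * c) = t / 4 by field; rewrite gt_eqF.
rewrite !max_r; [|lra|lra].
have -> : (- (4 * (1 - t) / c)) ^+ 2 * (t * c) = 16 * (t * (1 - t) ^+ 2) / c.
  by field; rewrite gt_eqF.
rewrite [leRHS]mulrAC ler_pM2r ?invr_gt0//.
have H1 : t * (1 - t) ^+ 2 <= 1 by nra.
have H2 : 9 / 16 <= (1 - t / 4) ^+ 2 by nra.
have H3 : 1 / 4 <= ((1 - t / 4) ^+ 2) ^+ 2.
  by move: ((1 - t / 4) ^+ 2) H2 => p p1; nra.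
lra.
Qed.

End open_measure.

(** * Growth of the localized energy and its vanishing *)

Section liouville.
Context {R : realType} {n : nat}.
Local Notation mu := (lebesgue_row R n).
Implicit Types (x y z : 'rV[R]_n) (i j : 'I_n).
Variables (Omega : set 'rV[R]_n) (f : R -> R) (u : 'rV[R]_n -> R).
Variable G : seq 'I_n -> 'rV[R]_n -> R.
Hypotheses (oO : open Omega) (cO : segment_convex Omega).
Hypotheses (cu : {within closure Omega, continuous u}) (Cu : Ck_open 3 Omega u).
Hypotheses (cG : forall s, (size s <= 3)%N -> {within closure Omega, continuous (G s)}).
Hypotheses (GE : forall s x, (size s <= 3)%N -> Omega x -> G s x = partials s u x).

Let W x := \sum_i G [:: i] x ^+ 2.
Let mO := measurable_row_open oO.

Lemma continuous_energy x : Omega x -> continuous_at x W.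
Proof.
move=> Ox; apply: continuous_at_sum => i; apply: continuous_atX2.
have := @within_open_continuous _ _ Omega oO (G [:: i]) x (@cG [:: i] isT) Ox; exact.
Qed.

Lemma energy_bounded :
  ('N[mu]_+oo[(fun x => (enorm (grad u x))%:E) \_ Omega] < +oo)%E ->
  exists2 B : R, 0 <= B & forall x, Omega x -> W x <= B.
Proof.
move=> foo.
have gW x : Omega x -> enorm (grad u x) = Num.sqrt (W x).
  move=> Ox; rewrite /enorm; congr Num.sqrt; apply: eq_bigr => i _.
  by rewrite mxE GE.
have [M HM] : exists M : R, forall x, Omega x -> enorm (grad u x) <= M.
  apply: (@bounded_of_Lnorm_oo _ _ Omega oO (fun x => enorm (grad u x))) => // x Ox.
  apply: (@near_eq_continuous _ _ (fun y => Num.sqrt (W y))).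
    by apply: Omega_near Ox _ => // y Oy; rewrite gW.
  by apply: continuous_at_comp; [exact: continuous_energy|exact: sqrt_continuous].
exists (M ^+ 2) => [|x Ox]; first exact: sqr_ge0.
have W0 : 0 <= W x by apply: sumr_ge0 => i _; exact: sqr_ge0.
have := HM x Ox; rewrite gW// => H; rewrite -(sqr_sqrtr W0).
by rewrite ler_pXn2r// nnegrE ?sqrtr_ge0// (le_trans (sqrtr_ge0 _) H).
Qed.

Lemma cutoff_energy_growth a (B S : R) : 0 < S -> 0 <= B -> (forall x, Omega x -> W x <= B) ->
  \int[mu]_(x in Omega) (cutoff [set a] S x ^+ 2 * W x) <= B * 2 ^+ n * S ^+ n.
Proof.
move=> S0 B0 WB.
have mB := @measurable_row_ball R n a S.
have Boo : (mu (ball a S) < +oo)%E by rewrite lebesgue_row_ball// ltry.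
have [iB IB] := @Rintegral_patch_cst _ _ Omega (ball a S) B mO mB Boo.
apply: (@le_trans _ _ (\int[mu]_(y in Omega) ((fun=> B) \_ (ball a S)) y)).
  apply: le_Rintegral => //; first exact: integrable_cutoff_energy.
  move=> x Ox; rewrite patchE; case: ifPn => [_|].
    apply: le_trans (WB x Ox); rewrite ler_piMl//.
      by apply: sumr_ge0 => i _; exact: sqr_ge0.
    by rewrite expr_le1// ?cutoff_ge0// cutoff_le1.
  rewrite notin_setE -ball_normE/= distrC => /negP; rewrite -leNgt => xS.
  by rewrite cutoff_energy_support// expr0n mul0r.
rewrite IB -mulrA -exprMn ler_wpM2l// -lee_fin fineK.
  rewrite -(lebesgue_row_ball a S0); apply: le_measure; rewrite ?inE//.
  exact: measurableI.
rewrite ge0_fin_numE//; apply: le_lt_trans Boo.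
by apply: le_measure; rewrite ?inE//; exact: measurableI.
Qed.

(** The cutoffs are centred at the very point a where the energy is to vanish. As the cutoff equals
    1 there, the vanishing of the integral at a single scale gives W(a) = 0. *)
Lemma energy_eq0 (l : R) : smooth_boundary Omega -> C1_real f ->
  (forall x, Omega x -> - laplacian u x = f (u x)) ->
  (forall x nu, frontier Omega x -> outward_normal Omega x nu ->
    normal_derivative Omega nu u x = 0) ->
  ('N[mu]_+oo[(fun x => (enorm (grad u x))%:E) \_ Omega] < +oo)%E ->
  0 < l -> (l%:E <= lambda1 Omega f u)%E ->
  forall x, Omega x -> W x = 0.
Proof.
move=> sO fC1 pde neu foo l0 lle a Oa.
have [r r0 ar] := open_normP oO Oa.
have [B B0 WB] := energy_bounded foo.
pose m (S : R) := \int[mu]_(x in Omega) (cutoff [set a] S x ^+ 2 * W x).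
have W0 x : 0 <= W x by apply: sumr_ge0 => i _; exact: sqr_ge0.
have m0 S : 0 <= m S by apply: Rintegral_ge0 => x _; rewrite mulr_ge0// sqr_ge0.
have mS S : 0 < S -> l * m S <= 64 / S ^+ 2 * m (2 * S).
  move=> S0.
  have := caccioppoli oO cO r0 ar Cu cu cG GE fC1 pde sO neu S0 lle.
  move/le_trans; apply; have S20 : 0 < 2 * S by rewrite mulr_gt0.
  have i2 := integrable_cutoff_energy a oO cG S20.
  rewrite -RintegralZl//.
  apply: le_Rintegral => //.
  - exact: integrable_slope_energy.
  - exact: integrable_EFinZ.
  - move=> x Ox; rewrite [leRHS]mulrA; apply: ler_wpM2r; first exact: W0.
    exact: slope_le_cutoff.
(* For S >= S0 >= 1 one has l S^2 >= l S >= 64 2^(n+1), so the factor 64 / (l S^2) is at most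
   2^-(n+1). *)
pose S0 := 1 + 64 * 2 ^+ n.+1 / l.
have S01 : 1 <= S0 by rewrite lerDl divr_ge0// ?(ltW l0)// mulr_ge0// exprn_ge0.
have mgrow S : S0 <= S -> 2 ^+ n.+1 * m S <= m (2 * S).
  move=> SS; have S1 : 1 <= S by exact: le_trans SS.
  have Sp : 0 < S by exact: lt_le_trans S1.
  have H := mS S Sp.
  have lS : 64 * 2 ^+ n.+1 <= l * S.
    by rewrite [leRHS]mulrC -ler_pdivrMr//; apply: le_trans SS; rewrite lerDr.
  have lS2 : 64 * 2 ^+ n.+1 <= l * S ^+ 2.
    by apply: le_trans lS _; rewrite ler_pM2l// expr2 ler_peMl// ltW.
  have : l * m S * S ^+ 2 <= 64 * m (2 * S).
    by move: H; rewrite mulrAC ler_pdivlMr// exprn_gt0.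
  move: (m S) (m (2 * S)) (m0 S) lS2 => p q p0 lS2 pq.
  rewrite -(@ler_pM2l _ 64)// (le_trans _ pq)//.
  by rewrite mulrA [leRHS]mulrAC; exact: ler_wpM2r.
have S0p : 0 < S0 by exact: lt_le_trans S01.
have meq0 := @geometric_growth_eq0 R n m (B * 2 ^+ n) S0 S0p m0
  (fun S S0 => cutoff_energy_growth a S0 B0 WB) mgrow S0 (lexx _).
have H := @integral_continuous_eq0 _ _ Omega oO
  (fun x => cutoff [set a] S0 x ^+ 2 * W x) _ _ (integrable_cutoff_energy a oO cG S0p) meq0 a Oa.
have : cutoff [set a] S0 a ^+ 2 * W a = 0.
  apply: H => x Ox; last by rewrite mulr_ge0// sqr_ge0.
  apply: continuous_atM; last exact: continuous_energy.
  apply: continuous_atX2; apply: continuous_cut; [by exists a|exact: closed_row1|exact: segment_convex1].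
rewrite (_ : cutoff [set a] S0 a = 1) ?expr1n ?mul1r//.
by apply: cutoff_in => //; [exists a|exact: closed_row1].
Qed.

End liouville.

Theorem theorem1p4 (R : realType) (n : nat) (n_gt0 : (0 < n)%N)
    (Omega : set 'rV[R]_n) (f : R -> R)
    (smooth_convex_Omega : smooth_convex_domain Omega) (f_C1 : C1_real f)
    (u : 'rV[R]_n -> R) (u_solution : solution Omega f u)
    (u_stable : stable_nondegenerate Omega f u) :
  exists c : R, forall x, closure Omega x -> u x = c.
Proof.
have [oO [a Oa] /convex_set_segment cO sO] := smooth_convex_Omega.
have [[Cu cu eu] foo pde neu] := u_solution.
(* [lambda1] may be +oo; only a positive real lower bound is needed, for instance 1 in that case. *)
have [l l0 lle] : exists2 l : R, 0 < l & (l%:E <= lambda1 Omega f u)%E.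
  move: u_stable; rewrite /stable_nondegenerate.
  case: (lambda1 Omega f u) => [l l0|_|//]; first by exists l.
  by exists 1; rewrite ?leey.
(* The condition on the size is placed inside, so that [choice] yields one family over all
   sequences; for long ones u is a placeholder. *)
have exG s : exists g, (size s <= 3)%N -> {within closure Omega, continuous g} /\
    (forall x, Omega x -> g x = partials s u x).
  have [s3|s3] := leqP (size s) 3; last by exists u.
  by have [g Hg] := eu s s3; exists g.
have [G HG] := choice exG.
have cG s (s3 : (size s <= 3)%N) := (HG s s3).1.
have GE s x (s3 : (size s <= 3)%N) := (HG s s3).2 x.
have W0 := energy_eq0 oO cO cu Cu cG GE sO f_C1 pde neu foo l0 lle.
have grad0 x : Omega x -> grad u x = 0.
  move=> Ox; apply/rowP => i; rewrite !mxE -[LHS](@GE [:: i])//.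
  apply/eqP; rewrite -sqrf_eq0 eq_le sqr_ge0 andbT -(W0 x Ox) (bigD1 i)//= lerDl.
  by apply: sumr_ge0 => j _; exact: sqr_ge0.
have C1 : Ck_open 1 Omega u.
  move=> s s1; have [H1 H2] := Cu s (leq_trans s1 (isT : (1 <= 3)%N)); split => // s1'.
  by apply: H2; exact: leq_trans s1' (isT : (1 <= 3)%N).
have uO x : Omega x -> u x = u a.
  move=> Ox; have [t /andP[t0 t1] H] := MVT_segment_domain oO cO C1 Oa Ox.
  apply/eqP; rewrite -subr_eq0 H grad0; last first.
    by apply: cO => //; rewrite !ltW.
  by rewrite dotC -(scale0r 0) dotZl mul0r.
exists (u a) => x cx.
have ca : {within closure Omega, continuous (fun=> u a)}.
  by apply: within_continuousT => y; exact: continuous_at_cst.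
(* Both u(x) and the constant u(a) are the limit at x of u along Omega. *)
rewrite -(within_closure_lim cu (fun y _ => erefl) cx).
exact: within_closure_lim ca (fun y Oy => esym (uO y Oy)) cx.
Qed.
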